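(* Let $\Omega\subset\mathbb{R}^2$ be a bounded open Lipschitz domain, $\alpha\in(0,1)$, $\epsilon>0$, and let $u_-<u_m<u_+$ be real numbers and $\mathcal{N}(u)=u\,(u+u_--u_m)(u+u_--u_+)$. For any initial condition $u_0\in C_0(\Omega)$, let $u$ be the global-in-time solution of $$\partial_t u=-\epsilon^2(-\Delta)^\alpha u-\mathcal{N}(u)\ \text{ in }\Omega\times(0,\infty),\qquad u|_{\partial\Omega}=0,\qquad u(0)=u_0,$$ and assume $u\in C((0,\infty),\mathbb{H}^\alpha(\Omega))$. Define the $\omega$-limit set $$\omega(u_0)=\{y\in L^2(\Omega):\ \exists\, t_n\to\infty,\ u(t_n)\to y\text{ in }L^2(\Omega)\}.$$ Then: (i) $\omega(u_0)\neq\varnothing$; (ii) any $y\in\omega(u_0)$ is a stationary solution, i.e. $-\epsilon^2(-\Delta)^\alpha y-\mathcal{N}(y)=0$ in $\mathbb{H}^{-\alpha}(\Omega)$.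
   Context: $C_0(\Omega)=\{u\in C(\overline\Omega): u=0 \text{ on }\partial\Omega\}$ with the sup norm. Let $\{(\lambda_k,\varphi_k)\}_{k\ge1}$ be the Dirichlet eigenpairs of $-\Delta$ on $\Omega$, with $\{\varphi_k\}$ an orthonormal basis of $L^2(\Omega)$, and $u_k=\int_\Omega u\varphi_k\,dx$. The spectral fractional Laplacian is $(-\Delta)^\alpha u=\sum_k\lambda_k^\alpha u_k\varphi_k$; $\mathbb{H}^\alpha(\Omega)=\{u\in L^2(\Omega):\sum_k\lambda_k^\alpha|u_k|^2<\infty\}$ with norm $\|(-\Delta)^{\alpha/2}u\|_{L^2}$; $\mathbb{H}^{-\alpha}(\Omega)$ is its dual. The solution is understood through the Duhamel formula $u(t)=Q(t)u_0-\int_0^tQ(t-s)\mathcal{N}(u(s))\,ds$ in $C([0,\infty),C_0(\Omega))$, where $Q(t)=e^{-\epsilon^2(-\Delta)^\alpha t}$. The equation in $\mathbb{H}^{-\alpha}(\Omega)$ means $\epsilon^2\int_\Omega(-\Delta)^{\alpha/2}y\,(-\Delta)^{\alpha/2}\phi\,dx+\int_\Omega\mathcal{N}(y)\phi\,dx=0$ for all $\phi\in\mathbb{H}^\alpha(\Omega)$. *)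

(* Defs.v *)
From HB Require Import structures.
From mathcomp Require Import all_boot all_order all_algebra.
From mathcomp Require Import all_classical all_reals all_analysis.
Import Order.TTheory GRing.Theory Num.Theory.
Import numFieldNormedType.Exports.

Set Implicit Arguments.
Unset Strict Implicit.
Unset Printing Implicit Defensive.

Local Open Scope classical_set_scope.
Local Open Scope ring_scope.

(* Functions on Omega (or on its closure) are represented by total functions
   R * R -> R of which only the values on Omega (or its closure) matter. *)

Section Plane.
Context {R : realType}.
Implicit Types (f g : R * R -> R) (Omega : set (R * R)).

Definition leb2 := (@lebesgue_measure R \x @lebesgue_measure R)%E.

Definition boundary Omega : set (R * R) := closure Omega `\` interior Omega.

(* Near each boundary point, in suitable orthonormal coordinates centred at
   that point, Omega is the strict epigraph of a Lipschitz function. *)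
Definition lipschitz_boundary Omega : Prop :=
  forall p, boundary Omega p ->
  exists (c s r : R) (g : R -> R),
    [/\ c ^+ 2 + s ^+ 2 = 1, 0 < r, [lipschitz g x | x in [set: R]] &
        forall q, ball p r q ->
          (Omega q <->
           g (c * (q.1 - p.1) + s * (q.2 - p.2))
             < - s * (q.1 - p.1) + c * (q.2 - p.2))].

Definition lipschitz_domain Omega : Prop :=
  [/\ Omega !=set0, open Omega, bounded_set Omega & lipschitz_boundary Omega].

Definition e1 : R * R := (1, 0).
Definition e2 : R * R := (0, 1).

Fixpoint Cn (n : nat) f : Prop :=
  if n is m.+1 then
    [/\ continuous f,
        forall x, derivable f x e1 /\ derivable f x e2,
        Cn m ('D_e1 f) & Cn m ('D_e2 f)]
  else continuous f.

Definition test_function Omega f : Prop :=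
  [/\ forall n, Cn n f,
      compact (closure [set x | f x != 0]) &
      closure [set x | f x != 0] `<=` Omega].

Definition L2 Omega f : Prop :=
  measurable_fun Omega f /\
  leb2.-integrable Omega (EFin \o (fun x => f x ^+ 2)).

Definition L2dot Omega f g : R := (\int[leb2]_(x in Omega) (f x * g x))%R.

Definition L2norm Omega f : R := Num.sqrt (L2dot Omega f f).

Definition L2cvg Omega (F : nat -> R * R -> R) f : Prop :=
  (fun n => L2norm Omega (F n \- f)) @ \oo --> (0 : R).

Definition weak_gradient Omega f g1 g2 : Prop :=
  forall psi, test_function Omega psi ->
    L2dot Omega f ('D_e1 psi) = - L2dot Omega g1 psi /\
    L2dot Omega f ('D_e2 psi) = - L2dot Omega g2 psi.

(* f belongs to H^1(Omega), with weak gradient (g1, g2). *)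
Definition H1 Omega f g1 g2 : Prop :=
  [/\ L2 Omega f, L2 Omega g1, L2 Omega g2 & weak_gradient Omega f g1 g2].

(* f belongs to H^1_0(Omega), the closure of the test functions in
   H^1(Omega), with weak gradient (g1, g2). *)
Definition H10 Omega f g1 g2 : Prop :=
  H1 Omega f g1 g2 /\
  exists psi : nat -> R * R -> R,
    [/\ forall n, test_function Omega (psi n),
        L2cvg Omega psi f,
        L2cvg Omega (fun n => 'D_e1 (psi n)) g1 &
        L2cvg Omega (fun n => 'D_e2 (psi n)) g2].

Definition dirichlet_eigenpair Omega (l : R) f : Prop :=
  0 < L2norm Omega f /\
  exists g1 g2, H10 Omega f g1 g2 /\
    forall v h1 h2, H10 Omega v h1 h2 ->
      L2dot Omega g1 h1 + L2dot Omega g2 h2 = l * L2dot Omega f v.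

Definition orthonormal_basis Omega (phi : nat -> R * R -> R) : Prop :=
  [/\ forall k, L2 Omega (phi k),
      forall j k, L2dot Omega (phi j) (phi k) = (j == k)%:R &
      forall f, L2 Omega f ->
        L2cvg Omega
          (fun n x => \sum_(k < n) L2dot Omega f (phi k) * phi k x) f].

(* Indices start at 0 instead of 1. *)
Definition dirichlet_eigenbasis Omega (lambda : nat -> R)
    (phi : nat -> R * R -> R) : Prop :=
  orthonormal_basis Omega phi /\
  forall k, dirichlet_eigenpair Omega (lambda k) (phi k).

Definition C0 Omega f : Prop :=
  {within closure Omega, continuous f} /\ forall x, boundary Omega x -> f x = 0.

Definition sup_norm Omega f : R := sup [set `|f x| | x in closure Omega].

(* Continuity on the set of times I of a curve in a space with norm N. *)
Definition continuous_curve (N : (R * R -> R) -> R) (I : set R)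
    (u : R -> R * R -> R) : Prop :=
  forall t, I t -> N (u s \- u t) @[s --> within I (nbhs t)] --> (0 : R).

(* J is the Bochner integral over [a, b] of the L^2(Omega)-valued function F:
   the n-th approximating simple function is
   s |-> \sum_(i < m n) \1_(A n i) s *: v n i. *)
Definition bochner_integral Omega (a b : R) (F : R -> R * R -> R) J : Prop :=
  [/\ L2 Omega J,
      forall s, s \in `[a, b] -> L2 Omega (F s) &
      exists (m : nat -> nat) (A : nat -> nat -> set R)
             (v : nat -> nat -> R * R -> R),
      let err n s :=
        L2norm Omega (fun x => F s x - \sum_(i < m n) \1_(A n i) s * v n i x) in
      [/\ forall n i, measurable (A n i) /\ L2 Omega (v n i),
          forall n, lebesgue_measure.-integrable `[a, b] (EFin \o err n),
          (fun n => (\int[lebesgue_measure]_(s in `[a, b]) err n s)%R) @ \oo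
            --> (0 : R) &
          L2cvg Omega (fun n x => \sum_(i < m n)
            fine (lebesgue_measure (A n i `&` `[a, b])) * v n i x) J]].

End Plane.

Section SpectralFractionalLaplacian.
Context {R : realType}.
Variables (Omega : set (R * R)) (lambda : nat -> R) (phi : nat -> R * R -> R).
Implicit Types (f y : R * R -> R) (u : R -> R * R -> R) (N : R -> R).

Definition coef f (k : nat) : R := L2dot Omega f (phi k).

(* \sum_k m (lambda k) f_k phi_k, the series being taken in L^2(Omega): a
   representative of its sum if it converges, and 0 otherwise. *)
Definition spectral (m : R -> R) f : R * R -> R :=
  xget (fun=> 0) [set g | L2 Omega g /\
    L2cvg Omega (fun n x => \sum_(k < n) m (lambda k) * coef f k * phi k x) g].

Definition fracLap (beta : R) f : R * R -> R := spectral (fun l => l `^ beta) f.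

Definition Halpha (alpha : R) f : Prop :=
  L2 Omega f /\
  cvgn (series (fun k => lambda k `^ alpha * `|coef f k| ^+ 2)).

Definition Halpha_norm (alpha : R) f : R := L2norm Omega (fracLap (alpha / 2) f).

Definition Q (alpha eps t : R) f : R * R -> R :=
  spectral (fun l => expR (- (eps ^+ 2 * l `^ alpha * t))) f.

Definition global_solution (alpha eps : R) N (u0 : R * R -> R) u : Prop :=
  [/\ forall t, 0 <= t -> C0 Omega (u t),
      continuous_curve (sup_norm Omega) `[0, +oo[ u,
      forall x, closure Omega x -> u 0 x = u0 x &
      forall t, 0 <= t -> exists J,
        bochner_integral Omega 0 t
          (fun s => Q alpha eps (t - s) (fun x => N (u s x))) J /\
        {ae leb2, forall x, Omega x -> u t x = Q alpha eps t u0 x - J x}].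

Definition omega_limit u : set (R * R -> R) :=
  [set y | L2 Omega y /\
    exists tn : nat -> R,
      tn @ \oo --> +oo /\ L2cvg Omega (fun n => u (tn n)) y].

Definition stationary_solution (alpha eps : R) N y : Prop :=
  Halpha alpha y /\
  forall f, Halpha alpha f ->
    leb2.-integrable Omega (EFin \o (fun x => N (y x) * f x)) /\
    eps ^+ 2 * L2dot Omega (fracLap (alpha / 2) y) (fracLap (alpha / 2) f)
      + (\int[leb2]_(x in Omega) (N (y x) * f x))%R = 0.

End SpectralFractionalLaplacian.

Definition reaction {R : realType} (u_minus u_mid u_plus w : R) : R :=
  w * (w + u_minus - u_mid) * (w + u_minus - u_plus).

(* Main.v *)
Require Import Defs.
From mathcomp Require Import all_boot all_order all_algebra.
From mathcomp Require Import all_classical all_reals all_analysis.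
From mathcomp Require Import measurable_realfun.
From mathcomp Require Import ring lra.
Import Order.TTheory GRing.Theory Num.Theory.
Import numFieldNormedType.Exports.
Set Implicit Arguments.
Unset Strict Implicit.
Unset Printing Implicit Defensive.
Local Open Scope classical_set_scope.
Local Open Scope ring_scope.

(** Write A for the Dirichlet Laplacian, c_k for the coefficients of u(t) in the
eigenbasis, and F for a primitive of the reaction term N. The flow is the gradient
flow of the energy
E(u) = (eps^2 / 2) <A^alpha u, u> + int F(u), and the theorem follows from the
decrease of E.

Paired with an eigenfunction, Duhamel's formula becomes the scalar equation
c_k' = - eps^2 lambda_k^alpha c_k - <N(u), phi_k> ([coef_ode]). Summing over k, the
energy lost during a time window of fixed small length delta dominates the
integral of the sum of the c_k'^2 ([window_dissipation]). Since E is bounded below,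
it follows that u(t) is bounded in H^alpha for t >= 1 ([quadratic_energy_bounded])
and that the displacement of u during the window starting at t tends to 0 as t
goes to infinity ([displacement_decay]).

As the eigenvalues tend to infinity, sets bounded in H^alpha are relatively compact
in L2 ([relative_compactness]), and this gives (i). For (ii), if u(t_n) tends to y
then u stays close to y during the windows starting at t_n. By the mean value
theorem c_k' is small somewhere in the window, and the scalar equation gives
eps^2 lambda_k^alpha y_k + <N(y), phi_k> = 0 for each k ([omega_limit_stationary]).
These are the coefficients of the stationary equation.

Two ingredients need an argument of their own. The first one is a bound on |u| that
is uniform in time, since N is only locally Lipschitz. It is a maximum principle:
if gap is the signed distance to [-M, M], then <A^alpha f, gap o f> >= 0
([fractional_gap_ge0]). This holds for the resolvents of A, by testing their weak
equation with a smoothed gap of the solution; hence these do not increase the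
integral of gap(f)^2, nor do their powers. It extends to A^alpha because the
binomial series of (1 - x)^alpha has nonpositive coefficients but the first one. If
moreover N(r) gap(r) >= 0, the integral of gap(u(t))^2 does not increase, and
remains 0 ([gap_energy_curve]). The computation is made on the partial sums of the
expansion of u(t), which are in the domain of A.

The second one is that only finitely many eigenvalues lie below a given level
([eigenvalue_unbounded]). By the Poincare inequality on the squares of a fine grid,
the corresponding eigenfunctions have means over the squares that carry at least
half of their norm, and Bessel's inequality limits their number. *)

(** * The space L2 of a planar set *)

#[global] Instance leb2_ae_filter {R : realType} :
  Filter (nbhs (almost_everywhere (@leb2 R))).
Proof. exact: (@ae_filter_ringOfSetsType _ _ R leb2). Qed.

Section L2Space.
Context {R : realType} (Om : set (R * R)).
Hypothesis mOm : measurable Om.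
Implicit Types (f g h : R * R -> R).

Lemma L2_measurable f : L2 Om f -> measurable_fun Om f.
Proof. by case. Qed.

Lemma L2M_integrable f g : L2 Om f -> L2 Om g ->
  leb2.-integrable Om (EFin \o (fun x => f x * g x)).
Proof.
move=> [mf if2] [mg ig2].
apply: (@le_integrable _ _ _ leb2 Om mOm _
  (fun x => (f x ^+ 2)%:E + (g x ^+ 2)%:E)%E).
- by apply/measurable_EFinP; exact: measurable_funM.
- move=> x Dx; rewrite -EFinD !abse_EFin lee_fin.
  rewrite [leRHS]ger0_norm ?addr_ge0 ?sqr_ge0//.
  rewrite normrM -[f x ^+ 2]real_normK ?num_real// -[g x ^+ 2]real_normK ?num_real//.
  by have := sqr_ge0 (`|f x| - `|g x|);
     have := sqr_ge0 (`|f x| + `|g x|); nra.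
- exact: integrableD.
Qed.

Lemma L2_dominated f g : measurable_fun Om f -> L2 Om g ->
  (forall x, Om x -> `|f x| <= `|g x|) -> L2 Om f.
Proof.
move=> mf [mg ig] fg; split => //.
apply: (@le_integrable _ _ _ leb2 Om mOm _ (EFin \o (fun x => g x ^+ 2))) => //.
- by apply/measurable_EFinP; exact: measurable_funX.
- move=> x Dx /=; rewrite lee_fin !normrX lerXn2r ?nnegrE//; exact: fg.
Qed.

Lemma L2D f g : L2 Om f -> L2 Om g -> L2 Om (fun x => f x + g x).
Proof.
move=> Lf Lg; split.
  by apply: measurable_funD; exact: L2_measurable.
have -> : EFin \o (fun x => (f x + g x) ^+ 2) =
  ((EFin \o (fun x => f x ^+ 2)%R) \+ ((fun x => 2%:E * (EFin \o (fun x => f x * g x)%R) x)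
   \+ (EFin \o (fun x => g x ^+ 2)%R)))%E.
  by apply/funext => x /=; rewrite -EFinM -!EFinD; congr EFin; ring.
apply: integrableD => //; first by case: Lf.
apply: integrableD => //; last by case: Lg.
by apply: integrableZl => //; exact: L2M_integrable.
Qed.

Lemma L2Z a f : L2 Om f -> L2 Om (fun x => a * f x).
Proof.
move=> [mf Lf]; split; first exact: measurable_funM.
have -> : EFin \o (fun x => (a * f x) ^+ 2) =
  (fun x => (a ^+ 2)%:E * (EFin \o (fun x => f x ^+ 2)%R) x)%E.
  by apply/funext => x /=; rewrite -EFinM exprMn.
exact: integrableZl.
Qed.

Lemma L2N f : L2 Om f -> L2 Om (fun x => - f x).
Proof.
move=> Lf; have -> : (fun x => - f x) = (fun x => (-1) * f x).
  by apply/funext => x; rewrite mulN1r.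
exact: L2Z.
Qed.

Lemma L2B f g : L2 Om f -> L2 Om g -> L2 Om (fun x => f x - g x).
Proof. by move=> Lf Lg; apply: L2D => //; exact: L2N. Qed.

Lemma L2_0 : L2 Om (fun=> 0).
Proof.
split; first exact: measurable_cst.
have -> : EFin \o (fun _ : R * R => 0 ^+ 2 : R) = cst 0%E.
  by apply/funext => x /=; rewrite expr0n.
exact: integrable0.
Qed.

Lemma L2_sum (I : Type) (r : seq I) (P : pred I) (F : I -> R * R -> R) :
  (forall i, P i -> L2 Om (F i)) -> L2 Om (fun x => \sum_(i <- r | P i) F i x).
Proof.
move=> LF; elim: r => [|i r IH].
  by under [X in L2 _ X]funext do rewrite big_nil; exact: L2_0.
under [X in L2 _ X]funext do rewrite big_cons.
by case: (boolP (P i)) => // Pi; apply: L2D => //; exact: LF.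
Qed.

Lemma L2_ext f g : (forall x, Om x -> f x = g x) -> L2 Om f -> L2 Om g.
Proof.
move=> fg [mf If]; split.
  by apply: eq_measurable_fun mf => x /[!inE] /fg.
by apply: eq_integrable If => // x /[!inE] /fg /= ->.
Qed.

Lemma L2dotC f g : L2dot Om f g = L2dot Om g f.
Proof. by congr fine; apply: eq_integral => x _; rewrite mulrC. Qed.

Lemma eq_L2dot f f' g g' : (forall x, Om x -> f x = f' x) ->
  (forall x, Om x -> g x = g' x) -> L2dot Om f g = L2dot Om f' g'.
Proof.
by move=> ff gg; apply: eq_Rintegral => x /[!inE] Dx; rewrite ff ?gg.
Qed.

Lemma L2dotDl f g h : L2 Om f -> L2 Om g -> L2 Om h ->
  L2dot Om (fun x => f x + g x) h = L2dot Om f h + L2dot Om g h.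
Proof.
move=> Lf Lg Lh; rewrite /L2dot -RintegralD//; try exact: L2M_integrable.
by apply: eq_Rintegral => x _; rewrite mulrDl.
Qed.

Lemma L2dotZl a f h : L2 Om f -> L2 Om h ->
  L2dot Om (fun x => a * f x) h = a * L2dot Om f h.
Proof.
move=> Lf Lh; rewrite /L2dot -RintegralZl//; last exact: L2M_integrable.
by apply: eq_Rintegral => x _; rewrite mulrA.
Qed.

Lemma L2dotNl f h : L2 Om f -> L2 Om h ->
  L2dot Om (fun x => - f x) h = - L2dot Om f h.
Proof.
move=> Lf Lh; rewrite -mulN1r -L2dotZl//.
by apply: eq_L2dot => // x _; rewrite mulN1r.
Qed.

Lemma L2dotBl f g h : L2 Om f -> L2 Om g -> L2 Om h ->
  L2dot Om (fun x => f x - g x) h = L2dot Om f h - L2dot Om g h.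
Proof. by move=> Lf Lg Lh; rewrite L2dotDl ?L2dotNl//; exact: L2N. Qed.

Lemma L2dot0l h : L2dot Om (fun=> 0) h = 0.
Proof.
rewrite /L2dot (@eq_Rintegral _ _ _ _ _ (fun=> 0)); last by move=> x _; rewrite mul0r.
by rewrite Rintegral_cst// mul0r.
Qed.

Lemma L2dot_suml (I : Type) (r : seq I) (P : pred I) (F : I -> R * R -> R) h :
  (forall i, P i -> L2 Om (F i)) -> L2 Om h ->
  L2dot Om (fun x => \sum_(i <- r | P i) F i x) h =
  \sum_(i <- r | P i) L2dot Om (F i) h.
Proof.
move=> LF Lh; elim: r => [|i r IH].
  rewrite big_nil; apply: etrans (L2dot0l h); apply: eq_L2dot => // x _.
  by rewrite big_nil.
rewrite big_cons -IH.
case: ifPn => Pi.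
  rewrite -L2dotDl//; [|exact: LF|exact: L2_sum].
  by apply: eq_L2dot => // x _; rewrite big_cons Pi.
by apply: eq_L2dot => // x _; rewrite big_cons (negbTE Pi).
Qed.

Lemma L2dotDr f g h : L2 Om f -> L2 Om g -> L2 Om h ->
  L2dot Om h (fun x => f x + g x) = L2dot Om h f + L2dot Om h g.
Proof. by move=> *; rewrite L2dotC L2dotDl// !(L2dotC h). Qed.

Lemma L2dotZr a f h : L2 Om f -> L2 Om h ->
  L2dot Om h (fun x => a * f x) = a * L2dot Om h f.
Proof. by move=> *; rewrite L2dotC L2dotZl// (L2dotC h). Qed.

Lemma L2dotBr f g h : L2 Om f -> L2 Om g -> L2 Om h ->
  L2dot Om h (fun x => f x - g x) = L2dot Om h f - L2dot Om h g.
Proof. by move=> *; rewrite L2dotC L2dotBl// !(L2dotC h). Qed.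

Lemma L2dot_ge0 f : 0 <= L2dot Om f f.
Proof. by apply: Rintegral_ge0 => x _; rewrite -expr2 sqr_ge0. Qed.

Lemma L2norm_ge0 f : 0 <= L2norm Om f.
Proof. exact: sqrtr_ge0. Qed.

Lemma sqr_L2norm f : L2norm Om f ^+ 2 = L2dot Om f f.
Proof. by rewrite sqr_sqrtr// L2dot_ge0. Qed.

Lemma eq_L2norm f g : (forall x, Om x -> f x = g x) -> L2norm Om f = L2norm Om g.
Proof. by move=> fg; rewrite /L2norm; congr Num.sqrt; exact: eq_L2dot. Qed.

Lemma L2dot_le f g : L2 Om f -> L2 Om g ->
  (forall x, Om x -> `|f x| <= `|g x|) -> L2dot Om f f <= L2dot Om g g.
Proof.
move=> Lf Lg fg; apply: le_Rintegral => //; try exact: L2M_integrable.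
move=> x Dx; rewrite -!expr2 -[leLHS]real_normK ?num_real// -[leRHS]real_normK ?num_real//.
by rewrite lerXn2r ?nnegrE//; exact: fg.
Qed.

Lemma L2norm_le f g : L2 Om f -> L2 Om g ->
  (forall x, Om x -> `|f x| <= `|g x|) -> L2norm Om f <= L2norm Om g.
Proof. by move=> Lf Lg fg; rewrite ler_wsqrtr// L2dot_le. Qed.

(** The quadratic polynomial <f + t g, f + t g> in t is nonnegative; when <g, g>
vanishes it is affine, so that its slope vanishes too. *)
Lemma L2_CS2 f g : L2 Om f -> L2 Om g ->
  L2dot Om f g ^+ 2 <= L2dot Om f f * L2dot Om g g.
Proof.
move=> Lf Lg.
have H t : 0 <= L2dot Om f f - t * L2dot Om f g *+ 2 + t ^+ 2 * L2dot Om g g.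
  have := L2dot_ge0 (fun x => f x - t * g x).
  rewrite L2dotBl ?L2dotBr ?L2dotZl ?L2dotZr//; try (by repeat first [exact: L2Z|apply: L2B]).
  by rewrite (L2dotC g f); lra.
have gg := L2dot_ge0 g; have ff := L2dot_ge0 f.
have [g0|g0] := eqVneq (L2dot Om g g) 0.
  rewrite g0 mulr0.
  have [->|fg0] := eqVneq (L2dot Om f g) 0; first by rewrite expr0n.
  have := H ((L2dot Om f f + 1) / (L2dot Om f g *+ 2)).
  rewrite g0 mulr0 addr0 -mulrnAr mulfVK; last by rewrite mulrn_eq0.
  lra.
have {}g0 : 0 < L2dot Om g g by rewrite lt_neqAle eq_sym g0.
have := H (L2dot Om f g / L2dot Om g g).
have -> : L2dot Om f f - L2dot Om f g / L2dot Om g g * L2dot Om f g *+ 2 +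
   (L2dot Om f g / L2dot Om g g) ^+ 2 * L2dot Om g g
   = (L2dot Om f f * L2dot Om g g - L2dot Om f g ^+ 2) / L2dot Om g g.
  by field; rewrite gt_eqF.
by rewrite pmulr_lge0 ?invr_gt0// subr_ge0.
Qed.

Lemma L2_CS f g : L2 Om f -> L2 Om g ->
  `|L2dot Om f g| <= L2norm Om f * L2norm Om g.
Proof.
move=> Lf Lg; rewrite -sqrtrM ?L2dot_ge0// -sqrtr_sqr ler_wsqrtr//.
exact: L2_CS2.
Qed.

Lemma L2normD f g : L2 Om f -> L2 Om g ->
  L2norm Om (fun x => f x + g x) <= L2norm Om f + L2norm Om g.
Proof.
move=> Lf Lg; rewrite -(@ler_pXn2r _ 2)// ?nnegrE ?addr_ge0 ?L2norm_ge0//.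
rewrite sqr_L2norm sqrrD !sqr_L2norm L2dotDl ?L2dotDr//; try exact: L2D.
have := L2_CS Lf Lg; rewrite (L2dotC g f).
by have := ler_norm (L2dot Om f g); lra.
Qed.

Lemma L2normN f : L2 Om f -> L2norm Om (fun x => - f x) = L2norm Om f.
Proof.
move=> Lf; rewrite /L2norm L2dotNl ?(L2dotC _ (fun x => - f x)) ?L2dotNl ?opprK//.
exact: L2N.
Qed.

Lemma L2normZ a f : L2 Om f -> L2norm Om (fun x => a * f x) = `|a| * L2norm Om f.
Proof.
move=> Lf; rewrite /L2norm L2dotZl ?(L2dotC _ (fun x => a * f x)) ?L2dotZl//; last exact: L2Z.
by rewrite mulrA -expr2 sqrtrM ?sqr_ge0// sqrtr_sqr.
Qed.

Lemma L2norm_sub f g : L2 Om f -> L2 Om g ->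
  L2norm Om (fun x => f x - g x) = L2norm Om (fun x => g x - f x).
Proof.
move=> Lf Lg; rewrite -L2normN; last exact: L2B.
by apply: eq_L2norm => x _; rewrite opprB.
Qed.

Lemma L2normB f g h : L2 Om f -> L2 Om g -> L2 Om h ->
  L2norm Om (fun x => f x - h x) <=
  L2norm Om (fun x => f x - g x) + L2norm Om (fun x => g x - h x).
Proof.
move=> Lf Lg Lh; apply: le_trans (L2normD (L2B Lf Lg) (L2B Lg Lh)).
by rewrite le_eqVlt; apply/orP; left; apply/eqP/eq_L2norm => x _; ring.
Qed.

Lemma L2dot_ae_l f f' g : L2 Om f -> L2 Om f' -> L2 Om g ->
  {ae leb2, forall x, Om x -> f x = f' x} -> L2dot Om f g = L2dot Om f' g.
Proof.
move=> Lf Lf' Lg ff; congr fine; apply: ae_eq_integral => //.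
- by have /integrableP[] := L2M_integrable Lf Lg.
- by have /integrableP[] := L2M_integrable Lf' Lg.
- by apply: filterS ff => x + Dx => ->.
Qed.

Lemma L2norm_eq0_ae f : L2 Om f -> L2norm Om f = 0 ->
  {ae leb2, forall x, Om x -> f x = 0}.
Proof.
move=> Lf f0.
have If := L2M_integrable Lf Lf.
have : (\int[leb2]_(x in Om) `|(f x * f x)%:E| = 0)%E.
  have : L2dot Om f f = 0 by rewrite -sqr_L2norm f0 expr0n.
  rewrite /L2dot /Rintegral => H.
  under eq_integral => x _ do rewrite /= ger0_norm -?expr2 ?sqr_ge0 // expr2.
  have F0 := @integrable_fin_num _ _ _ leb2 Om mOm _ If.
  by have := fineK F0; rewrite /= H => <-.
have mff : measurable_fun Om (EFin \o (fun x => f x * f x)) by case/integrableP: If.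
move/(ae_eq_integral_abs leb2 mOm mff).1.
apply: filterS => x /= + Dx => /(_ Dx) [] /eqP.
by rewrite mulf_eq0 orbb => /eqP.
Qed.

End L2Space.

(** * Orthonormal expansions *)

Lemma cvgn_epsP {R : realType} (u : nat -> R) (l : R) :
  (u @ \oo --> l) <->
  (forall e, 0 < e -> exists N, forall n, (N <= n)%N -> `|u n - l| <= e).
Proof.
split.
  move=> /cvgrPdist_le H e e0; have [N _ HN] := H e e0.
  by exists N => n Nn; rewrite distrC; exact: HN.
move=> H; apply/cvgrPdist_le => e e0; have [N HN] := H e e0.
by exists N => // n /= Nn; rewrite distrC; exact: HN.
Qed.

Lemma cvgn_squeeze0 {R : realType} (u v : nat -> R) (l : R) :
  v @ \oo --> (0 : R) -> (forall n, `|u n - l| <= v n) -> u @ \oo --> l.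
Proof.
move=> /cvgn_epsP v0 uv; apply/cvgn_epsP => e e0; have [N HN] := v0 e e0.
exists N => n Nn; apply: le_trans (uv n) _; apply: le_trans (ler_norm _) _.
by have := HN n Nn; rewrite subr0.
Qed.

Lemma cvgn_le {R : realType} (u : nat -> R) (l b : R) N :
  u @ \oo --> l -> (forall n, (N <= n)%N -> u n <= b) -> l <= b.
Proof.
move=> ul ub; have <- : limn u = l by apply/cvg_lim.
apply: limr_le; first by apply/cvg_ex; exists l.
by exists N.
Qed.

Lemma cvgn_ge {R : realType} (u : nat -> R) (l b : R) N :
  u @ \oo --> l -> (forall n, (N <= n)%N -> b <= u n) -> b <= l.
Proof.
move=> ul ub; have <- : limn u = l by apply/cvg_lim.
apply: limr_ge; first by apply/cvg_ex; exists l.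
by exists N.
Qed.

Section L2Convergence.
Context {R : realType} (Om : set (R * R)).
Hypothesis mOm : measurable Om.
Implicit Types (f g h : R * R -> R) (F : nat -> R * R -> R).

Lemma L2cvg_dot F f h : (forall n, L2 Om (F n)) -> L2 Om f -> L2 Om h ->
  L2cvg Om F f -> (fun n => L2dot Om (F n) h) @ \oo --> L2dot Om f h.
Proof.
move=> LF Lf Lh Ff.
apply: (@cvgn_squeeze0 _ _ (fun n => L2norm Om (fun x => F n x - f x) * L2norm Om h)).
  by rewrite -(mul0r (L2norm Om h)); apply: cvgMl.
by move=> n; rewrite -L2dotBl//; apply: L2_CS => //; exact: L2B.
Qed.

Lemma L2norm_dist f g : L2 Om f -> L2 Om g ->
  `|L2norm Om f - L2norm Om g| <= L2norm Om (fun x => f x - g x).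
Proof.
move=> Lf Lg; rewrite ler_norml; apply/andP; split.
  rewrite lerBrDl lerBlDr (L2norm_sub mOm Lf Lg) -[leRHS]addrC addrC.
  apply: le_trans (L2normD mOm Lf (L2B mOm Lg Lf)).
  by rewrite le_eqVlt; apply/orP; left; apply/eqP/eq_L2norm => x _; ring.
rewrite lerBlDr; apply: le_trans (L2normD mOm (L2B mOm Lf Lg) Lg).
by rewrite le_eqVlt; apply/orP; left; apply/eqP/eq_L2norm => x _; ring.
Qed.

Lemma L2cvg_norm F f : (forall n, L2 Om (F n)) -> L2 Om f ->
  L2cvg Om F f -> (fun n => L2norm Om (F n)) @ \oo --> L2norm Om f.
Proof.
by move=> LF Lf Ff; apply: cvgn_squeeze0 Ff _ => n; exact: L2norm_dist.
Qed.

Lemma L2_fatou F f B : (forall n, L2 Om (F n)) -> measurable_fun Om f ->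
  {ae leb2, forall x, Om x -> (fun n => F n x) @ \oo --> f x} ->
  (forall n, L2dot Om (F n) (F n) <= B) -> L2 Om f /\ L2dot Om f f <= B.
Proof.
move=> LF mf Ff FB.
have mFn n : measurable_fun Om (fun x => (F n x * F n x)%:E).
  apply/measurable_EFinP; apply: measurable_funM; exact: L2_measurable (LF n).
have F0 n x : Om x -> (0 <= (F n x * F n x)%:E)%E.
  by move=> _; rewrite lee_fin -expr2 sqr_ge0.
have mff : measurable_fun Om (fun x => (f x * f x)%:E).
  by apply/measurable_EFinP; exact: measurable_funM.
have mE : measurable_fun Om (fun x => limn_einf (fun n => (F n x * F n x)%:E)).
  have mN n : measurable_fun Om (fun x => (- (F n x * F n x))%:E).
    apply/measurable_EFinP; apply: measurable_funN.
    by apply: measurable_funM; exact: L2_measurable (LF n).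
  have mS := measurable_fun_limn_esup mN.
  have mO : measurable_fun [set: \bar R] (@oppe R) by exact: oppe_measurable.
  exact: (measurableT_comp mO mS).
have H : (\int[leb2]_(x in Om) (f x * f x)%:E <= B%:E)%E.
  apply: le_trans (_ : \int[leb2]_(x in Om) limn_einf (fun n => (F n x * F n x)%:E) <= _)%E.
    apply: ae_ge0_le_integral => //.
    - by move=> x _; rewrite lee_fin -expr2 sqr_ge0.
    - move=> x Dx; rewrite limn_einf_lim; apply: lime_ge.
        exact: is_cvg_einfs.
      by apply: nearW => n; apply: le_ereal_inf_tmp => _ [m /= _ <-]; exact: F0.
    - apply: filterS Ff => x Ff Dx.
      have : (fun n => (F n x * F n x)%:E) @ \oo --> (f x * f x)%:E.
        by apply: cvg_EFin; [exact: nearW|apply: cvgM; exact: Ff].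
      by move=> /cvg_limn_einf_sup[-> _].
  apply: le_trans (@fatou _ _ _ leb2 Om mOm _ mFn F0) _.
  rewrite limn_einf_lim; apply: lime_le; first exact: is_cvg_einfs.
  apply: nearW => n; apply: ereal_inf_le; exists (\int[leb2]_(x in Om) (F n x * F n x)%:E)%E.
    by exists n => /=.
  have I := @integrable_fin_num _ _ _ leb2 Om mOm _ (L2M_integrable mOm (LF n) (LF n)).
  by rewrite -(fineK I) lee_fin; exact: FB.
have f0 : (0 <= \int[leb2]_(x in Om) (f x * f x)%:E)%E.
  by apply: integral_ge0 => x _; rewrite lee_fin -expr2 sqr_ge0.
have Lf : L2 Om f.
  split => //; apply/integrableP; split.
    by apply/measurable_EFinP; exact: measurable_funX.
  under eq_integral => x _ do rewrite /= ger0_norm ?sqr_ge0 // expr2.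
  by apply: le_lt_trans H _; rewrite ltry.
split => //; rewrite -lee_fin /L2dot /Rintegral fineK//.
exact: (@integrable_fin_num _ _ _ leb2 Om mOm _ (L2M_integrable mOm Lf Lf)).
Qed.

End L2Convergence.

Definition fsum {R : realType} (phi : nat -> R * R -> R) (c : nat -> R) (n : nat) : R * R -> R :=
  fun x => \sum_(k < n) c k * phi k x.

Section Basis.
Context {R : realType} (Om : set (R * R)) (phi : nat -> R * R -> R).
Hypothesis mOm : measurable Om.
Hypothesis onb : orthonormal_basis Om phi.
Implicit Types (f g h : R * R -> R) (c d : nat -> R).

Let Lphi k : L2 Om (phi k). Proof. by case: onb. Qed.

Lemma L2_fsum c n : L2 Om (fsum phi c n).
Proof. by apply: L2_sum => // k _; exact: L2Z. Qed.

Lemma L2dot_fsum c n f : L2 Om f ->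
  L2dot Om (fsum phi c n) f = \sum_(k < n) c k * L2dot Om (phi k) f.
Proof.
move=> Lf; rewrite L2dot_suml//; last by move=> k _; exact: L2Z.
by apply: eq_bigr => k _; rewrite L2dotZl.
Qed.

Lemma coef_fsum c n k : (k < n)%N -> L2dot Om (fsum phi c n) (phi k) = c k.
Proof.
move=> kn; rewrite L2dot_fsum// (bigD1 (Ordinal kn))//=.
have [_ o _] := onb; rewrite o eqxx mulr1 big1 ?addr0// => i ik.
by move: ik; rewrite -val_eqE /= o => /negbTE ->; rewrite mulr0.
Qed.

Lemma L2dot_fsum2 c d n :
  L2dot Om (fsum phi c n) (fsum phi d n) = \sum_(k < n) c k * d k.
Proof.
rewrite L2dot_fsum; last exact: L2_fsum.
by apply: eq_bigr => k _; rewrite L2dotC coef_fsum.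
Qed.

Lemma fsumB c d n x : fsum phi (fun k => c k - d k) n x = fsum phi c n x - fsum phi d n x.
Proof. by rewrite /fsum -sumrB; apply: eq_bigr => k _; rewrite mulrBl. Qed.

Lemma L2norm2_fsum c n : L2dot Om (fsum phi c n) (fsum phi c n) = \sum_(k < n) c k ^+ 2.
Proof. by rewrite L2dot_fsum2; apply: eq_bigr => k _; rewrite expr2. Qed.

Lemma L2cvg_coef f : L2 Om f ->
  L2cvg Om (fsum phi (coef Om phi f)) f.
Proof. by case: onb => _ _ H /H. Qed.

Lemma parseval f g : L2 Om f -> L2 Om g ->
  (fun n => \sum_(k < n) coef Om phi f k * coef Om phi g k) @ \oo --> L2dot Om f g.
Proof.
move=> Lf Lg; have := L2cvg_dot mOm (L2_fsum (coef Om phi f)) Lf Lg (L2cvg_coef Lf).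
apply: cvg_trans; apply: near_eq_cvg; apply: nearW => n /=.
by rewrite L2dot_fsum//; apply: eq_bigr => k _; rewrite /coef (L2dotC _ g).
Qed.

Lemma parseval_norm f : L2 Om f ->
  (fun n => \sum_(k < n) coef Om phi f k ^+ 2) @ \oo --> L2dot Om f f.
Proof.
by move=> Lf; under eq_fun do under eq_bigr do rewrite expr2; exact: parseval.
Qed.

Lemma bessel f n : L2 Om f -> \sum_(k < n) coef Om phi f k ^+ 2 <= L2dot Om f f.
Proof.
move=> Lf; apply: (cvgn_ge (parseval_norm Lf) (N := n)) => m nm.
rewrite -(subnKC nm) big_split_ord /= lerDl sumr_ge0// => i _; exact: sqr_ge0.
Qed.

(** Pythagoras: f minus its n-th partial sum is orthogonal to the span of the
first n functions. *)
Lemma sub_fsum_coef_fsum f c n : L2 Om f ->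
  L2dot Om (fun x => f x - fsum phi c n x) (fun x => f x - fsum phi c n x) =
  L2dot Om f f - \sum_(k < n) coef Om phi f k ^+ 2
  + \sum_(k < n) (coef Om phi f k - c k) ^+ 2.
Proof.
move=> Lf; have LS := L2_fsum c n.
rewrite L2dotBl ?L2dotBr//; try exact: L2B.
rewrite L2norm2_fsum (L2dotC _ f) L2dot_fsum// -!addrA; congr (_ + _).
rewrite -!sumrN -!big_split /= -sumrN -big_split /=.
by apply: eq_bigr => k _; rewrite /coef (L2dotC _ f); ring.
Qed.

Lemma fsum_cat c n m : (n <= m)%N ->
  L2dot Om (fun x => fsum phi c m x - fsum phi c n x)
           (fun x => fsum phi c m x - fsum phi c n x)
  = \sum_(k < m) c k ^+ 2 - \sum_(k < n) c k ^+ 2.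
Proof.
move=> nm; rewrite sub_fsum_coef_fsum ?L2norm2_fsum; last exact: L2_fsum.
have E (k : 'I_n) : coef Om phi (fsum phi c m) k = c k.
  by apply: coef_fsum; exact: leq_trans (ltn_ord k) nm.
rewrite [X in _ - X](eq_bigr (fun k : 'I_n => c k ^+ 2)); last by move=> k _; rewrite E.
rewrite [X in _ + X]big1 ?addr0// => k _.
by rewrite E subrr expr0n.
Qed.

End Basis.

Section RieszFischer.
Context {R : realType} (Om : set (R * R)) (phi : nat -> R * R -> R).
Hypothesis mOm : measurable Om.
Hypothesis finOm : (leb2 Om < +oo)%E.
Hypothesis onb : orthonormal_basis Om phi.
Implicit Types (f g h : R * R -> R) (c d : nat -> R).

Lemma L2_bounded f (C : R) : measurable_fun Om f -> (forall x, Om x -> `|f x| <= C) -> L2 Om f.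
Proof.
move=> mf fC; split => //.
have := @measurable_bounded_integrable _ _ _ leb2 (fun x => f x ^+ 2) Om mOm finOm.
apply; first exact: measurable_funX.
exists (C ^+ 2); split; first exact: num_real.
move=> y Cy x /= Dx; rewrite normrX; apply: le_trans (ltW Cy).
have := fC x Dx; have := normr_ge0 (f x); nra.
Qed.

(** On a set of finite measure the L2 norm dominates the L1 norm, so that the
series of the |S n.+1 - S n| has a finite integral; it is then finite almost
everywhere, and S converges there. *)
Lemma ae_cvg_of_summable (S : nat -> R * R -> R) (b : nat -> R) (B : R) :
  (forall n, L2 Om (S n)) ->
  (forall n, L2norm Om (fun x => S n.+1 x - S n x) <= b n) ->
  (forall n, \sum_(k < n) b k <= B) ->
  {ae leb2, forall x, Om x -> cvgn (fun n => S n x)}.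
Proof.
move=> LS Sb bB.
pose h n x : R := `|S n.+1 x - S n x|.
have mhr n : measurable_fun Om (h n).
  apply: measurableT_comp => //.
  by apply: measurable_funB; exact: L2_measurable (LS _).
have mh n : measurable_fun Om (fun x => (h n x)%:E) by apply/measurable_EFinP.
have h0 n x : Om x -> (0 <= (h n x)%:E)%E by move=> _; rewrite lee_fin normr_ge0.
have L1 : L2 Om (fun=> 1) by apply: (L2_bounded (C := 1)) => // x _; rewrite normr1.
have Lh n : L2 Om (h n).
  apply: (L2_dominated mOm (mhr n) (L2B mOm (LS n.+1) (LS n))).
  by move=> x _; rewrite normr_id.
have Ih n : (\int[leb2]_(x in Om) (h n x)%:E <= (b n * L2norm Om (fun=> 1))%:E)%E.
  have I := L2M_integrable mOm (Lh n) L1.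
  have := @integrable_fin_num _ _ _ leb2 Om mOm _ I => /fineK.
  under eq_integral do rewrite /= mulr1.
  move=> <-; rewrite lee_fin.
  have -> : fine (\int[leb2]_(x in Om) (h n x)%:E) = L2dot Om (h n) (fun=> 1).
    by congr fine; apply: eq_integral => x _; rewrite mulr1.
  apply: le_trans (ler_norm _) _; apply: le_trans (L2_CS mOm (Lh n) L1) _.
  apply: ler_wpM2r; first exact: L2norm_ge0.
  apply: le_trans (Sb n); apply: L2norm_le => //; first exact: L2B.
  by move=> x _; rewrite normr_id.
have Itot : (\int[leb2]_(x in Om) (\sum_(n <oo) (h n x)%:E) < +oo)%E.
  rewrite (@integral_nneseries _ _ _ leb2 Om mOm _ mh h0).
  apply: (@le_lt_trans _ _ (B * L2norm Om (fun=> 1))%:E); last by rewrite ltry.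
  apply: lime_le.
    by apply: is_cvg_nneseries => n _ _; apply: integral_ge0 => x; exact: h0.
  apply: nearW => n; rewrite big_mkord.
  apply: (@le_trans _ _ (\sum_(k < n) (b k * L2norm Om (fun=> 1))%:E)%E).
    by apply: lee_sum => k _; exact: Ih.
  rewrite sumEFin lee_fin -mulr_suml ler_wpM2r//; exact: L2norm_ge0.
have msum : measurable_fun Om (fun x => \sum_(n <oo) (h n x)%:E)%E.
  apply: (@emeasurable_fun_cvg _ _ _ Om (fun n x => \sum_(0 <= k < n) (h k x)%:E)%E).
    move=> n; under [X in measurable_fun _ X]eq_fun do rewrite sumEFin.
    have mr : measurable_fun Om (fun x => \sum_(0 <= k < n) h k x).
      by apply: measurable_sum.
    exact/measurable_EFinP.
  by move=> x Dx; apply: is_cvg_nneseries => n _ _; exact: h0.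
have Isum : leb2.-integrable Om (fun x => \sum_(n <oo) (h n x)%:E)%E.
  apply/integrableP; split => //.
  have mabs : measurable_fun Om (fun x => `|\sum_(n <oo) (h n x)%:E|)%E.
    have mA : measurable_fun [set: \bar R] (@abse R) by exact: abse_measurable.
    exact: (measurableT_comp mA msum).
  apply: le_lt_trans Itot; apply: ge0_le_integral => //.
  - by move=> x Dx; rewrite gee0_abs//; apply: nneseries_ge0 => n _ _; exact: h0.
have := @integrable_ae _ _ _ leb2 Om mOm _ Isum.
apply: filterS => x Hx Dx; have {}Hx := Hx Dx.
have : cvgn (series (telescope (fun n => S n x))).
  apply: normed_cvg; apply: nondecreasing_is_cvgn.
    by apply: nondecreasing_series => n _ _; exact: normr_ge0.
  exists (fine (\sum_(n <oo) (h n x)%:E)%E) => _ [n _ <-].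
  rewrite -lee_fin fineK//.
  have := @nneseries_lim_ge R (fun n => (h n x)%:E) xpredT 0 n (fun k _ _ => h0 k x Dx).
  by rewrite sumEFin.
move=> H; have -> : (fun n => S n x) = (fun n => S 0%N x + series (telescope (fun n => S n x)) n).
  by apply/funext => n; rewrite -eq_sum_telescope.
by apply: is_cvgD => //; exact: is_cvg_cst.
Qed.

(** A subsequence of partial sums with increments of norm at most 2^-j converges
almost everywhere. Fatou's lemma bounds the distance of its pointwise limit to
each partial sum by the remainder of the series of squares. *)
Lemma riesz_fischer c (B : R) : (forall n, \sum_(k < n) c k ^+ 2 <= B) ->
  exists f, L2 Om f /\ L2cvg Om (fsum phi c) f.
Proof.
move=> cB.
pose s n := \sum_(k < n) c k ^+ 2.
have s_nd : nondecreasing_seq s.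
  move=> n m nm; rewrite /s -(subnKC nm) big_split_ord /= lerDl sumr_ge0// => i _.
  exact: sqr_ge0.
have sc : cvgn s by apply: nondecreasing_is_cvgn => //; exists B => _ [n _ <-]; exact: cB.
have sle n : s n <= limn s by exact: nondecreasing_cvgn_le.
have /choice[N HN] : forall j, exists Nj, forall n, (Nj <= n)%N ->
    limn s - s n <= ((2^-1 : R) ^+ j) ^+ 2.
  move=> j; have /cvgn_epsP := sc => /(_ (((2^-1 : R) ^+ j) ^+ 2)) [|M HM].
    by rewrite !exprn_gt0// invr_gt0.
  by exists M => n /HM; rewrite distrC; apply: le_trans; exact: ler_norm.
(* Increasing indices beyond which the remainder is at most 4^-j. *)
pose m j := (\sum_(i < j.+1) (N i).+1)%N.
have mN j : (N j <= m j)%N by rewrite /m big_ord_recr /= (leq_trans (leqnSn _))// leq_addl.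
have mj j : (j < m j)%N.
  rewrite /m; elim: (j) => [|i IH]; first by rewrite big_ord_recr big_ord0.
  by rewrite big_ord_recr /= -addn1 leq_add.
have mS j : (m j <= m j.+1)%N by rewrite /m [leqRHS]big_ord_recr /= leq_addr.
pose S j := fsum phi c (m j).
have LS j : L2 Om (S j) by exact: L2_fsum.
have dS n p : (m p <= n)%N -> L2dot Om (fun x => fsum phi c n x - S p x)
     (fun x => fsum phi c n x - S p x) <= limn s - s (m p).
  by move=> pn; rewrite fsum_cat// lerB//; exact: sle.
have Sb j : L2norm Om (fun x => S j.+1 x - S j x) <= 2^-1 ^+ j.
  rewrite -(@ler_pXn2r _ 2)// ?nnegrE ?L2norm_ge0 ?exprn_ge0 ?invr_ge0//.
  by rewrite sqr_L2norm; apply: le_trans (dS _ _ (mS j)) _; exact: HN.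
have bB n : \sum_(k < n) (2^-1 : R) ^+ k <= 2.
  have -> : \sum_(k < n) (2^-1 : R) ^+ k = 2 - 2 * 2^-1 ^+ n.
    elim: n => [|n IH]; first by rewrite big_ord0 expr0 mulr1 subrr.
    by rewrite big_ord_recr /= IH exprS; field.
  by rewrite gerBl mulr_ge0// exprn_ge0// invr_ge0.
have Sae := ae_cvg_of_summable LS Sb bB.
(* An upper limit, so that f is measurable also where the subsequence diverges. *)
pose f x := fine (limn_esup (fun j => (S j x)%:E)).
have mf : measurable_fun Om f.
  have mS' j : measurable_fun Om (fun x => (S j x)%:E).
    by apply/measurable_EFinP; exact: L2_measurable (LS j).
  have mE := measurable_fun_limn_esup mS'.
  have mF : measurable_fun [set: \bar R] (@fine R) by exact: fine_measurable.
  exact: (measurableT_comp mF mE).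
have Sf : {ae leb2, forall x, Om x -> (fun j => S j x) @ \oo --> f x}.
  apply: filterS Sae => x Hx Dx; have {}Hx := Hx Dx.
  have : (fun j => (S j x)%:E) @ \oo --> (limn (fun j => S j x))%:E.
    by apply: cvg_EFin => //; exact: nearW.
  by move=> /cvg_limn_einf_sup[_ e]; rewrite /f e.
have key n : L2 Om (fun x => f x - fsum phi c n x) /\
   L2dot Om (fun x => f x - fsum phi c n x) (fun x => f x - fsum phi c n x) <= limn s - s n.
  pose G j := fun x => S (j + n)%N x - fsum phi c n x.
  have LG j : L2 Om (G j) by apply: L2B => //; exact: L2_fsum.
  apply: (L2_fatou mOm LG).
  - by apply: measurable_funB => //; exact: L2_measurable (L2_fsum mOm onb _ _).
  - apply: filterS Sf => x Hx Dx; have {}Hx := Hx Dx.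
    apply: cvgB; last exact: cvg_cst.
    by have := Hx; rewrite -(cvg_shiftn n).
  - move=> j; rewrite fsum_cat//; first by rewrite lerB//; exact: sle.
    by apply: leq_trans (ltnW (mj (j + n)%N)); rewrite leq_addl.
have Lf : L2 Om f.
  apply: (@L2_ext _ _ mOm (fun x => (f x - fsum phi c 0 x) + fsum phi c 0 x)).
    by move=> x _; rewrite subrK.
  by apply: L2D => //; [have [] := key 0%N|exact: L2_fsum].
exists f; split => //; apply/cvgn_epsP => e e0.
have /cvgn_epsP/(_ (e ^+ 2)) := sc; rewrite exprn_gt0// => /(_ isT)[M HM].
exists M => n Mn; rewrite subr0 ger0_norm ?L2norm_ge0//.
rewrite (L2norm_sub mOm) ?L2_fsum//; last exact: L2_fsum.
rewrite -(@ler_pXn2r _ 2)// ?nnegrE ?L2norm_ge0 ?(ltW e0)// sqr_L2norm.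
have [_ h] := key n; apply: le_trans h _; apply: le_trans (HM _ Mn).
by rewrite distrC ler_norm.
Qed.

Lemma coef_L2cvg c f k : L2 Om f -> L2cvg Om (fsum phi c) f -> coef Om phi f k = c k.
Proof.
move=> Lf cf; have [Lp _ _] := onb; rewrite /coef.
have /cvg_lim <-// := L2cvg_dot mOm (L2_fsum mOm onb c) Lf (Lp k) cf.
apply: lim_near_cst => //; exists k.+1 => // n /= kn.
by rewrite (coef_fsum mOm onb).
Qed.

(** The series in the definition of spectral converges by Riesz-Fischer, so that
the representative chosen there is its sum. *)
Lemma spectralP (lambda : nat -> R) (m : R -> R) f (B : R) :
  (forall n, \sum_(k < n) (m (lambda k) * coef Om phi f k) ^+ 2 <= B) ->
  L2 Om (spectral Om lambda phi m f) /\
  forall k, coef Om phi (spectral Om lambda phi m f) k = m (lambda k) * coef Om phi f k.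
Proof.
move=> H; have [g [Lg cg]] := riesz_fischer (c := fun k => m (lambda k) * coef Om phi f k) H.
have [Ls cs] : [set g | L2 Om g /\
    L2cvg Om (fun n x => \sum_(k < n) m (lambda k) * coef Om phi f k * phi k x) g]
      (spectral Om lambda phi m f).
  by apply: xgetPex; exists g.
split=> // k.
exact: (@coef_L2cvg (fun k => m (lambda k) * coef Om phi f k) _ k Ls cs).
Qed.

End RieszFischer.

(** * Calculus of test functions *)

Section PlaneMeasurability.
Context {R : realType}.

Definition box (q : (R * R) * (R * R)) : set (R * R) :=
  (`]q.1.1, q.1.2[ `*` `]q.2.1, q.2.2[)%classic.

Lemma measurable_box q : measurable (box q).
Proof. by apply: measurableX; exact: measurable_itv. Qed.

(** An open set is a countable union of rational boxes, which are measurable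
rectangles of the product sigma-algebra. *)
Lemma open_measurable2 (A : set (R * R)) : open A -> measurable A.
Proof.
move=> oA.
pose B (q : (rat * rat) * (rat * rat)) : (R * R) * (R * R) :=
  ((ratr q.1.1, ratr q.1.2), (ratr q.2.1, ratr q.2.2)).
pose F q : set (R * R) := [set x | box (B q) `<=` A /\ box (B q) x].
have -> : A = \bigcup_q F q.
  apply/seteqP; split => [x Ax|x [q _ [qA]]]; last exact: qA.
  have /nbhs_ballP[e /= e0 eA] : nbhs x A by move: oA; rewrite openE => /(_ x Ax).
  have /rat_in_itvoo[a1 xa1] : x.1 - e < x.1 by lra.
  have /rat_in_itvoo[b1 xb1] : x.1 < x.1 + e by lra.
  have /rat_in_itvoo[a2 xa2] : x.2 - e < x.2 by lra.
  have /rat_in_itvoo[b2 xb2] : x.2 < x.2 + e by lra.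
  move: xa1 xb1 xa2 xb2; rewrite !in_itv /= => /andP[? ?] /andP[? ?] /andP[? ?] /andP[? ?].
  exists ((a1, b1), (a2, b2)) => //; split => [y [/=]|]; last first.
    by split => /=; rewrite in_itv /=; apply/andP.
  rewrite !in_itv /= => /andP[? ?] /andP[? ?]; apply: eA; split => /=.
    by rewrite /ball /= ltr_norml; apply/andP; split; lra.
  by rewrite /ball /= ltr_norml; apply/andP; split; lra.
apply: countable_bigcupT_measurable; first exact: countableP.
move=> q; case: (pselect (box (B q) `<=` A)) => qA.
  have -> : F q = box (B q) by apply/seteqP; split => y; [case|].
  exact: measurable_box.
have -> : F q = set0 by apply/seteqP; split => y //; case.
exact: measurable0.
Qed.

Lemma open_continuous_measurable2 (A : set (R * R)) (f : R * R -> R) : open A ->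
  {in A, continuous f} -> measurable_fun A f.
Proof.
move=> oA /(continuous_inP f oA) cf.
apply: (measurability _ (RGenOpens.measurableE R)).
move=> _ [_ [a [b ->] <-]]; apply: open_measurable2.
by apply: cf; exact: interval_open.
Qed.

End PlaneMeasurability.

Section DirectionalCalculus.
Context {R : realType}.
Implicit Types (f g : R * R -> R) (v x : R * R).

Lemma derive_slice f x v : 'D_v f x = 'D_1 (fun h : R => f (h *: v + x)) 0.
Proof.
rewrite /derive; set g1 := fun h => h^-1 *: _; set g2 := fun h => h^-1 *: _.
suff -> : g1 = g2 by [].
by rewrite funeqE /g1 /g2 => h /=; rewrite addr0 scale0r add0r [_%:A]mulr1.
Qed.

Lemma derive_comp1 (K : R -> R) (k : R) f x v :
  derivable f x v -> is_derive (f x) (1 : R) K k ->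
  derivable (K \o f) x v /\ 'D_v (K \o f) x = k * 'D_v f x.
Proof.
move=> /derivable1P df dK.
have dg : is_derive (0 : R) (1 : R) (fun h : R => f (h *: v + x)) ('D_v f x).
  by split => //; rewrite derive_slice.
have dK' : is_derive ((fun h : R => f (h *: v + x)) 0) (1 : R) K k.
  by rewrite scale0r add0r.
have [d1 d2] := is_derive1_comp dK' dg.
by split; [apply/derivable1P|rewrite derive_slice -d2].
Qed.

(** Existence of the partial derivatives and their values are packed together,
which suits the sum, product and chain rules. *)
Lemma CnE n f : Cn n.+1 f ->
  [/\ continuous f, forall x, is_derive x e1 f ('D_e1 f x),
      forall x, is_derive x e2 f ('D_e2 f x), Cn n ('D_e1 f) & Cn n ('D_e2 f)].
Proof.
move=> [cf df f1 f2]; split => //.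
  by move=> x; apply: derivableP; have [] := df x.
by move=> x; apply: derivableP; have [] := df x.
Qed.

Lemma CnS n f a b : continuous f -> (forall x, is_derive x e1 f (a x)) ->
  (forall x, is_derive x e2 f (b x)) -> Cn n a -> Cn n b -> Cn n.+1 f.
Proof.
move=> cf fa fb ca cb; split => //.
- by have -> : 'D_e1 f = a by apply/funext => x; have [] := fa x.
- by have -> : 'D_e2 f = b by apply/funext => x; have [] := fb x.
Qed.

Lemma CnW n f : Cn n.+1 f -> Cn n f.
Proof.
elim: n f => [|n IH] f /CnE[cf f1 f2 c1 c2]; first exact: cf.
exact: (CnS cf f1 f2 (IH _ c1) (IH _ c2)).
Qed.

Lemma Cn_cst n c : Cn n (cst c : R * R -> R).
Proof.
elim: n c => [|n IH] c; first by move=> x; exact: cst_continuous.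
by apply: (@CnS n _ (cst 0) (cst 0)) => // x; exact: cst_continuous.
Qed.

Lemma CnD n f g : Cn n f -> Cn n g -> Cn n (f + g).
Proof.
elim: n f g => [|n IH] f g.
  by move=> cf cg x; apply: continuousD; [exact: cf|exact: cg].
move=> /CnE[cf f1 f2 cf1 cf2] /CnE[cg g1 g2 cg1 cg2].
apply: (CnS _ (fun x => is_deriveD (f1 x) (g1 x)) (fun x => is_deriveD (f2 x) (g2 x))).
- by move=> x; apply: continuousD; [exact: cf|exact: cg].
- exact: (IH _ _ cf1 cg1).
- exact: (IH _ _ cf2 cg2).
Qed.

Lemma CnM n f g : Cn n f -> Cn n g -> Cn n (f * g).
Proof.
elim: n f g => [|n IH] f g.
  by move=> cf cg x; apply: continuousM; [exact: cf|exact: cg].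
move=> Hf Hg; have Hf' := CnW Hf; have Hg' := CnW Hg.
move: Hf Hg => /CnE[cf f1 f2 cf1 cf2] /CnE[cg g1 g2 cg1 cg2].
apply: (CnS _ (fun x => is_deriveM (f1 x) (g1 x)) (fun x => is_deriveM (f2 x) (g2 x))).
- by move=> x; apply: continuousM; [exact: cf|exact: cg].
- exact: (CnD (IH _ _ Hf' cg1) (IH _ _ Hg' cf1)).
- exact: (CnD (IH _ _ Hf' cg2) (IH _ _ Hg' cf2)).
Qed.

Lemma CnZ n c f : Cn n f -> Cn n (fun x => c * f x).
Proof. by move=> Hf; exact: (CnM (Cn_cst n c) Hf). Qed.

Lemma Cn_derive n f : (forall n, Cn n f) -> Cn n ('D_e1 f) /\ Cn n ('D_e2 f).
Proof. by move=> /(_ n.+1) /CnE[]. Qed.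

Lemma continuous_comp1 (K : R -> R) f : continuous K -> continuous f -> continuous (K \o f).
Proof. by move=> cK cf x; apply: continuous_comp; [exact: cf|exact: cK]. Qed.

Lemma is_derive_comp2 (K : R -> R) (k : R) f (df : R) x v :
  is_derive x v f df -> is_derive (f x) (1 : R) K k ->
  is_derive x v (K \o f) (k * df).
Proof.
move=> [fd <-] dK; have [d1 d2] := derive_comp1 fd dK; exact: DeriveDef.
Qed.

(** The derivatives of rsq d and rsqrt d are polynomials in the variable and
rsq d. Smoothness of their composites thus follows by induction from the product
rule, without a chain rule of higher order. *)
Definition rsq (d r : R) : R := (Num.sqrt (r ^+ 2 + d ^+ 2))^-1.
Definition rsqrt (d r : R) : R := Num.sqrt (r ^+ 2 + d ^+ 2).

Section Rsqrt.
Variable d : R.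
Hypothesis d0 : 0 < d.

Let q0 r : 0 < r ^+ 2 + d ^+ 2.
Proof. by rewrite ltr_wpDl ?sqr_ge0// exprn_gt0. Qed.

Lemma rsqrt_gt0 r : 0 < rsqrt d r. Proof. by rewrite sqrtr_gt0. Qed.

Lemma sqr_rsqrt r : rsqrt d r ^+ 2 = r ^+ 2 + d ^+ 2.
Proof. by rewrite sqr_sqrtr// ltW. Qed.

Lemma is_derive_rsqrt r : is_derive r (1 : R) (rsqrt d) (r * rsq d r).
Proof.
have h1 : is_derive r (1 : R) (fun r : R => r ^+ 2 + d ^+ 2) (2 * r).
  have -> : (fun r : R => r ^+ 2 + d ^+ 2) = (id ^+ 2 + cst (d ^+ 2)) :> (R -> R).
    by apply/funext => y /=; rewrite !fctE.
  by apply: is_derive_eq; rewrite addr0 expr1 /= /GRing.scale /= mulr1.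
have h2 := is_derive1_sqrt (q0 r).
have := @is_derive1_comp R Num.sqrt (fun r : R => r ^+ 2 + d ^+ 2) r _ _ h2 h1.
suff -> : (2 * Num.sqrt (r ^+ 2 + d ^+ 2))^-1 * (2 * r) = r * rsq d r by [].
rewrite /rsq; field.
by rewrite gt_eqF// sqrtr_gt0.
Qed.

Lemma is_derive_rsq r : is_derive r (1 : R) (rsq d) (-1 * (r * rsq d r * rsq d r * rsq d r)).
Proof.
have h := is_derive_rsqrt r.
have r0 : rsqrt d r != 0 by rewrite gt_eqF// rsqrt_gt0.
have H := is_deriveV r0 h.
suff -> : -1 * (r * rsq d r * rsq d r * rsq d r) = - rsqrt d r ^- 2 *: (r * rsq d r).
  exact: H.
by rewrite /rsq -/(rsqrt d r) /GRing.scale /=; field.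
Qed.

Lemma Cn_rsq n f : Cn n f -> Cn n (rsq d \o f).
Proof.
have cr : continuous (rsq d).
  move=> r; apply: differentiable_continuous; apply/derivable1_diffP.
  by have [] := is_derive_rsq r.
elim: n => [|n IH] Hf; first exact: continuous_comp1.
have Hk := IH (CnW Hf); have Hf' := CnW Hf.
move: Hf => /CnE[cf f1 f2 cf1 cf2].
apply: (CnS _ (fun x => is_derive_comp2 (f1 x) (is_derive_rsq (f x)))
   (fun x => is_derive_comp2 (f2 x) (is_derive_rsq (f x)))).
- exact: continuous_comp1.
- exact: (CnM (CnZ (-1) (CnM (CnM (CnM Hf' Hk) Hk) Hk)) cf1).
- exact: (CnM (CnZ (-1) (CnM (CnM (CnM Hf' Hk) Hk) Hk)) cf2).
Qed.

Lemma Cn_rsqrt n f : Cn n f -> Cn n (rsqrt d \o f).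
Proof.
move=> Hf.
have -> : rsqrt d \o f = (f * f + cst (d ^+ 2)) * (rsq d \o f).
  apply/funext => x /=; rewrite !fctE -expr2 -sqr_rsqrt /rsq -/(rsqrt _ _).
  by rewrite expr2 mulfK// gt_eqF// rsqrt_gt0.
by apply: CnM; [apply: CnD; [exact: CnM|exact: Cn_cst]|exact: Cn_rsq].
Qed.

End Rsqrt.
End DirectionalCalculus.

Section TestFunctions.
Context {R : realType} (Om : set (R * R)).
Hypothesis oOm : open Om.
Implicit Types (f g psi chi : R * R -> R).

Lemma test_intro f (K : set (R * R)) : (forall n, Cn n f) -> compact K -> K `<=` Om ->
  (forall x, f x != 0 -> K x) -> test_function Om f.
Proof.
move=> cf cK KO fK.
have clK : closed K by apply: compact_closed => //; exact: norm_hausdorff.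
have sub : closure [set x | f x != 0] `<=` K.
  by have := closure_subset fK; rewrite -(closure_id K).1.
split => //; last exact: subset_trans KO.
by apply: subclosed_compact cK sub; exact: closed_closure.
Qed.

Lemma test_Cn f n : test_function Om f -> Cn n f. Proof. by case. Qed.

Lemma test_continuous f : test_function Om f -> continuous f.
Proof. by move=> /(@test_Cn _ 0%N). Qed.

Lemma test_supp f x : test_function Om f -> ~ closure [set x | f x != 0] x -> f x = 0.
Proof.
move=> _ H; apply/eqP; apply: contrapT => /negP fx; apply: H.
exact: subset_closure.
Qed.

Lemma test_out f x : test_function Om f -> ~ Om x -> f x = 0.
Proof. by move=> tf xO; apply: test_supp => // fx; apply: xO; have [_ _] := tf; exact. Qed.

Lemma testD f g : test_function Om f -> test_function Om g -> test_function Om (f + g).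
Proof.
move=> [cf kf sf] [cg kg sg].
apply: (@test_intro _ (closure [set x | f x != 0] `|` closure [set x | g x != 0])).
- by move=> n; exact: CnD.
- exact: compactU.
- by move=> x [/sf|/sg].
- move=> x; rewrite !fctE => fg.
  have [fx|fx] := eqVneq (f x) 0; last by left; exact: subset_closure.
  by right; apply: subset_closure => /=; apply: contra_neq fg => ->; rewrite fx addr0.
Qed.

Lemma testM f g : test_function Om f -> (forall n, Cn n g) -> test_function Om (f * g).
Proof.
move=> [cf kf sf] cg; apply: (@test_intro _ (closure [set x | f x != 0])) => //.
- by move=> n; exact: CnM.
- by move=> x fg; apply: subset_closure => /=; apply: contra_neq fg => fx; rewrite !fctE fx mul0r.
Qed.

Lemma testZ f c : test_function Om f -> test_function Om (fun x => c * f x).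
Proof.
move=> tf; have := testM tf (fun n => Cn_cst n c).
by congr test_function; apply/funext => x; rewrite !fctE mulrC.
Qed.

Lemma test0 : test_function Om (fun=> 0).
Proof.
apply: (@test_intro _ set0); [by move=> n; exact: Cn_cst|exact: compact0|by []|].
by move=> x /=; rewrite eqxx.
Qed.

Lemma test_sum (I : Type) (r : seq I) (F : I -> R * R -> R) :
  (forall i, test_function Om (F i)) -> test_function Om (fun x => \sum_(i <- r) F i x).
Proof.
move=> tF; elim: r => [|i r IH].
  by under [X in test_function _ X]funext do rewrite big_nil; exact: test0.
by under [X in test_function _ X]funext do rewrite big_cons; exact: (testD (tF i) IH).
Qed.

Lemma test_comp f (K : R -> R) : K 0 = 0 -> (forall n f, Cn n f -> Cn n (K \o f)) ->
  test_function Om f -> test_function Om (K \o f).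
Proof.
move=> K0 cK [cf kf sf]; apply: (@test_intro _ (closure [set x | f x != 0])) => //.
- by move=> n; exact: cK.
- move=> x fg; apply: subset_closure => /=; apply: contra_neq fg => fx /=.
  by rewrite fx.
Qed.

Lemma test_derive f v : test_function Om f -> (forall n, Cn n ('D_v f)) ->
  test_function Om ('D_v f).
Proof.
move=> tf cD; have [cf kf sf] := tf.
apply: (@test_intro _ (closure [set x | f x != 0])) => // x Dx.
apply: contrapT => nx; move/eqP: Dx; apply.
have : \forall y \near x, f y = cst 0 y.
  have : nbhs x (~` closure [set x | f x != 0]).
    by apply: open_nbhs_nbhs; split => //; apply: closed_openC; exact: closed_closure.
  by apply: filterS => y; exact: test_supp.
have [->|v0] := eqVneq v 0; first by rewrite derive0.
by move=> H; rewrite (@near_eq_derive _ _ _ f (cst 0) x v H) derive_cst.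
Qed.

Lemma test_derive1 f : test_function Om f -> test_function Om ('D_e1 f).
Proof. by move=> tf; apply: test_derive => // n; have [] := Cn_derive n (fun m => test_Cn m tf). Qed.

Lemma test_derive2 f : test_function Om f -> test_function Om ('D_e2 f).
Proof. by move=> tf; apply: test_derive => // n; have [] := Cn_derive n (fun m => test_Cn m tf). Qed.

Lemma test_is_derive1 f x : test_function Om f -> is_derive x e1 f ('D_e1 f x).
Proof. by move=> /(@test_Cn _ 1%N)/CnE[]. Qed.

Lemma test_is_derive2 f x : test_function Om f -> is_derive x e2 f ('D_e2 f x).
Proof. by move=> /(@test_Cn _ 1%N)/CnE[]. Qed.

Lemma test_bounded f : test_function Om f -> exists C : R, 0 < C /\ forall x, `|f x| <= C.
Proof.
move=> tf; have [cf kf sf] := tf.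
have [M [Mr HM]] := compact_bounded (continuous_compact (continuous_subspaceT (test_continuous tf)) kf).
exists (`|M| + 1); split; first by rewrite ltr_wpDl.
move=> x; have [->|fx] := eqVneq (f x) 0; first by rewrite normr0 addr_ge0.
apply: HM; first by rewrite (le_lt_trans (ler_norm M))// ltrDl.
by exists x => //; exact: subset_closure.
Qed.

Lemma test_measurable f : test_function Om f -> measurable_fun setT f.
Proof.
move=> /test_continuous cf; apply: open_continuous_measurable2; first exact: openT.
by move=> x _; exact: cf.
Qed.

Lemma test_L2 f : (leb2 Om < +oo)%E -> test_function Om f -> L2 Om f.
Proof.
move=> fin tf; have [C [_ HC]] := test_bounded tf.
apply: (@L2_bounded _ _ (open_measurable2 oOm) fin _ C) => //.
by apply: (measurable_funS measurableT) => //; exact: test_measurable.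
Qed.

End TestFunctions.

(** * Signed distance to an interval *)

Section Gap.
Context {R : realType}.
Implicit Types (M d r a b : R).

(** The signed distance to the interval [-M, M]. It is the derivative of the convex
function gap^2 / 2. *)
Definition gap M r := r + (`|r - M| - `|r + M|) / 2.

Lemma gap_cases M r : 0 <= M ->
  [\/ r <= - M /\ gap M r = r + M, [/\ - M <= r, r <= M & gap M r = 0] | M <= r /\ gap M r = r - M].
Proof.
move=> M0; rewrite /gap.
have [h1|h1] := leP r (- M).
  apply: Or31; split => //; rewrite (ler0_norm (_ : r - M <= 0)); last lra.
  by rewrite (ler0_norm (_ : r + M <= 0)); lra.
have [h2|h2] := leP r M.
  apply: Or32; split; [exact: ltW|by []|].
  rewrite (ler0_norm (_ : r - M <= 0)); last lra.
  by rewrite (ger0_norm (_ : 0 <= r + M)); lra.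
apply: Or33; split; first exact: ltW.
rewrite (ger0_norm (_ : 0 <= r - M)); last lra.
by rewrite (ger0_norm (_ : 0 <= r + M)); lra.
Qed.

(** A convex function lies above its tangents. *)
Lemma gap_tangent M a b : 0 <= M -> gap M b * (a - b) <= gap M a ^+ 2 / 2 - gap M b ^+ 2 / 2.
Proof.
move=> M0.
suff : 0 <= gap M b * ((gap M a - a) - (gap M b - b)).
  by have := sqr_ge0 (gap M a - gap M b); nra.
by case: (gap_cases a M0) => [[ha ->]|[ha ha' ->]|[ha ->]]; case: (gap_cases b M0) => [[hb ->]|[hb hb' ->]|[hb ->]]; nra.
Qed.

Lemma gap_lipschitz M a b : 0 <= M -> `|gap M a - gap M b| <= `|a - b|.
Proof.
move=> M0; case: (gap_cases a M0) => [[ha ->]|[ha ha' ->]|[ha ->]];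
case: (gap_cases b M0) => [[hb ->]|[hb hb' ->]|[hb ->]];
by rewrite ler_norml; have [ab|ab] := leP 0 (a - b);
  rewrite ?(ger0_norm ab) ?(ltr0_norm ab); apply/andP; split; lra.
Qed.

Lemma gap0 M : 0 <= M -> gap M 0 = 0.
Proof. by move=> M0; case: (gap_cases 0 M0) => [[h ->]|[h h' ->]|[h ->]]; lra. Qed.

Lemma gap_le M r : 0 <= M -> `|gap M r| <= `|r|.
Proof. by move=> M0; have := gap_lipschitz r 0 M0; rewrite gap0// !subr0. Qed.

Lemma gap_mulr_ge0 M r : 0 <= M -> 0 <= gap M r * r.
Proof. by move=> M0; case: (gap_cases r M0) => [[h ->]|[h h' ->]|[h ->]]; nra. Qed.

Lemma gap_eq0 M r : 0 <= M -> gap M r = 0 -> `|r| <= M.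
Proof.
by move=> M0; rewrite ler_norml; case: (gap_cases r M0) => [[h ->]|[h h' ->]|[h ->]] e; apply/andP; split; lra.
Qed.

Lemma gap_small M r : 0 <= M -> `|r| <= M -> gap M r = 0.
Proof.
by move=> M0; rewrite ler_norml => /andP[? ?]; case: (gap_cases r M0) => [[h ->]|[h h' ->]|[h ->]]; lra.
Qed.

Lemma gap_continuous M : 0 <= M -> continuous (gap M).
Proof.
move=> M0 r; apply/cvgrPdist_lt => e e0; near=> y.
apply: le_lt_trans (gap_lipschitz r y M0) _.
near: y; exact: cvgr_dist_lt.
Unshelve. all: by end_near. Qed.

(** The absolute values in gap are smoothed into square roots. The result vanishes
at 0 and preserves smoothness, hence maps test functions to test functions. *)
Definition sgap d M r := r + (rsqrt d (r - M) - rsqrt d (r + M)) / 2.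
Definition dsgap d M r := 1 + ((r - M) * rsq d (r - M) - (r + M) * rsq d (r + M)) / 2.

Lemma rsqrt_near d r : 0 < d -> `|r| <= rsqrt d r <= `|r| + d.
Proof.
move=> d0; have h := sqr_rsqrt d0 r; have h0 := rsqrt_gt0 d0 r; have n0 := normr_ge0 r.
have nn : `|r| ^+ 2 = r ^+ 2 by rewrite real_normK ?num_real.
apply/andP; split.
  by rewrite -(@ler_pXn2r _ 2)// ?nnegrE ?(ltW h0)// h nn; nra.
rewrite -(@ler_pXn2r _ 2)// ?nnegrE ?(ltW h0) ?addr_ge0 ?(ltW d0)//.
by rewrite h -nn; nra.
Qed.

Lemma sgap_near d M r : 0 < d -> `|sgap d M r - gap M r| <= d.
Proof.
move=> d0; have /andP[a1 a2] := rsqrt_near (r - M) d0; have /andP[b1 b2] := rsqrt_near (r + M) d0.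
by rewrite /sgap /gap ler_norml; apply/andP; split; lra.
Qed.

Lemma sgap0 d M : sgap d M 0 = 0.
Proof. by rewrite /sgap /rsqrt sub0r !add0r sqrrN subrr mul0r. Qed.

Lemma is_derive_sgap d M r : 0 < d -> is_derive r (1 : R) (sgap d M) (dsgap d M r).
Proof.
move=> d0.
have h1 : is_derive r (1 : R) (fun x : R => rsqrt d (x - M)) ((r - M) * rsq d (r - M)).
  have dl : is_derive r (1 : R) (fun x : R => x - M) 1.
    by apply: is_derive_eq; rewrite subr0.
  by have := @is_derive1_comp R (rsqrt d) (fun x : R => x - M) r _ _ (is_derive_rsqrt d0 _) dl; rewrite mulr1.
have h2 : is_derive r (1 : R) (fun x : R => rsqrt d (x + M)) ((r + M) * rsq d (r + M)).
  have dl : is_derive r (1 : R) (fun x : R => x + M) 1.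
    by apply: is_derive_eq; rewrite addr0.
  by have := @is_derive1_comp R (rsqrt d) (fun x : R => x + M) r _ _ (is_derive_rsqrt d0 _) dl; rewrite mulr1.
have -> : sgap d M = id + 2^-1 *: ((fun x : R => rsqrt d (x - M)) - (fun x : R => rsqrt d (x + M))).
  by apply/funext => x; rewrite !fctE /sgap /GRing.scale /= mulrC.
have H := is_deriveD (is_derive_id r (1 : R)) (is_deriveZ 2^-1 (is_deriveB h1 h2)).
by move: H; rewrite /dsgap /GRing.scale /= [in X in is_derive _ _ _ X]mulrC.
Qed.

Lemma dsgap_bound d M r : 0 < d -> 0 <= dsgap d M r <= 2.
Proof.
move=> d0.
have H y : -1 <= y * rsq d y <= 1.
  rewrite -ler_norml normrM /rsq -/(rsqrt d y) (gtr0_norm (_ : 0 < (rsqrt d y)^-1)).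
    by rewrite ler_pdivrMr ?rsqrt_gt0// mul1r; have /andP[] := rsqrt_near y d0.
  by rewrite invr_gt0 rsqrt_gt0.
have /andP[] := H (r - M); have /andP[] := H (r + M).
by rewrite /dsgap => *; apply/andP; split; lra.
Qed.

Lemma Cn_sgap d M n f : 0 < d -> Cn n f -> Cn n (sgap d M \o f).
Proof.
move=> d0 Hf.
have -> : sgap d M \o f = f + ((cst 2^-1) * ((rsqrt d \o (f + cst (- M))) + (cst (-1) * (rsqrt d \o (f + cst M))))).
  by apply/funext => x; rewrite !fctE /= ?fctE /sgap mulrC mulN1r.
apply: CnD => //; apply: CnM; first exact: Cn_cst.
apply: CnD; first by apply: Cn_rsqrt => //; apply: CnD => //; exact: Cn_cst.
apply: CnM; first exact: Cn_cst.
by apply: Cn_rsqrt => //; apply: CnD => //; exact: Cn_cst.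
Qed.

Lemma sgap_lipschitz d M a b : 0 < d -> `|sgap d M a - sgap d M b| <= 2 * `|a - b|.
Proof.
move=> d0; wlog ab : a b / b <= a.
  move=> W; have [/W//|/ltW/W] := leP b a.
  by rewrite distrC (distrC b).
have dd x : x \in `]b, a[%R -> is_derive x (1 : R) (sgap d M) (dsgap d M x).
  by move=> _; exact: is_derive_sgap.
have cc : {within `[b, a], continuous (sgap d M)}.
  apply: continuous_subspaceT => x; apply: differentiable_continuous.
  by apply/derivable1_diffP; have [] := is_derive_sgap M x d0.
have [c _ ->] := MVT_segment ab dd cc.
have /andP[h0 h2] := dsgap_bound M c d0.
by rewrite normrM ger0_norm// ler_wpM2r.
Qed.

End Gap.

(** * Integration along slices and the Poincare inequality on a square *)

Section Primitive.
Context {R : realType}.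
Local Notation mu := (@lebesgue_measure R).

(** The primitive is the integral from a. It is not claimed to be differentiable at a,
as it is constant on the left of a. *)
Lemma primitive_from (f : R -> R) (a : R) : continuous f ->
  exists S : R -> R, (forall x, a < x -> is_derive x (1 : R) S (f x)) /\
    (forall x y, a < x -> x <= y -> (\int[mu]_(t in `[x, y]) f t)%R = S y - S x).
Proof.
move=> cf.
have If x y : mu.-integrable `[x, y] (EFin \o f).
  by apply: continuous_compact_integrable; [exact: segment_compact|exact: continuous_subspaceT].
exists (fun x => \int[mu]_(t in `[a, x]) f t)%R; split.
  move=> x ax.
  have := @continuous_FTC1_closed R f a x (x + 1) _ (If a (x + 1)) ax (cf x).
  rewrite ltrDl ltr01 => /(_ isT)[d1 d2].
  by apply: DeriveDef; [exact: d1|rewrite -derive1E].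
move=> x y ax xy; rewrite (@Rintegral_itvB R f (BLeft a) (BRight y) x)//.
- rewrite Rintegral_itv_obnd_cbnd//.
  apply: (@integrableS _ _ _ mu `[x, y] `]x, y]) => //.
  by apply: subset_itvr; rewrite bnd_simp.
- by rewrite bnd_simp ltW.
Qed.

Lemma nondecreasing_of_derive (S s : R -> R) (a b : R) : a <= b ->
  (forall x, a <= x <= b -> is_derive x (1 : R) S (s x)) ->
  (forall x, a <= x <= b -> 0 <= s x) -> S a <= S b.
Proof.
move=> ab dS s0.
have cS : {within `[a, b], continuous S}.
  apply: derivable_within_continuous => x; rewrite in_itv /= => /dS[]//.
have dS' x : x \in `]a, b[%R -> is_derive x (1 : R) S (s x).
  by rewrite in_itv /= => /andP[ax xb]; apply: dS; rewrite !ltW.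
have [c] := MVT_segment ab dS' cS.
rewrite in_itv /= => cab E; rewrite -subr_ge0 E mulr_ge0 ?s0//.
by rewrite subr_ge0.
Qed.

(** Cauchy-Schwarz for the increment of P, seen as the integral of f. Integrals are
avoided by comparing derivatives: (f - t)^2 >= 0 for t the mean slope of P. *)
Lemma sqr_increment_le (P S f : R -> R) (a b : R) : a <= b ->
  (forall x, a <= x <= b -> is_derive x (1 : R) P (f x)) ->
  (forall x, a <= x <= b -> is_derive x (1 : R) S (f x ^+ 2)) ->
  (P b - P a) ^+ 2 <= (b - a) * (S b - S a).
Proof.
rewrite le_eqVlt => /predU1P[->|ab]; first by rewrite !subrr expr0n mul0r.
move=> dP dS; have ab0 : 0 < b - a by rewrite subr_gt0.
pose t := (P b - P a) / (b - a).
have H : S a + (-2 * t) * P a + t ^+ 2 * a <= S b + (-2 * t) * P b + t ^+ 2 * b.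
  apply: (@nondecreasing_of_derive (fun x => S x + (-2 * t) * P x + t ^+ 2 * x)
           (fun x => (f x - t) ^+ 2)); first exact: ltW.
    move=> x xab.
    have := is_deriveD (is_deriveD (dS x xab) (is_deriveZ (-2 * t) (dP x xab)))
      (is_deriveZ (t ^+ 2) (is_derive_id x (1 : R))).
    have -> : f x ^+ 2 + (-2 * t) *: f x + (t ^+ 2) *: 1 = (f x - t) ^+ 2.
      by rewrite /GRing.scale /=; ring.
    by [].
  by move=> x _; exact: sqr_ge0.
have E : P b - P a = t * (b - a) by rewrite /t mulfVK// gt_eqF.
have E2 : 2 * t * (P b - P a) - t ^+ 2 * (b - a) = t ^+ 2 * (b - a) by rewrite E; ring.
have K : t ^+ 2 * (b - a) <= S b - S a by rewrite -E2; lra.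
rewrite E exprMn [(b - a) ^+ 2]expr2 mulrA [leRHS]mulrC ler_wpM2r//.
exact: ltW.
Qed.

End Primitive.

Section FubiniCell.
Context {R : realType}.
Local Notation mu := (@lebesgue_measure R).
Implicit Types (f : R * R -> R) (I J : set R).

Lemma leb2X I J : measurable I -> measurable J -> leb2 (I `*` J) = (mu I * mu J)%E.
Proof. by move=> mI mJ; rewrite /leb2 product_measure1E. Qed.

Variables (I J : set R).
Hypothesis (mI : measurable I) (mJ : measurable J).
Hypothesis (fI : (mu I < +oo)%E) (fJ : (mu J < +oo)%E).
Variable f : R * R -> R.
Hypothesis mf : measurable_fun setT f.
Variable C : R.
Hypothesis fC : forall z, `|f z| <= C.

Let mIJ : measurable (I `*` J). Proof. exact: measurableX. Qed.

Let fIJ : (leb2 (I `*` J) < +oo)%E.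
Proof. by rewrite leb2X//; apply: lte_mul_pinfty => //; rewrite ge0_fin_numE. Qed.

Lemma cell_integrable : leb2.-integrable (I `*` J) (EFin \o f).
Proof.
apply: (@measurable_bounded_integrable _ _ _ leb2 f (I `*` J) mIJ fIJ).
  exact: measurable_funTS.
exists C; split; first exact: num_real.
by move=> y Cy x _; apply: le_trans (fC x) (ltW Cy).
Qed.

Lemma slice1_integrable x : mu.-integrable J (EFin \o (fun y => f (x, y))).
Proof.
apply: measurable_bounded_integrable => //.
  by apply: measurable_funTS; apply: measurableT_comp.
exists C; split; first exact: num_real.
by move=> y Cy z _; apply: le_trans (fC _) (ltW Cy).
Qed.

Lemma slice2_integrable y : mu.-integrable I (EFin \o (fun x => f (x, y))).
Proof.
apply: measurable_bounded_integrable => //.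
  by apply: measurable_funTS; apply: measurableT_comp.
exists C; split; first exact: num_real.
by move=> z Cz x _; apply: le_trans (fC _) (ltW Cz).
Qed.

Let If : leb2.-integrable setT (EFin \o (f \_ (I `*` J))).
Proof.
have mIJ' := mIJ.
by rewrite -restrict_EFin; apply/(integrable_mkcond (mu := leb2) _ mIJ').1; exact: cell_integrable.
Qed.

Lemma fubini_cell1 : (\int[leb2]_(z in I `*` J) f z = \int[mu]_(x in I) \int[mu]_(y in J) f (x, y))%R.
Proof.
rewrite /Rintegral; congr fine.
rewrite integral_mkcond restrict_EFin.
have := @integral12_prod_meas1 _ _ _ _ _ mu mu _ If => <-.
rewrite [RHS]integral_mkcond; apply: eq_integral => x _.
rewrite /fubini_F patchE; case: ifPn => xI.
  rewrite fineK; last by apply: integrable_fin_num => //; exact: slice1_integrable.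
  rewrite [RHS]integral_mkcond; apply: eq_integral => y _ /=.
  by rewrite !patchE in_setX xI /=; case: ifP.
by rewrite integral0_eq// => y _ /=; rewrite patchE in_setX (negbTE xI).
Qed.

Lemma fubini_cell2 : (\int[leb2]_(z in I `*` J) f z = \int[mu]_(y in J) \int[mu]_(x in I) f (x, y))%R.
Proof.
rewrite /Rintegral; congr fine.
rewrite integral_mkcond restrict_EFin.
have := @integral21_prod_meas1 _ _ _ _ _ mu mu _ If => <-.
rewrite [RHS]integral_mkcond; apply: eq_integral => y _.
rewrite /fubini_G patchE; case: ifPn => yJ.
  rewrite fineK; last by apply: integrable_fin_num => //; exact: slice2_integrable.
  rewrite [RHS]integral_mkcond; apply: eq_integral => x _ /=.
  by rewrite !patchE in_setX yJ andbT /=; case: ifP.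
by rewrite integral0_eq// => x _ /=; rewrite patchE in_setX (negbTE yJ) andbF.
Qed.

Hypothesis f0 : forall z, 0 <= f z.

Lemma slice1_measurable : measurable_fun setT (fun x => \int[mu]_(y in J) f (x, y))%R.
Proof.
have mF : measurable_fun setT (fun z : R * R => ((f \_ (setT `*` J)) z)%:E).
  apply/measurable_EFinP; apply/(measurable_restrictT _ _).1.
    by apply: measurableX.
  exact: measurable_funTS.
have F0 z : (0 <= ((f \_ (setT `*` J)) z)%:E)%E.
  by rewrite patchE; case: ifP; rewrite lee_fin ?f0.
have := @measurable_fun_fubini_tonelli_F _ _ _ _ _ mu _ mF F0.
have mfine : measurable_fun [set: \bar R] (@fine R) by exact: fine_measurable.
move=> /(measurableT_comp mfine).
apply: eq_measurable_fun => x _ /=; rewrite /fubini_F /Rintegral; congr fine.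
rewrite [RHS]integral_mkcond; apply: eq_integral => y _.
by rewrite !patchE in_setX in_setT /=; case: ifP.
Qed.

Lemma slice2_measurable : measurable_fun setT (fun y => \int[mu]_(x in I) f (x, y))%R.
Proof.
have mF : measurable_fun setT (fun z : R * R => ((f \_ (I `*` setT)) z)%:E).
  apply/measurable_EFinP; apply/(measurable_restrictT _ _).1.
    by apply: measurableX.
  exact: measurable_funTS.
have F0 z : (0 <= ((f \_ (I `*` setT)) z)%:E)%E.
  by rewrite patchE; case: ifP; rewrite lee_fin ?f0.
have := @measurable_fun_fubini_tonelli_G _ _ _ _ _ mu _ mF F0.
have mfine : measurable_fun [set: \bar R] (@fine R) by exact: fine_measurable.
move=> /(measurableT_comp mfine).
apply: eq_measurable_fun => y _ /=; rewrite /fubini_G /Rintegral; congr fine.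
rewrite [RHS]integral_mkcond; apply: eq_integral => x _.
by rewrite !patchE in_setX in_setT andbT /=; case: ifP.
Qed.

Lemma slice1_bound x : 0 <= (\int[mu]_(y in J) f (x, y))%R <= C * fine (mu J).
Proof.
rewrite Rintegral_ge0//= -Rintegral_cst//; apply: le_Rintegral => //.
- exact: slice1_integrable.
- apply: measurable_bounded_integrable => //.
  by exists `|C|; split; [exact: num_real|move=> y /ltW ? z _].
- by move=> y _; apply: le_trans (ler_norm _) (fC _).
Qed.

Lemma slice2_bound y : 0 <= (\int[mu]_(x in I) f (x, y))%R <= C * fine (mu I).
Proof.
rewrite Rintegral_ge0//= -Rintegral_cst//; apply: le_Rintegral => //.
- exact: slice2_integrable.
- apply: measurable_bounded_integrable => //.
  by exists `|C|; split; [exact: num_real|move=> x /ltW ? z _].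
- by move=> x _; apply: le_trans (ler_norm _) (fC _).
Qed.

End FubiniCell.

Section Slices.
Context {R : realType}.
Local Notation mu := (@lebesgue_measure R).

Lemma is_derive_slice1 (f : R * R -> R) (s y d : R) :
  is_derive (s, y) e1 f d -> is_derive s (1 : R) (fun t : R => f (t, y)) d.
Proof.
have E : (fun h : R => h^-1 *: (f (h *: e1 + (s, y)) - f (s, y))) =
         (fun h : R => h^-1 *: (f (h *: (1 : R) + s, y) - f (s, y))).
  apply/funext => h; congr (_ *: (f _ - _)).
  by rewrite /e1; congr pair; rewrite /= /GRing.scale /= mulr0 add0r.
by move=> [d1 d2]; split; [move: d1; rewrite /derivable /= E|move: d2; rewrite /derive /= E].
Qed.

Lemma is_derive_slice2 (f : R * R -> R) (x s d : R) :
  is_derive (x, s) e2 f d -> is_derive s (1 : R) (fun t : R => f (x, t)) d.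
Proof.
have E : (fun h : R => h^-1 *: (f (h *: e2 + (x, s)) - f (x, s))) =
         (fun h : R => h^-1 *: (f (x, h *: (1 : R) + s) - f (x, s))).
  apply/funext => h; congr (_ *: (f _ - _)).
  by rewrite /e2; congr pair; rewrite /= /GRing.scale /= mulr0 add0r.
by move=> [d1 d2]; split; [move: d1; rewrite /derivable /= E|move: d2; rewrite /derive /= E].
Qed.

Lemma continuous_slice1 (f : R * R -> R) y : continuous f -> continuous (fun s => f (s, y)).
Proof.
move=> cf s; apply/cvgrPdist_lt => eps eps0.
have /cvgrPdist_lt/(_ _ eps0)/nbhs_ballP[e /= e0 H] := cf (s, y).
apply/nbhs_ballP; exists e => // t st; apply: (H (t, y)).
by split => //=; exact: ballxx.
Qed.

Lemma continuous_slice2 (f : R * R -> R) x : continuous f -> continuous (fun s => f (x, s)).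
Proof.
move=> cf s; apply/cvgrPdist_lt => eps eps0.
have /cvgrPdist_lt/(_ _ eps0)/nbhs_ballP[e /= e0 H] := cf (x, s).
apply/nbhs_ballP; exists e => // t st; apply: (H (x, t)).
by split => //=; exact: ballxx.
Qed.

Lemma measurable_comp_fst (g : R -> R) : measurable_fun setT g ->
  measurable_fun setT (fun z : R * R => g z.1).
Proof. by move=> mg; apply: (@measurableT_comp _ _ _ _ _ _ g _ fst). Qed.

Lemma measurable_comp_snd (g : R -> R) : measurable_fun setT g ->
  measurable_fun setT (fun z : R * R => g z.2).
Proof. by move=> mg; apply: (@measurableT_comp _ _ _ _ _ _ g _ snd). Qed.

Lemma bounded_integrable1 (g : R -> R) (D : set R) (C : R) : measurable D ->
  (mu D < +oo)%E -> measurable_fun setT g -> (forall x, `|g x| <= C) ->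
  mu.-integrable D (EFin \o g).
Proof.
move=> mD fD mg gC; apply: measurable_bounded_integrable => //.
  exact: measurable_funTS.
exists C; split; first exact: num_real.
by move=> y Cy x _; apply: le_trans (gC x) (ltW Cy).
Qed.

Lemma ge0_Rintegral_subset d (T : measurableType d) (m : {measure set T -> \bar R})
    (A B : set T) (f : T -> R) :
  measurable A -> measurable B -> A `<=` B -> m.-integrable B (EFin \o f) ->
  (forall x, B x -> 0 <= f x) ->
  (\int[m]_(x in A) f x <= \int[m]_(x in B) f x)%R.
Proof.
move=> mA mB AB If f0; rewrite -lee_fin /Rintegral !fineK.
- apply: ge0_subset_integral => //; first exact: measurable_int If.
- exact: (@integrable_fin_num _ _ _ m B).
- by apply: (@integrable_fin_num _ _ _ m A) => //; exact: integrableS If.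
Qed.

Lemma sqr_increment_cell (P p : R -> R) (a b x y : R) : continuous p ->
  (forall s, is_derive s (1 : R) P (p s)) -> a <= x < b -> a <= y < b ->
  (P x - P y) ^+ 2 <= (b - a) * (\int[mu]_(s in `[a, b[) (p s ^+ 2))%R.
Proof.
move=> cp dP; wlog xy : x y / y <= x.
  move=> W hx hy; have [/W|/ltW/W] := leP y x; first exact.
  by rewrite -sqrrN opprB; exact.
move=> /andP[ax xb] /andP[ay yb].
have cp2 : continuous (fun s => p s ^+ 2).
  by move=> s; apply: (@continuousM _ _ p p); exact: cp.
have [S [dS iS]] := primitive_from (a - 1) cp2.
have a1y : a - 1 < y by lra.
have dS' s : y <= s <= x -> is_derive s (1 : R) S (p s ^+ 2).
  by move=> /andP[h _]; apply: dS; lra.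
have := sqr_increment_le xy (fun s _ => dP s) dS'.
rewrite -iS// => H; apply: le_trans H _.
have Ip : mu.-integrable `[a, b] (EFin \o (fun s => p s ^+ 2)).
  by apply: continuous_compact_integrable; [exact: segment_compact|exact: continuous_subspaceT].
have I0 : 0 <= (\int[mu]_(t in `[y, x]) (p t ^+ 2))%R.
  by apply: Rintegral_ge0 => t _; exact: sqr_ge0.
apply: ler_pM => //; [lra|lra|].
apply: ge0_Rintegral_subset => //.
- by apply: subset_itv; rewrite bnd_simp.
- apply: integrableS Ip => //; apply: subset_itv; by rewrite bnd_simp.
- by move=> s _; exact: sqr_ge0.
Qed.

End Slices.

Lemma sqr_sub_le2 {R : realType} (u v w h A B : R) :
  (u - v) ^+ 2 <= h * A -> (v - w) ^+ 2 <= h * B ->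
  (u - w) ^+ 2 <= 2 * h * A + 2 * h * B.
Proof. by move=> s1 s2; have := sqr_ge0 ((u - v) - (v - w)); nra. Qed.

Section PoincareCell.
Context {R : realType} (Om : set (R * R)).
Hypothesis oOm : open Om.
Local Notation mu := (@lebesgue_measure R).
Variables (psi : R * R -> R) (tpsi : test_function Om psi) (a b h : R).
Hypothesis h0 : 0 < h.
Let I := `[a, a + h[%classic.
Let J := `[b, b + h[%classic.
Let p : R * R -> R := 'D_e1 psi.
Let q : R * R -> R := 'D_e2 psi.
Let c := I `*` J.

Let mI : measurable I. Proof. exact: measurable_itv. Qed.
Let mJ : measurable J. Proof. exact: measurable_itv. Qed.
Let muI : mu I = h%:E.
Proof. by rewrite lebesgue_measure_itv /= lte_fin ltrDl h0 -EFinB addrAC subrr add0r. Qed.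
Let muJ : mu J = h%:E.
Proof. by rewrite lebesgue_measure_itv /= lte_fin ltrDl h0 -EFinB addrAC subrr add0r. Qed.
Let fI : (mu I < +oo)%E. Proof. by rewrite muI ltry. Qed.
Let fJ : (mu J < +oo)%E. Proof. by rewrite muJ ltry. Qed.
Let mc : measurable c. Proof. exact: measurableX. Qed.
Let muc : leb2 c = (h ^+ 2)%:E.
Proof. by rewrite leb2X// muI muJ -EFinM expr2. Qed.
Let fc : (leb2 c < +oo)%E. Proof. by rewrite muc ltry. Qed.

Let A y := (\int[mu]_(s in I) (p (s, y) ^+ 2))%R.
Let B x := (\int[mu]_(s in J) (q (x, s) ^+ 2))%R.

(** Two points of the cell are joined by a horizontal and a vertical segment; along
each of them the increment of psi is controlled by the integral of the square of
a partial derivative. Averaging over one end point bounds the deviation of psi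
from its mean, and averaging over the other one gives the inequality. *)
Lemma poincare_cell :
  L2dot c psi psi <= h ^- 2 * (L2dot c psi (fun=> 1)) ^+ 2 +
     2 * h ^+ 2 * (L2dot c ('D_e1 psi) ('D_e1 psi) + L2dot c ('D_e2 psi) ('D_e2 psi)).
Proof.
have tp : test_function Om p := test_derive1 tpsi.
have tq : test_function Om q := test_derive2 tpsi.
have [Cp [Cp0 Hp]] := test_bounded tp.
have [Cq [Cq0 Hq]] := test_bounded tq.
have [C [C0 HC]] := test_bounded tpsi.
have L2b (f : R * R -> R) (K : R) : measurable_fun setT f -> (forall z, `|f z| <= K) -> L2 c f.
  move=> mf fK; apply: (@L2_bounded _ _ mc fc _ K); first exact: measurable_funTS.
  by move=> z _.
have mpsi := test_measurable tpsi; have mp := test_measurable tp; have mq := test_measurable tq.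
have Lpsi : L2 c psi := L2b _ _ mpsi HC.
have L1 : L2 c (fun=> 1) by apply: (L2b _ 1) => // z; rewrite normr1.
have mp2 : measurable_fun setT (fun z => p z ^+ 2) by exact: measurable_funX.
have mq2 : measurable_fun setT (fun z => q z ^+ 2) by exact: measurable_funX.
have p2b z : `|p z ^+ 2| <= Cp ^+ 2 by rewrite normrX lerXn2r// nnegrE// ltW.
have q2b z : `|q z ^+ 2| <= Cq ^+ 2 by rewrite normrX lerXn2r// nnegrE// ltW.
have p2g z : 0 <= p z ^+ 2 by exact: sqr_ge0.
have q2g z : 0 <= q z ^+ 2 by exact: sqr_ge0.
have mA : measurable_fun setT A := slice2_measurable mI mp2 p2g.
have mB : measurable_fun setT B := slice1_measurable mJ mq2 q2g.
have bA y : 0 <= A y <= Cp ^+ 2 * h by have := slice2_bound mI fI mp2 p2b p2g y; rewrite muI.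
have bB x : 0 <= B x <= Cq ^+ 2 * h by have := slice1_bound mJ fJ mq2 q2b q2g x; rewrite muJ.
pose P := L2dot c p p; pose Q := L2dot c q q.
have PE : P = (\int[mu]_(y in J) A y)%R.
  rewrite /P /L2dot; under eq_Rintegral do rewrite -expr2.
  exact: (fubini_cell2 mI mJ fI fJ mp2 p2b).
have QE : Q = (\int[mu]_(y in I) B y)%R.
  rewrite /Q /L2dot; under eq_Rintegral do rewrite -expr2.
  exact: (fubini_cell1 mI mJ fI fJ mq2 q2b).
have cstJ r : (\int[mu]_(y in J) (cst r y))%R = r * h.
  by transitivity (r * fine (mu J)); [exact: Rintegral_cst|rewrite muJ].
have cstI r : (\int[mu]_(y in I) (cst r y))%R = r * h.
  by transitivity (r * fine (mu I)); [exact: Rintegral_cst|rewrite muI].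
pose A2 (z : R * R) := A z.2; pose B2 (z : R * R) := B z.1.
have mA2 : measurable_fun setT A2 := measurable_comp_snd mA.
have mB2 : measurable_fun setT B2 := measurable_comp_fst mB.
have bA2 z : `|A2 z| <= Cp ^+ 2 * h by have /andP[h1 h2] := bA z.2; rewrite ger0_norm.
have bB2 z : `|B2 z| <= Cq ^+ 2 * h by have /andP[h1 h2] := bB z.1; rewrite ger0_norm.
have LA2 := L2b _ _ mA2 bA2; have LB2 := L2b _ _ mB2 bB2.
have IA : L2dot c A2 (fun=> 1) = h * P.
  rewrite /L2dot; under eq_Rintegral do rewrite mulr1.
  rewrite (fubini_cell2 mI mJ fI fJ mA2 bA2) /A2 /=.
  rewrite PE -RintegralZl//; last first.
    by apply: (bounded_integrable1 mJ fJ mA (C := Cp ^+ 2 * h)) => y; have /andP[h1 h2'] := bA y; rewrite ger0_norm.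
  by apply: eq_Rintegral => y _; rewrite cstI mulrC.
have IB : L2dot c B2 (fun=> 1) = h * Q.
  rewrite /L2dot; under eq_Rintegral do rewrite mulr1.
  rewrite (fubini_cell1 mI mJ fI fJ mB2 bB2) /B2 /=.
  rewrite QE -RintegralZl//; last first.
    by apply: (bounded_integrable1 mI fI mB (C := Cq ^+ 2 * h)) => y; have /andP[h1 h2'] := bB y; rewrite ger0_norm.
  by apply: eq_Rintegral => y _; rewrite cstJ mulrC.
have I1 : L2dot c (fun=> 1) (fun=> 1) = h ^+ 2.
  rewrite /L2dot; under eq_Rintegral do rewrite mulr1.
  by transitivity (1 * fine (leb2 c)); [exact: Rintegral_cst|rewrite muc mul1r].
pose K := L2dot c psi (fun=> 1).
have h2 : 0 < h ^+ 2 by rewrite exprn_gt0.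
have osc z z' : c z -> c z' -> (psi z - psi z') ^+ 2 <= 2 * h * A2 z + 2 * h * B2 z'.
  case: z z' => [x y] [x' y'] [/= cx cy] [/= cx' cy'].
  have s1 : (psi (x, y) - psi (x', y)) ^+ 2 <= h * A y.
    have := @sqr_increment_cell R (fun s => psi (s, y)) (fun s => p (s, y)) a (a + h) x x'.
    rewrite [a + h - a]addrAC subrr add0r; apply => //.
    - by apply: continuous_slice1; exact: test_continuous tp.
    - by move=> s; apply: is_derive_slice1; exact: test_is_derive1 tpsi.
  have s2 : (psi (x', y) - psi (x', y')) ^+ 2 <= h * B x'.
    have := @sqr_increment_cell R (fun s => psi (x', s)) (fun s => q (x', s)) b (b + h) y y'.
    rewrite [b + h - b]addrAC subrr add0r; apply => //.
    - by apply: continuous_slice2; exact: test_continuous tq.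
    - by move=> s; apply: is_derive_slice2; exact: test_is_derive2 tpsi.
  rewrite /A2 /B2 /=.
  exact: sqr_sub_le2 s1 s2.
have dev z : c z -> (psi z - h ^- 2 * K) ^+ 2 <= 2 * h * A2 z + 2 * Q.
  move=> cz.
  pose g := fun z' => psi z * 1 - psi z'.
  have Lg : L2 c g by apply: L2B => //; exact: L2Z.
  have g1 : L2dot c g (fun=> 1) = h ^+ 2 * (psi z - h ^- 2 * K).
    rewrite L2dotBl// ?L2dotZl ?I1//; last exact: L2Z.
    by rewrite mulrBr mulVKf ?gt_eqF// mulrC.
  have := L2_CS2 mc Lg L1; rewrite g1 I1 => H.
  have g2 : L2dot c g g <= L2dot c (fun z' => 2 * h * A2 z * 1 + 2 * h * B2 z') (fun=> 1).
    apply: le_Rintegral => //; try exact: L2M_integrable.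
      by apply: L2M_integrable => //; apply: L2D => //; exact: L2Z.
    move=> z' cz'; rewrite !mulr1 -expr2 /g mulr1; exact: osc.
  have g3 : L2dot c (fun z' => 2 * h * A2 z * 1 + 2 * h * B2 z') (fun=> 1) =
      2 * h * A2 z * h ^+ 2 + 2 * h * (h * Q).
    by rewrite L2dotDl ?L2dotZl ?I1 ?IB//; exact: L2Z.
  rewrite g3 in g2; have := le_trans H (ler_wpM2r (ltW h2) g2).
  rewrite exprMn => H2; rewrite -(@ler_pM2l _ ((h ^+ 2) ^+ 2)) ?exprn_gt0//.
  by apply: le_trans H2 _; rewrite le_eqVlt; apply/orP; left; apply/eqP; ring.
pose g := fun z => psi z - h ^- 2 * K * 1.
have Lg : L2 c g by apply: L2B => //; exact: L2Z.
have gg : L2dot c g g = L2dot c psi psi - h ^- 2 * K ^+ 2.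
  rewrite L2dotBl ?L2dotBr ?L2dotZl ?L2dotZr ?I1//; try exact: L2Z.
  by rewrite (L2dotC c _ psi) -/K; field; rewrite gt_eqF.
have : L2dot c g g <= L2dot c (fun z => 2 * h * A2 z + 2 * Q * 1) (fun=> 1).
  apply: le_Rintegral => //; try exact: L2M_integrable.
    by apply: L2M_integrable => //; apply: L2D => //; exact: L2Z.
  by move=> z cz; rewrite !mulr1 -expr2 /g mulr1; exact: dev.
clearbody g; rewrite gg L2dotDl ?L2dotZl ?I1 ?IA//; try exact: L2Z.
rewrite -/P -/Q -/K lerBlDl => H; apply: (le_trans H).
clearbody P Q K; rewrite le_eqVlt; apply/orP; left; apply/eqP; ring.
Qed.

End PoincareCell.

Section SupportIntegrals.
Context {R : realType} (Om : set (R * R)).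
Hypothesis oOm : open Om.
Local Notation mu := (@lebesgue_measure R).

Lemma Rintegral_supp (A B : set (R * R)) (f : R * R -> R) :
  (forall z, ~ A z -> f z = 0) -> (forall z, ~ B z -> f z = 0) ->
  (\int[leb2]_(z in A) f z = \int[leb2]_(z in B) f z)%R.
Proof.
move=> fA fB; rewrite Rintegral_mkcond [RHS]Rintegral_mkcond.
congr Rintegral; apply/funext => z; rewrite !patchE.
case: ifPn; case: ifPn => //; rewrite ?inE ?notin_setE => zA zB //.
by rewrite fB. by rewrite fA.
Qed.

Lemma Rintegral_FTC (P p : R -> R) (a b : R) : continuous p ->
  (forall s, is_derive s (1 : R) P (p s)) -> a <= b ->
  (\int[mu]_(s in `[a, b[) p s)%R = P b - P a.
Proof.
move=> cp dP ab; have [S [dS iS]] := primitive_from (a - 1) cp.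
have Ip : mu.-integrable `[a, b] (EFin \o p).
  by apply: continuous_compact_integrable; [exact: segment_compact|exact: continuous_subspaceT].
rewrite Rintegral_itv_bndo_bndc; last first.
  by apply: integrableS Ip => //; apply: subset_itv; rewrite bnd_simp.
rewrite iS//; last lra.
have H1 : P a - S a <= P b - S b.
  apply: (@nondecreasing_of_derive R (fun x => P x - S x) (fun x => p x - p x)) => //.
    by move=> x /andP[xa _]; apply: is_deriveB; apply: dS; lra.
  by move=> x _; rewrite subrr.
have H2 : S a - P a <= S b - P b.
  apply: (@nondecreasing_of_derive R (fun x => S x - P x) (fun x => p x - p x)) => //.
    by move=> x /andP[xa _]; apply: is_deriveB; apply: dS; lra.
  by move=> x _; rewrite subrr.
lra.
Qed.

Lemma bounded_box : bounded_set Om -> exists L : R, 0 < L /\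
  forall z, Om z -> (- L < z.1 < L) && (- L < z.2 < L).
Proof.
move=> [M [_ HM]]; exists (`|M| + 2); split; first by rewrite ltr_wpDl.
move=> z Oz; have : `|z| <= `|M| + 1.
  by apply: HM => //; rewrite (le_lt_trans (ler_norm M))// ltrDl.
rewrite prod_normE ge_max => /andP[]; rewrite !ler_norml => /andP[? ?] /andP[? ?].
by apply/andP; split; apply/andP; split; lra.
Qed.

Section Support.
Variables (L : R).
Hypothesis L0 : 0 < L.
Hypothesis OmL : forall z, Om z -> (- L < z.1 < L) && (- L < z.2 < L).
Let I := `[- L, L[%classic.

Let fI : (mu I < +oo)%E.
Proof. by rewrite lebesgue_measure_itv /=; case: ifP; rewrite ?ltry// -EFinB ltry. Qed.

Lemma test_out_box f z : test_function Om f -> ~ (I `*` I) z -> f z = 0.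
Proof.
move=> tf zI; apply: (test_out tf) => Oz; apply: zI.
have /andP[/andP[? ?] /andP[? ?]] := OmL Oz.
by split; rewrite /I /= in_itv /=; apply/andP; split; lra.
Qed.

Lemma test_boundary_out f (z : R * R) : test_function Om f ->
  `|z.1| = L \/ `|z.2| = L -> f z = 0.
Proof.
move=> tf zL; apply: (test_out tf) => Oz.
have /andP[] := OmL Oz; rewrite -!ltr_norml => h1 h2.
by case: zL => e; [move: h1|move: h2]; rewrite e ltxx.
Qed.

(** Fubini reduces this to the fundamental theorem of calculus on the segments of a
box that contains the support. *)
Lemma integral_test_derive f : test_function Om f ->
  (\int[leb2]_(z in Om) 'D_e1 f z)%R = 0 /\ (\int[leb2]_(z in Om) 'D_e2 f z)%R = 0.
Proof.
move=> tf; have t1 := test_derive1 tf; have t2 := test_derive2 tf.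
have [C1 [_ H1]] := test_bounded t1; have [C2 [_ H2]] := test_bounded t2.
have mI : measurable I by exact: measurable_itv.
have LL : - L <= L by rewrite (le_trans _ (ltW L0))// oppr_le0 ltW.
have nL : `|L| = L by rewrite ger0_norm// ltW.
split.
  rewrite (@Rintegral_supp Om (I `*` I)); last 2 first.
    by move=> z; exact: (test_out t1).
    by move=> z; exact: (test_out_box t1).
  rewrite (fubini_cell2 mI mI fI fI (test_measurable t1) H1).
  rewrite (@eq_Rintegral _ _ _ _ _ (fun=> 0)) ?Rintegral_cst ?mul0r// => y _.
  have D s : is_derive s (1 : R) (fun s => f (s, y)) ('D_e1 f (s, y)).
    by apply: is_derive_slice1; exact: test_is_derive1 tf.
  have := Rintegral_FTC (continuous_slice1 (y := y) (test_continuous t1)) D LL => ->.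
  by rewrite !(@test_boundary_out f) ?subrr//; left; rewrite /= ?normrN.
rewrite (@Rintegral_supp Om (I `*` I)); last 2 first.
  by move=> z; exact: (test_out t2).
  by move=> z; exact: (test_out_box t2).
rewrite (fubini_cell1 mI mI fI fI (test_measurable t2) H2).
rewrite (@eq_Rintegral _ _ _ _ _ (fun=> 0)) ?Rintegral_cst ?mul0r// => x _.
have D s : is_derive s (1 : R) (fun s => f (x, s)) ('D_e2 f (x, s)).
  by apply: is_derive_slice2; exact: test_is_derive2 tf.
have := Rintegral_FTC (continuous_slice2 (x := x) (test_continuous t2)) D LL => ->.
by rewrite !(@test_boundary_out f) ?subrr//; right; rewrite /= ?normrN.
Qed.

Lemma box_finite : (leb2 Om < +oo)%E.
Proof.
have mI : measurable I by exact: measurable_itv.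
apply: (@le_lt_trans _ _ (leb2 (I `*` I))).
  apply: le_measure; rewrite ?inE.
  - exact: open_measurable2.
  - exact: measurableX.
  - move=> z Oz; have /andP[/andP[? ?] /andP[? ?]] := OmL Oz.
    by split; rewrite /I /= in_itv /=; apply/andP; split; lra.
by rewrite leb2X//; apply: lte_mul_pinfty => //; rewrite ge0_fin_numE.
Qed.

(** Integration by parts is the vanishing of the integral of the derivative of a
product of two test functions. *)
Lemma test_H10 f : test_function Om f -> H10 Om f ('D_e1 f) ('D_e2 f).
Proof.
move=> tf; have t1 := test_derive1 tf; have t2 := test_derive2 tf.
have fin := box_finite; have mOm := open_measurable2 oOm.
have LT g : test_function Om g -> L2 Om g by exact: test_L2.
split.
  split; [exact: LT|exact: LT|exact: LT|] => psi tpsi.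
  have p1 := test_derive1 tpsi; have p2 := test_derive2 tpsi.
  have tfp := testM tf (fun n => test_Cn n tpsi).
  have [I1 I2] := integral_test_derive tfp.
  split; apply/eqP; rewrite -addr_eq0; apply/eqP.
    rewrite -[RHS]I1 /L2dot -RintegralD//; try (by apply: L2M_integrable => //; exact: LT).
    apply: eq_Rintegral => z _; rewrite deriveM; last 2 first.
      by have [] := test_is_derive1 z tf.
      by have [] := test_is_derive1 z tpsi.
    by rewrite /GRing.scale /= [psi z * _]mulrC.
  rewrite -[RHS]I2 /L2dot -RintegralD//; try (by apply: L2M_integrable => //; exact: LT).
  apply: eq_Rintegral => z _; rewrite deriveM; last 2 first.
    by have [] := test_is_derive2 z tf.
    by have [] := test_is_derive2 z tpsi.
  by rewrite /GRing.scale /= [psi z * _]mulrC.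
have L2self g : L2cvg Om (fun=> g) g.
  rewrite /L2cvg.
  have -> : (fun n : nat => L2norm Om (g \- g)) = cst 0.
    apply/funext => n /=; rewrite (@eq_L2norm _ _ _ (fun=> 0)).
      by rewrite /L2norm L2dot0l// sqrtr0.
    by move=> z _ /=; rewrite subrr.
  exact: cvg_cst.
by exists (fun=> f); split => //; exact: L2self.
Qed.

End Support.
End SupportIntegrals.

(** * The binomial series of a fractional power *)

Section Binomial.
Context {R : realType}.
Variable al : R.
Hypothesis al01 : 0 < al < 1.

(** binA n is the coefficient of x^n in (1 - x)^(al - 1), and - binb j is that of
x^(j+1) in (1 - x)^al; binf n truncates the latter series. The point of these
series is that binA and binb are nonnegative. *)
Fixpoint binA (n : nat) : R := if n is m.+1 then binA m * (1 - al / m.+1%:R) else 1.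
Definition binb (j : nat) : R := al / j.+1%:R * binA j.
Definition binf (n : nat) (x : R) : R := 1 - \sum_(j < n) binb j * x ^+ j.+1.

Lemma binA_ge0 n : 0 <= binA n <= 1.
Proof.
have /andP[a0 a1] := al01.
elim: n => [|n /andP[h0 h1]] /=; first by rewrite ler01 lexx.
have n0 : (0 : R) < n.+1%:R by rewrite ltr0n.
have q1 : al / n.+1%:R <= 1.
  by rewrite ler_pdivrMr// mul1r (le_trans (ltW a1))// ler1n.
have q0 : 0 <= al / n.+1%:R by rewrite divr_ge0// ltW.
by move: (al / n.+1%:R) (binA n) q0 q1 h0 h1 => t A *; apply/andP; split; nra.
Qed.

Lemma binb_ge0 j : 0 <= binb j.
Proof.
have /andP[a0 a1] := al01; have /andP[h0 h1] := binA_ge0 j.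
by rewrite /binb mulr_ge0// divr_ge0// ltW.
Qed.

Lemma binA_S n : binA n.+1 = binA n - binb n.
Proof. by rewrite /= /binb mulrBr mulr1 mulrC. Qed.

Lemma sum_binb n : \sum_(j < n) binb j = 1 - binA n.
Proof.
elim: n => [|n IH]; first by rewrite big_ord0 /= subrr.
by rewrite big_ord_recr /= IH -/(binA n.+1) binA_S; ring.
Qed.

(** This compares the truncations of (1 - x) (1 - x)^(al - 1) and (1 - x)^al. *)
Lemma binf_identity n x : (1 - x) * (\sum_(j < n) binA j * x ^+ j) = binf n x - binA n * x ^+ n.
Proof.
rewrite /binf; elim: n => [|n IH]; first by rewrite !big_ord0 /= expr0; ring.
by rewrite !big_ord_recr /= mulrDr IH -/(binA n.+1) binA_S exprS; ring.
Qed.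

Lemma is_derive_binf n x : is_derive x (1 : R) (binf n) (- al * \sum_(j < n) binA j * x ^+ j).
Proof.
elim: n => [|n IH].
  have -> : binf 0 = cst 1 by apply/funext => y; rewrite /binf big_ord0 subr0.
  by rewrite big_ord0 mulr0; exact: is_derive_cst.
have -> : binf n.+1 = binf n - (binb n *: (id ^+ n.+1)).
  apply/funext => y; rewrite /binf big_ord_recr /= opprD addrA !fctE.
  by rewrite /GRing.scale.
have H := is_deriveB IH (is_deriveZ (binb n) (is_deriveX n.+1 (is_derive_id x (1 : R)))).
apply: is_derive_eq H _; rewrite big_ord_recr /= /GRing.scale /= mulr1 /binb.
have n0 : n.+1%:R != 0 :> R by rewrite pnatr_eq0.
by field.
Qed.

(** By binf_identity all terms but one cancel in the derivative of
binf n x (1 - x)^(- al): it is of order x^n, and so is the difference between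
this product and its value 1 at 0. *)
Lemma binf_cvg (x : R) : 0 <= x < 1 -> (fun n => binf n x) @ \oo --> (1 - x) `^ al.
Proof.
move=> /andP[x0 x1]; have /andP[a0 a1] := al01.
pose q (y : R) := (1 - y) `^ (- al).
have dq (y : R) : y < 1 -> is_derive y (1 : R) q (al * (1 - y) `^ (- al - 1)).
  move=> y1; have y1' : 0 < 1 - y by rewrite subr_gt0.
  have d1 : is_derive y (1 : R) (fun y : R => 1 - y) (- 1).
    have H := is_deriveB (is_derive_cst (1 : R) y (1 : R)) (is_derive_id y (1 : R)).
    by rewrite sub0r in H; exact: H.
  have d2 := is_derive1_powR (- al) y1'.
  have H := @is_derive1_comp R (fun z => z `^ (- al)) (fun y : R => 1 - y) y _ _ d2 d1.
  by apply: is_derive_eq H _; ring.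
pose B := al * x * (1 - x) `^ (- al - 1).
have pos (y : R) : y < 1 -> 0 < (1 - y) `^ (- al - 1) by move=> y1; rewrite powR_gt0// subr_gt0.
have B0 : 0 <= B by rewrite /B !mulr_ge0// ?ltW// pos.
have key n : `|binf n x * q x - 1| <= B * x ^+ n.
  have cf : {within `[0, x], continuous (binf n * q)}.
    apply: derivable_within_continuous => y; rewrite in_itv /= => /andP[_ yx].
    apply: derivableM; first by have [] := is_derive_binf n y.
    by have [] := dq y (le_lt_trans yx x1).
  have df y : y \in `]0, x[%R -> is_derive y (1 : R) (binf n * q)
      (al * binA n * y ^+ n * (1 - y) `^ (- al - 1)).
    rewrite in_itv /= => /andP[y0 yx]; have y1 := lt_trans yx x1.
    have H := is_deriveM (is_derive_binf n y) (dq y y1).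
    apply: is_derive_eq H _; rewrite /GRing.scale /=.
    have -> : q y = (1 - y) * (1 - y) `^ (- al - 1).
      rewrite /q -[X in _ = X * _]powRr1 ?subr_ge0 ?(ltW y1)// -powRD.
        by congr (_ `^ _); ring.
      by apply/implyP => _; rewrite gt_eqF// subr_gt0.
    by have := binf_identity n y => /(congr1 (fun z => z * (al * (1 - y) `^ (- al - 1)))); lra.
  have [c] := MVT_segment x0 df cf.
  rewrite in_itv /= => /andP[c0 cx].
  have -> : (binf n * q) x - (binf n * q) 0 = binf n x * q x - 1.
    rewrite !fctE /q subr0 powR1 mulr1 /binf; congr (_ - _).
    by rewrite big1 ?subr0// => j _; rewrite expr0n mulr0.
  move=> ->; have c1 := le_lt_trans cx x1.
  have /andP[A0 A1] := binA_ge0 n.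
  rewrite subr0 ger0_norm; last first.
    by rewrite !mulr_ge0 ?exprn_ge0 ?(ltW a0)// ltW// pos.
  have h1 : c ^+ n <= x ^+ n by rewrite lerXn2r.
  have h2 : (1 - c) `^ (- al - 1) <= (1 - x) `^ (- al - 1).
    have E : - al - 1 = - (al + 1) by ring.
    rewrite E !powRN lef_pV2 ?posrE ?powR_gt0 ?subr_gt0//.
    apply: ge0_ler_powR; rewrite ?nnegrE ?subr_ge0 ?(ltW x1) ?(ltW c1)//.
      by rewrite addr_ge0// ltW.
    by rewrite lerD2l lerN2.
  have cn : 0 <= c ^+ n by rewrite exprn_ge0.
  have -> : al * binA n * c ^+ n * (1 - c) `^ (- al - 1) * x =
    (al * x) * (binA n * (c ^+ n * (1 - c) `^ (- al - 1))) by ring.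
  have -> : B * x ^+ n = (al * x) * (x ^+ n * (1 - x) `^ (- al - 1)) by rewrite /B; ring.
  apply: ler_wpM2l; first by rewrite mulr_ge0// ltW.
  apply: (@le_trans _ _ (1 * (c ^+ n * (1 - c) `^ (- al - 1)))).
    by apply: ler_wpM2r => //; rewrite mulr_ge0// ltW// pos.
  by rewrite mul1r ler_pM// ltW// pos.
have x1n : `|x| < 1 by rewrite ger0_norm.
have P0 : 0 < (1 - x) `^ al by rewrite powR_gt0// subr_gt0.
have qE : q x = ((1 - x) `^ al)^-1 by rewrite /q powRN.
apply: (@cvgn_squeeze0 _ _ (fun n => (1 - x) `^ al * B * x ^+ n)).
  rewrite -(mulr0 ((1 - x) `^ al * B)); apply: cvgMr; exact: cvg_expr.
move=> n; have := key n; rewrite qE => H.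
have -> : binf n x - (1 - x) `^ al = (1 - x) `^ al * (binf n x / (1 - x) `^ al - 1).
  by field; rewrite gt_eqF.
by rewrite normrM (ger0_norm (ltW P0)) -mulrA ler_wpM2l// (ltW P0).
Qed.

Lemma powR_cvg (u : nat -> R) (l : R) : 0 <= l -> (forall n, 0 <= u n) ->
  u @ \oo --> l -> (fun n => u n `^ al) @ \oo --> l `^ al.
Proof.
have /andP[a0 a1] := al01.
rewrite le_eqVlt => /predU1P[<-|l0] u0 ul.
  rewrite powR0 ?gt_eqF//; apply/cvgn_epsP => e e0.
  have e1 : 0 < e `^ al^-1 by rewrite powR_gt0.
  have /cvgn_epsP/(_ _ e1)[N HN] := ul.
  exists N => n Nn; have := HN n Nn; rewrite !subr0 ger0_norm// => h.
  rewrite ger0_norm ?powR_ge0//.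
  apply: le_trans (ge0_ler_powR (ltW a0) _ _ h) _; rewrite ?nnegrE ?(ltW e1)//.
  by rewrite -powRrM mulVf ?gt_eqF// powRr1// ltW.
have cc : {for l, continuous (fun x : R => x `^ al)}.
  apply: differentiable_continuous; apply/derivable1_diffP.
  by have [] := is_derive1_powR al l0.
exact: (@cvg_comp _ _ _ u (fun x : R => x `^ al) \oo (nbhs l) (nbhs (l `^ al)) ul cc).
Qed.

End Binomial.

(** * The resolvent of the Dirichlet Laplacian *)

Section FsumDerive.
Context {R : realType}.

Lemma is_derive_fsum (psi dpsi : nat -> R * R -> R) (c : nat -> R) n (x v : R * R) :
  (forall k, is_derive x v (psi k) (dpsi k x)) ->
  is_derive x v (fsum psi c n) (fsum dpsi c n x).
Proof.
move=> H; elim: n => [|n IH].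
  have -> : fsum psi c 0 = cst 0 by apply/funext => y; rewrite /fsum big_ord0.
  by rewrite /fsum big_ord0; exact: is_derive_cst.
have -> : fsum psi c n.+1 = fsum psi c n + (c n *: psi n).
  by apply/funext => y; rewrite /fsum big_ord_recr.
have -> : fsum dpsi c n.+1 x = fsum dpsi c n x + c n *: dpsi n x.
  by rewrite /fsum big_ord_recr.
by apply: is_deriveD; exact: is_deriveZ.
Qed.

End FsumDerive.

Section Dirichlet.
Context {R : realType} (Om : set (R * R)).
Hypothesis oOm : open Om.
Hypothesis bOm : bounded_set Om.
Variables (lambda : nat -> R) (phi : nat -> R * R -> R).
Hypothesis eig : dirichlet_eigenbasis Om lambda phi.

Let mOm : measurable Om. Proof. exact: open_measurable2. Qed.

Lemma finite_domain : (leb2 Om < +oo)%E.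
Proof. by have [L [L0 HL]] := bounded_box bOm; exact: box_finite HL. Qed.

Lemma test_is_H10 f : test_function Om f -> H10 Om f ('D_e1 f) ('D_e2 f).
Proof. by have [L [L0 HL]] := bounded_box bOm; exact: (test_H10 oOm L0 HL). Qed.

Let onb : orthonormal_basis Om phi. Proof. by case: eig. Qed.
Let Lphi k : L2 Om (phi k). Proof. by case: onb. Qed.
Let LT f : test_function Om f -> L2 Om f.
Proof. by move=> tf; apply: test_L2 => //; exact: finite_domain. Qed.

Lemma L2_cst (r : R) : L2 Om (fun=> r).
Proof. by apply: (L2_bounded mOm finite_domain (C := `|r|)) => // x _. Qed.

(** The last equation is the weak equation of an eigenfunction tested with itself. *)
Lemma eigenfunctions_test_approx : exists (g1 g2 : nat -> R * R -> R) (psi : nat -> nat -> R * R -> R),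
  forall k, [/\ L2 Om (g1 k), L2 Om (g2 k), forall j, test_function Om (psi k j) &
    [/\ L2cvg Om (psi k) (phi k),
     L2cvg Om (fun j => 'D_e1 (psi k j)) (g1 k), L2cvg Om (fun j => 'D_e2 (psi k j)) (g2 k) &
     (forall v h1 h2, H10 Om v h1 h2 ->
      L2dot Om (g1 k) h1 + L2dot Om (g2 k) h2 = lambda k * L2dot Om (phi k) v) /\
     L2dot Om (g1 k) (g1 k) + L2dot Om (g2 k) (g2 k) = lambda k]].
Proof.
have [_ o _] := onb.
have /choice[G HG] : forall k, exists G : ((R * R -> R) * (R * R -> R)) * (nat -> R * R -> R),
   [/\ L2 Om G.1.1, L2 Om G.1.2, forall j, test_function Om (G.2 j) &
    [/\ L2cvg Om G.2 (phi k),
     L2cvg Om (fun j => 'D_e1 (G.2 j)) G.1.1, L2cvg Om (fun j => 'D_e2 (G.2 j)) G.1.2 &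
     (forall v h1 h2, H10 Om v h1 h2 ->
      L2dot Om G.1.1 h1 + L2dot Om G.1.2 h2 = lambda k * L2dot Om (phi k) v) /\
     L2dot Om G.1.1 G.1.1 + L2dot Om G.1.2 G.1.2 = lambda k]].
  move=> k; have [_ /(_ k)[_ [g1 [g2 [H W]]]]] := eig.
  have E := W _ _ _ H; rewrite o eqxx mulr1 in E.
  have [[_ L1 L2' _] [psi [tp c1 c2 c3]]] := H.
  by exists ((g1, g2), psi); split.
by exists (fun k => (G k).1.1), (fun k => (G k).1.2), (fun k => (G k).2).
Qed.

(** An eigenvalue is the squared norm of the gradient of its eigenfunction. *)
Lemma eigenvalue_ge0 k : 0 <= lambda k.
Proof.
have [g1 [g2 [psi H]]] := eigenfunctions_test_approx.
have [_ _ _ [_ _ _ [_ <-]]] := H k.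
by rewrite addr_ge0// L2dot_ge0.
Qed.

Lemma L2_comp_lipschitz (K : R -> R) (C : R) f : (forall a b, `|K a - K b| <= C * `|a - b|) ->
  K 0 = 0 -> continuous K -> L2 Om f -> L2 Om (K \o f).
Proof.
move=> KL K0 cK Lf; apply: (L2_dominated mOm (g := fun x => C * f x)); last 2 first.
- exact: L2Z.
- move=> x _ /=; have := KL (f x) 0; rewrite K0 !subr0 => h.
  by apply: le_trans h _; rewrite normrM ler_wpM2r// ler_norm.
- apply: measurableT_comp; last exact: L2_measurable Lf.
  exact: continuous_measurable_fun.
Qed.

Lemma L2norm_comp_lipschitz (K : R -> R) (C : R) f g : 0 <= C -> (forall a b, `|K a - K b| <= C * `|a - b|) ->
  K 0 = 0 -> continuous K -> L2 Om f -> L2 Om g ->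
  L2norm Om (fun x => K (f x) - K (g x)) <= C * L2norm Om (fun x => f x - g x).
Proof.
move=> C0 KL K0 cK Lf Lg.
have -> : C * L2norm Om (fun x => f x - g x) = L2norm Om (fun x => C * (f x - g x)).
  by rewrite (L2normZ mOm) ?ger0_norm//; exact: L2B.
apply: L2norm_le => //.
- by apply: L2B => //; exact: (L2_comp_lipschitz KL K0 cK).
- by apply: L2Z => //; exact: L2B.
- by move=> x _; rewrite normrM (ger0_norm C0); exact: KL.
Qed.

Lemma L2cvg_fsum (psi : nat -> nat -> R * R -> R) (p : nat -> R * R -> R) c n :
  (forall k j, L2 Om (psi k j)) -> (forall k, L2 Om (p k)) ->
  (forall k, L2cvg Om (psi k) (p k)) ->
  L2cvg Om (fun j => fsum (psi^~ j) c n) (fsum p c n).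
Proof.
move=> Lpsi Lp H; elim: n => [|n IH].
  apply/cvgn_epsP => e e0; exists 0%N => j _; rewrite subr0.
  have -> : L2norm Om (fsum (psi^~ j) c 0 \- fsum p c 0) = L2norm Om (fun=> 0).
    by apply: eq_L2norm => x _; rewrite /= /fsum !big_ord0 subrr.
  by rewrite /L2norm L2dot0l// sqrtr0 normr0 ltW.
have LS (q : nat -> R * R -> R) m : (forall k, L2 Om (q k)) -> L2 Om (fsum q c m).
  by move=> Lq; apply: L2_sum => // k _; exact: L2Z.
apply: (@cvgn_squeeze0 _ _ (fun j => L2norm Om (fsum (psi^~ j) c n \- fsum p c n) +
   `|c n| * L2norm Om (psi n j \- p n))).
  rewrite -[X in _ --> X](_ : 0 + `|c n| * 0 = 0); last by rewrite mulr0 addr0.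
  by apply: cvgD; [exact: IH|apply: cvgMr; exact: H].
move=> j; rewrite subr0 ger0_norm ?L2norm_ge0//.
rewrite -(L2normZ mOm (c n)); last exact: L2B.
apply: le_trans (L2normD mOm _ _); last 2 first.
  by apply: L2B => //; apply: LS.
  by apply: L2Z => //; exact: L2B.
rewrite le_eqVlt; apply/orP; left; apply/eqP/eq_L2norm => x _ /=.
by rewrite /fsum !big_ord_recr /=; ring.
Qed.

Section Resolvent.
Variables (s : R) (c : nat -> R) (n : nat).
Hypothesis s0 : 0 < s.
Let w k := s / (s + lambda k) * c k.
Let F := fsum phi c n.
Let W := fsum phi w n.
Let LF : L2 Om F. Proof. exact: L2_fsum. Qed.
Let LW : L2 Om W. Proof. exact: L2_fsum. Qed.

(** W solves s (F - W) = - Delta W. Tested with K o W, the right-hand side is the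
integral of K'(W) |grad W|^2, which is nonnegative. Since K o W is not known to
be admissible, the weak equation is tested with K o Psi j, where the test
functions Psi j approximate W. *)
Lemma resolvent_profile (K K' : R -> R) (C : R) : 0 <= C ->
  (forall a b, `|K a - K b| <= C * `|a - b|) -> K 0 = 0 ->
  (forall r, is_derive r (1 : R) K (K' r)) -> (forall r, 0 <= K' r <= C) ->
  (forall n f, Cn n f -> Cn n (K \o f)) ->
  0 <= L2dot Om (fun x => F x - W x) (K \o W).
Proof.
move=> C0 KL K0 dK K'b CK.
have cK : continuous K.
  by move=> r; apply: differentiable_continuous; apply/derivable1_diffP; have [] := dK r.
have [g1 [g2 [psi H]]] := eigenfunctions_test_approx.
have Lg1 k : L2 Om (g1 k) by case: (H k).
have Lg2 k : L2 Om (g2 k) by case: (H k).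
have tpsi k j : test_function Om (psi k j) by case: (H k).
have LS (q : nat -> R * R -> R) : (forall k, L2 Om (q k)) -> L2 Om (fsum q w n).
  by move=> Lq; apply: L2_sum => // k _; exact: L2Z.
pose Psi j := fsum (psi^~ j) w n.
have tPsi j : test_function Om (Psi j).
  by apply: test_sum => k; exact: testZ.
have LPsi j : L2 Om (Psi j) by exact: LT.
have D1 j : 'D_e1 (Psi j) = fsum (fun k => 'D_e1 (psi k j)) w n.
  apply/funext => x.
  have Dk k := test_is_derive1 x (tpsi k j).
  by have [_ HD] := @is_derive_fsum _ (psi^~ j) (fun k => 'D_e1 (psi k j)) w n x e1 Dk.
have D2 j : 'D_e2 (Psi j) = fsum (fun k => 'D_e2 (psi k j)) w n.
  apply/funext => x.
  have Dk k := test_is_derive2 x (tpsi k j).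
  by have [_ HD] := @is_derive_fsum _ (psi^~ j) (fun k => 'D_e2 (psi k j)) w n x e2 Dk.
pose G1 := fsum g1 w n; pose G2 := fsum g2 w n.
have LG1 : L2 Om G1 by exact: LS.
have LG2 : L2 Om G2 by exact: LS.
have LD1 j : L2 Om ('D_e1 (Psi j)) by apply: LT; exact: test_derive1.
have LD2 j : L2 Om ('D_e2 (Psi j)) by apply: LT; exact: test_derive2.
have cPsi : L2cvg Om Psi W.
  by apply: L2cvg_fsum => // [k j|k]; [exact: LT|case: (H k) => _ _ _ []].
have cD1 : L2cvg Om (fun j => 'D_e1 (Psi j)) G1.
  rewrite (_ : (fun j => _) = (fun j => fsum (fun k => 'D_e1 (psi k j)) w n)); last by apply/funext.
  apply: (@L2cvg_fsum (fun k j => 'D_e1 (psi k j))) => // [k j|k].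
    by apply: LT; exact: test_derive1.
  by case: (H k) => _ _ _ [].
have cD2 : L2cvg Om (fun j => 'D_e2 (Psi j)) G2.
  rewrite (_ : (fun j => _) = (fun j => fsum (fun k => 'D_e2 (psi k j)) w n)); last by apply/funext.
  apply: (@L2cvg_fsum (fun k j => 'D_e2 (psi k j))) => // [k j|k].
    by apply: LT; exact: test_derive2.
  by case: (H k) => _ _ _ [].
have tK j : test_function Om (K \o Psi j) by exact: test_comp.
have LK j : L2 Om (K \o Psi j) by exact: LT.
have LKW : L2 Om (K \o W) := L2_comp_lipschitz KL K0 cK LW.
have LFW : L2 Om (fun x => F x - W x) by exact: L2B.
have DK1 j x : 'D_e1 (K \o Psi j) x = K' (Psi j x) * 'D_e1 (Psi j) x.
  by have [_ ->] := is_derive_comp2 (test_is_derive1 x (tPsi j)) (dK _).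
have DK2 j x : 'D_e2 (K \o Psi j) x = K' (Psi j x) * 'D_e2 (Psi j) x.
  by have [_ ->] := is_derive_comp2 (test_is_derive2 x (tPsi j)) (dK _).
have LDK1 j : L2 Om ('D_e1 (K \o Psi j)) by apply: LT; exact: test_derive1.
have LDK2 j : L2 Om ('D_e2 (K \o Psi j)) by apply: LT; exact: test_derive2.
have weak j : s * L2dot Om (fun x => F x - W x) (K \o Psi j) =
   L2dot Om G1 ('D_e1 (K \o Psi j)) + L2dot Om G2 ('D_e2 (K \o Psi j)).
  have hK := test_is_H10 (tK j).
  rewrite /G1 /G2 /fsum !L2dot_suml//; try by move=> k _; exact: L2Z.
  rewrite -big_split /= L2dotBl// !(L2dot_fsum mOm onb)// -sumrB mulr_sumr.
  apply: eq_bigr => k _; rewrite !L2dotZl// -mulrDr.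
  have [_ _ _ [_ _ _ [Wk _]]] := H k; rewrite (Wk _ _ _ hK) /w.
  have sl : s + lambda k != 0 by rewrite gt_eqF// ltr_wpDr// eigenvalue_ge0.
  by field.
(* What is lost by replacing grad W with grad (Psi j). *)
pose err j := C * (L2norm Om (fun x => 'D_e1 (Psi j) x - G1 x) * L2norm Om ('D_e1 (Psi j))) +
   C * (L2norm Om (fun x => 'D_e2 (Psi j) x - G2 x) * L2norm Om ('D_e2 (Psi j))).
have err0 : err @ \oo --> (0 : R).
  rewrite -[X in _ --> X](_ : C * (0 * L2norm Om G1) + C * (0 * L2norm Om G2) = 0); last by ring.
  by apply: cvgD; apply: cvgMr; apply: cvgM => //; apply: L2cvg_norm.
have half (g d dk : R * R -> R) (Ps : R * R -> R) : L2 Om g -> L2 Om d -> L2 Om dk ->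
   (forall x, dk x = K' (Ps x) * d x) ->
   - (C * (L2norm Om (fun x => d x - g x) * L2norm Om d)) <= L2dot Om g dk.
  move=> Lg Ld Ldk dkE.
  have -> : L2dot Om g dk = L2dot Om d dk - L2dot Om (fun x => d x - g x) dk.
    by rewrite L2dotBl//; ring.
  have h1 : 0 <= L2dot Om d dk.
    apply: Rintegral_ge0 => x _; rewrite dkE mulrCA mulr_ge0//; first by case/andP: (K'b (Ps x)).
    by rewrite -expr2 sqr_ge0.
  have h2 := L2_CS mOm (L2B mOm Ld Lg) Ldk.
  have h3 : L2norm Om dk <= C * L2norm Om d.
    rewrite -[X in X * _](ger0_norm C0) -(L2normZ mOm)//.
    apply: L2norm_le => //; first exact: L2Z.
    move=> x _; rewrite dkE !normrM ler_wpM2r//.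
    by have /andP[k0 k1] := K'b (Ps x); rewrite !ger0_norm.
  have h4 := ler_wpM2l (L2norm_ge0 Om (fun x => d x - g x)) h3.
  have h5 := ler_norm (L2dot Om (fun x => d x - g x) dk).
  rewrite mulrCA; lra.
have lower j : - err j <= s * L2dot Om (fun x => F x - W x) (K \o Psi j).
  rewrite weak /err opprD lerD//.
    exact: (half _ _ _ (Psi j) LG1 (LD1 j) (LDK1 j) (DK1 j)).
  exact: (half _ _ _ (Psi j) LG2 (LD2 j) (LDK2 j) (DK2 j)).
have cK2 : L2cvg Om (fun j => K \o Psi j) (K \o W).
  apply: (@cvgn_squeeze0 _ _ (fun j => C * L2norm Om (fun x => Psi j x - W x))).
    by rewrite -(mulr0 C); apply: cvgMr.
  move=> j; rewrite subr0 ger0_norm ?L2norm_ge0//.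
  exact: L2norm_comp_lipschitz.
have lim1 : (fun j => s * L2dot Om (K \o Psi j) (fun x => F x - W x) + err j) @ \oo -->
   s * L2dot Om (K \o W) (fun x => F x - W x) + 0.
  by apply: cvgD => //; apply: cvgMr; apply: L2cvg_dot.
rewrite addr0 in lim1.
have : 0 <= s * L2dot Om (K \o W) (fun x => F x - W x).
  apply: (cvgn_ge lim1 (N := 0)) => j _; have := lower j.
  by rewrite (L2dotC _ (K \o Psi j)); lra.
by rewrite pmulr_rge0// L2dotC.
Qed.

(** gap M is a uniform limit of the smooth profiles sgap d M. *)
Lemma resolvent_gap M : 0 <= M -> 0 <= L2dot Om (fun x => F x - W x) (gap M \o W).
Proof.
move=> M0.
have gL a b : `|gap M a - gap M b| <= 1 * `|a - b| by rewrite mul1r gap_lipschitz.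
have LgW : L2 Om (gap M \o W) := L2_comp_lipschitz gL (gap0 M0) (gap_continuous M0) LW.
have LFW : L2 Om (fun x => F x - W x) by exact: L2B.
have sgc d : 0 < d -> continuous (sgap d M).
  move=> d0 r; apply: differentiable_continuous; apply/derivable1_diffP.
  by have [] := is_derive_sgap M r d0.
have LsW d : 0 < d -> L2 Om (sgap d M \o W).
  by move=> d0; apply: (@L2_comp_lipschitz _ 2) => //; [move=> a b; exact: sgap_lipschitz|exact: sgap0|exact: sgc].
have pos d : 0 < d -> 0 <= L2dot Om (fun x => F x - W x) (sgap d M \o W).
  move=> d0; apply: (@resolvent_profile _ (dsgap d M) 2) => //.
  - by move=> a b; exact: sgap_lipschitz.
  - exact: sgap0.
  - by move=> r; exact: is_derive_sgap.
  - by move=> r; exact: dsgap_bound.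
  - by move=> m f; exact: Cn_sgap.
pose E := L2norm Om (fun x => F x - W x) * L2norm Om (fun=> 1).
have E0 : 0 <= E by rewrite mulr_ge0 ?L2norm_ge0.
have close d : 0 < d -> L2dot Om (fun x => F x - W x) (sgap d M \o W) <=
   L2dot Om (fun x => F x - W x) (gap M \o W) + d * E.
  move=> d0; rewrite -lerBlDl -L2dotBr//; last exact: LsW.
  apply: le_trans (ler_norm _) _; apply: le_trans (L2_CS mOm _ _) _ => //.
    by apply: L2B => //; exact: LsW.
  rewrite /E mulrCA ler_wpM2l ?L2norm_ge0//.
  rewrite -[X in X * _](ger0_norm (ltW d0)) -(L2normZ mOm); last exact: L2_cst.
  apply: L2norm_le => //.
  - by apply: L2B => //; exact: LsW.
  - by apply: L2Z => //; exact: L2_cst.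
  - by move=> x _; rewrite mulr1 (ger0_norm (ltW d0)); exact: sgap_near.
apply/ler_addgt0Pr => e e0.
have e1 : 0 < e / (E + 1) by rewrite divr_gt0// ltr_wpDl.
apply: le_trans (pos _ e1) _; apply: le_trans (close _ e1) _.
rewrite lerD2l -mulrA ler_piMr ?(ltW e0)// mulrC ler_pdivrMr; last by rewrite ltr_wpDl.
by rewrite mul1r lerDl.
Qed.

End Resolvent.
End Dirichlet.

(** * A maximum principle for the fractional Laplacian *)

Section GapContraction.
Context {R : realType} (Om : set (R * R)).
Hypothesis oOm : open Om.
Hypothesis bOm : bounded_set Om.
Variables (lambda : nat -> R) (phi : nat -> R * R -> R).
Hypothesis eig : dirichlet_eigenbasis Om lambda phi.
Variable M : R.
Hypothesis M0 : 0 <= M.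

Let mOm : measurable Om. Proof. exact: open_measurable2. Qed.
Let onb : orthonormal_basis Om phi. Proof. by case: eig. Qed.
Let Lphi k : L2 Om (phi k). Proof. by case: onb. Qed.

Lemma L2_gap f : L2 Om f -> L2 Om (gap M \o f).
Proof.
apply: (L2_comp_lipschitz oOm (C := 1)); [|exact: gap0|exact: gap_continuous].
by move=> a b; rewrite mul1r gap_lipschitz.
Qed.

(** The squared L2 distance from f to the functions with values in [-M, M]. *)
Definition gap_energy f := L2dot Om (gap M \o f) (gap M \o f).

Lemma gap_energy_tangent a b : L2 Om a -> L2 Om b ->
  2 * L2dot Om (fun x => a x - b x) (gap M \o b) <= gap_energy a - gap_energy b.
Proof.
move=> La Lb; have Lga := L2_gap La; have Lgb := L2_gap Lb.
have LB := L2B mOm La Lb.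
rewrite -L2dotZl// /gap_energy /L2dot -RintegralB//; try exact: L2M_integrable.
apply: le_Rintegral => //.
- by apply: L2M_integrable => //; exact: L2Z.
- have -> : (EFin \o (fun x => (gap M \o a) x * (gap M \o a) x - (gap M \o b) x * (gap M \o b) x)) =
    ((EFin \o (fun x => ((gap M \o a) x * (gap M \o a) x)%R)) \-
     (EFin \o (fun x => ((gap M \o b) x * (gap M \o b) x)%R)))%E by [].
  by apply: integrableB => //; exact: L2M_integrable.
- by move=> x _ /=; have := gap_tangent (a x) (b x) M0; rewrite !expr2; lra.
Qed.

Section Multipliers.
Variable n : nat.
Let S (c : nat -> R) := fsum phi c n.
Let LS c : L2 Om (S c). Proof. exact: L2_fsum. Qed.

(** A convex functional is at least as large at f as at w when its gradient at w has
a nonnegative product with f - w; this is resolvent_gap. *)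
Lemma resolvent_contraction (s : R) (c : nat -> R) : 0 < s ->
  gap_energy (S (fun k => s / (s + lambda k) * c k)) <= gap_energy (S c).
Proof.
move=> s0; have h1 := resolvent_gap oOm bOm eig c n s0 M0.
have h2 := gap_energy_tangent (LS c) (LS (fun k => s / (s + lambda k) * c k)).
have h3 : 0 <= 2 * L2dot Om (fun x => S c x - S (fun k => s / (s + lambda k) * c k) x)
   (gap M \o S (fun k => s / (s + lambda k) * c k)) by rewrite mulr_ge0.
by rewrite -subr_ge0; apply: le_trans h3 h2.
Qed.

Lemma resolvent_pow_contraction (s : R) (c : nat -> R) j : 0 < s ->
  gap_energy (S (fun k => (s / (s + lambda k)) ^+ j * c k)) <= gap_energy (S c).
Proof.
move=> s0; elim: j => [|j IH].
  by rewrite (_ : (fun k => _) = c)//; apply/funext => k; rewrite expr0 mul1r.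
apply: le_trans IH.
have := resolvent_contraction (fun k => (s / (s + lambda k)) ^+ j * c k) s0.
by rewrite (_ : (fun k => s / (s + lambda k) * ((s / (s + lambda k)) ^+ j * c k)) =
  (fun k => (s / (s + lambda k)) ^+ j.+1 * c k))//; apply/funext => k; rewrite exprS mulrA.
Qed.

Variable c : nat -> R.
Let ga k := L2dot Om (phi k) (gap M \o S c).

Let gaE (d : nat -> R) : L2dot Om (S d) (gap M \o S c) = \sum_(k < n) d k * ga k.
Proof. by rewrite L2dot_fsum//; exact: L2_gap. Qed.

Let base_ge0 : 0 <= \sum_(k < n) c k * ga k.
Proof.
rewrite -gaE; apply: Rintegral_ge0 => x _ /=.
by rewrite mulrC; exact: gap_mulr_ge0.
Qed.

(** By convexity, a direction along which the gap energy does not increase has a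
nonpositive product with its gradient. *)
Let pow_ge0 (s : R) j : 0 < s ->
  0 <= \sum_(k < n) (1 - (s / (s + lambda k)) ^+ j) * c k * ga k.
Proof.
move=> s0; pose d k := (s / (s + lambda k)) ^+ j * c k.
have h1 := gap_energy_tangent (LS d) (LS c).
have h2 := resolvent_pow_contraction c j s0.
have : \sum_(k < n) (1 - (s / (s + lambda k)) ^+ j) * c k * ga k =
   - L2dot Om (fun x => S d x - S c x) (gap M \o S c).
  rewrite L2dotBl//; last exact: L2_gap.
  rewrite !gaE -sumrB -sumrN; apply: eq_bigr => k _; rewrite /d; ring.
move=> ->; rewrite oppr_ge0; rewrite -/(S d) in h2; lra.
Qed.

(** A convex combination of the cases th = 1 and th = 0. *)
Let pow_theta_ge0 (s th : R) j : 0 < s -> 0 <= th <= 1 ->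
  0 <= \sum_(k < n) (1 - (th * (s / (s + lambda k))) ^+ j) * c k * ga k.
Proof.
move=> s0 /andP[t0 t1].
have -> : \sum_(k < n) (1 - (th * (s / (s + lambda k))) ^+ j) * c k * ga k =
  th ^+ j * (\sum_(k < n) (1 - (s / (s + lambda k)) ^+ j) * c k * ga k) +
  (1 - th ^+ j) * \sum_(k < n) c k * ga k.
  rewrite !mulr_sumr -big_split /=; apply: eq_bigr => k _; rewrite exprMn; ring.
by rewrite addr_ge0// mulr_ge0 ?exprn_ge0 ?subr_ge0 ?exprn_ile1// pow_ge0.
Qed.

Variable al : R.
Hypothesis al01 : 0 < al < 1.

(** The truncated binomial series of (1 - x)^al is a combination of the polynomials
1 and 1 - x^j with nonnegative coefficients. *)
Let binf_sum_ge0 (s th : R) N : 0 < s -> 0 <= th <= 1 ->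
  0 <= \sum_(k < n) binf al N (th * (s / (s + lambda k))) * c k * ga k.
Proof.
move=> s0 t01.
have -> : \sum_(k < n) binf al N (th * (s / (s + lambda k))) * c k * ga k =
  binA al N * (\sum_(k < n) c k * ga k) +
  \sum_(j < N) binb al j * \sum_(k < n) (1 - (th * (s / (s + lambda k))) ^+ j.+1) * c k * ga k.
  have -> : \sum_(j < N) binb al j * \sum_(k < n) (1 - (th * (s / (s + lambda k))) ^+ j.+1) * c k * ga k =
    \sum_(k < n) \sum_(j < N) binb al j * ((1 - (th * (s / (s + lambda k))) ^+ j.+1) * c k * ga k).
    by rewrite exchange_big /=; apply: eq_bigr => j _; rewrite mulr_sumr.
  rewrite mulr_sumr -big_split /=; apply: eq_bigr => k _.
  have -> : \sum_(j < N) binb al j * ((1 - (th * (s / (s + lambda k))) ^+ j.+1) * c k * ga k) =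
    (\sum_(j < N) binb al j - \sum_(j < N) binb al j * (th * (s / (s + lambda k))) ^+ j.+1) * c k * ga k.
    by rewrite -sumrB !mulr_suml; apply: eq_bigr => j _; ring.
  by rewrite sum_binb /binf; ring.
have /andP[A0 A1] := binA_ge0 al01 N.
rewrite addr_ge0 ?mulr_ge0// sumr_ge0// => j _; rewrite mulr_ge0 ?binb_ge0//.
exact: pow_theta_ge0.
Qed.

Lemma cvg_sum_lt (u : nat -> nat -> R) (l : nat -> R) :
  (forall k, (k < n)%N -> (fun j => u j k) @ \oo --> l k) ->
  (fun j => \sum_(k < n) u j k) @ \oo --> \sum_(k < n) l k.
Proof.
move=> H; elim: n H => [|m IH] H.
  under [X in X @ _ --> _]eq_fun do rewrite big_ord0.
  by rewrite big_ord0; exact: cvg_cst.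
under [X in X @ _ --> _]eq_fun do rewrite big_ord_recr /=.
rewrite big_ord_recr /=; apply: cvgD; last exact: H.
by apply: IH => k km; apply: H; exact: ltnW.
Qed.

(** The factor th < 1 keeps the argument in the disk where the binomial series
converges, also for a vanishing eigenvalue. *)
Let power_sum_ge0 (s th : R) : 0 < s -> 0 <= th < 1 ->
  0 <= \sum_(k < n) (1 - th * (s / (s + lambda k))) `^ al * c k * ga k.
Proof.
move=> s0 /andP[t0 t1].
have H : (fun N => \sum_(k < n) binf al N (th * (s / (s + lambda k))) * c k * ga k) @ \oo -->
  \sum_(k < n) (1 - th * (s / (s + lambda k))) `^ al * c k * ga k.
  apply: (@cvg_sum_lt (fun N k => binf al N (th * (s / (s + lambda k))) * c k * ga k)
    (fun k => (1 - th * (s / (s + lambda k))) `^ al * c k * ga k)) => k _.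
  apply: cvgMl; apply: cvgMl; apply: binf_cvg => //.
  have l0 := eigenvalue_ge0 eig k.
  have r0 : 0 <= s / (s + lambda k) by rewrite divr_ge0 ?addr_ge0 ?(ltW s0).
  have r1 : s / (s + lambda k) <= 1.
    by rewrite ler_pdivrMr ?mul1r ?lerDl// ltr_wpDr.
  rewrite mulr_ge0//=; apply: le_lt_trans t1.
  by rewrite -[leRHS]mulr1 ler_wpM2l.
apply: (cvgn_ge H (N := 0)) => N _; apply: binf_sum_ge0 => //.
by rewrite t0 (ltW t1).
Qed.

Lemma shifted_resolvent_error (s l : R) : 0 < s -> 0 <= l ->
  s * (1 - (1 - s ^- 2) * (s / (s + l))) - l = (1 - l ^+ 2) / (s + l).
Proof.
move=> s0 l0; have sl : s + l != 0 by rewrite gt_eqF// ltr_wpDr.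
have sn : s != 0 by rewrite gt_eqF.
by field; rewrite ?sl ?sn.
Qed.

(** Let A be the Dirichlet Laplacian and f a finite sum of eigenfunctions; the
statement reads <A^al f, gap o f> >= 0. Since s (1 - s / (s + A)) tends to A when
s goes to infinity, A^al is a limit of multiples of the operators of
power_sum_ge0, provided that the factor th tends to 1 faster than s^-1. *)
Lemma fractional_gap_ge0 :
  0 <= \sum_(k < n) lambda k `^ al * c k * L2dot Om (phi k) (gap M \o fsum phi c n).
Proof.
have /andP[a0 a1] := al01.
pose s (m : nat) : R := m.+2%:R.
pose th m := 1 - s m ^- 2.
pose y m k := s m * (1 - th m * (s m / (s m + lambda k))).
have s0 m : 0 < s m by rewrite ltr0n.
have s1 m : 1 < s m by rewrite ltr1n.
have yE m k : y m k - lambda k = (1 - lambda k ^+ 2) / (s m + lambda k).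
  exact: shifted_resolvent_error (s0 m) (eigenvalue_ge0 eig k).
have th01 m : 0 <= th m < 1.
  have h : s m ^- 2 <= 1 by rewrite invf_le1 ?exprn_gt0// exprn_ege1// ltW.
  have h' : 0 < s m ^- 2 by rewrite invr_gt0 exprn_gt0.
  by rewrite /th subr_ge0 h ltrBlDr ltrDl h'.
have q0 m k : 0 <= 1 - th m * (s m / (s m + lambda k)).
  have l0 := eigenvalue_ge0 eig k; have /andP[t0 t1] := th01 m.
  have r0 : 0 <= s m / (s m + lambda k) by rewrite divr_ge0 ?addr_ge0// ltW.
  have r1 : s m / (s m + lambda k) <= 1.
    by rewrite ler_pdivrMr ?mul1r ?lerDl// ltr_wpDr.
  by rewrite subr_ge0 mulr_ile1// (ltW t1).
have y0 m k : 0 <= y m k by rewrite mulr_ge0// ltW.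
have yc k : (fun m => y m k) @ \oo --> lambda k.
  apply: (@cvgn_squeeze0 _ _ (fun m => (1 + lambda k ^+ 2) * (s m)^-1)).
    rewrite -(mulr0 (1 + lambda k ^+ 2)); apply: cvgMr.
    apply: (cvgn_squeeze0 (@cvg_harmonic R)) => m.
    rewrite subr0 ger0_norm ?invr_ge0 ?(ltW (s0 m))// /harmonic /=.
    by rewrite lef_pV2 ?posrE ?ltr0n// ler_nat.
  move=> m; rewrite yE; have l0 := eigenvalue_ge0 eig k.
  have sl : 0 < s m + lambda k by rewrite ltr_wpDr.
  rewrite normrM; apply: ler_pM => //.
    apply: le_trans (ler_normB _ _) _; rewrite normr1 lerD2l normrX.
    by rewrite ger0_norm.
  by rewrite ger0_norm ?invr_ge0 ?(ltW sl)// lef_pV2 ?posrE// lerDl.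
have H : (fun m => \sum_(k < n) y m k `^ al * c k * ga k) @ \oo -->
   \sum_(k < n) lambda k `^ al * c k * ga k.
  apply: (@cvg_sum_lt (fun m k => y m k `^ al * c k * ga k)
    (fun k => lambda k `^ al * c k * ga k)) => k _.
  by apply: cvgMl; apply: cvgMl; exact: (powR_cvg al01 (eigenvalue_ge0 eig k) (fun m => y0 m k) (yc k)).
apply: (cvgn_ge H (N := 0)) => m _.
have -> : \sum_(k < n) y m k `^ al * c k * ga k = s m `^ al *
   \sum_(k < n) (1 - th m * (s m / (s m + lambda k))) `^ al * c k * ga k.
  rewrite mulr_sumr; apply: eq_bigr => k _; rewrite /y powRM ?(ltW (s0 m))//.
  by rewrite !mulrA.
by rewrite mulr_ge0 ?powR_ge0//; exact: power_sum_ge0.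
Qed.

End Multipliers.
End GapContraction.

(** * The eigenvalues tend to infinity *)

Section Rellich.
Context {R : realType} (Om : set (R * R)).
Hypothesis oOm : open Om.
Hypothesis bOm : bounded_set Om.

Let mOm : measurable Om. Proof. exact: open_measurable2. Qed.
Let LT f : test_function Om f -> L2 Om f.
Proof. by move=> tf; apply: test_L2 => //; exact: finite_domain. Qed.

(** The indicator of [a, b[, as a difference so that adjacent intervals telescope. *)
Definition itv_ind (a b x : R) : R := ((x < b)%R)%:R - ((x < a)%R)%:R.

Lemma itv_indE a b x : a <= b -> itv_ind a b x = ((a <= x < b)%R)%:R.
Proof.
move=> ab; rewrite /itv_ind; case: (ltP x b) => xb; case: (ltP x a) => xa /=.
- by rewrite subrr.
- by rewrite subr0.
- by move: (lt_le_trans xa ab); rewrite ltNge xb.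
- by rewrite subr0.
Qed.

Section Grid.
Variables (L : R) (n : nat).
Hypothesis L0 : 0 < L.
Hypothesis n0 : (0 < n)%N.
Hypothesis OmL : forall z, Om z -> (- L < z.1 < L) && (- L < z.2 < L).
Let h : R := 2 * L / n%:R.
Let h0 : 0 < h. Proof. by rewrite /h divr_gt0 ?mulr_gt0// ltr0n. Qed.
Let node (i : nat) : R := - L + i%:R * h.
Let nodeS i : node i.+1 = node i + h.
Proof. by rewrite /node -addrA -natr1 mulrDl mul1r. Qed.

Let node_le i : node i <= node i.+1. Proof. by rewrite nodeS lerDl ltW. Qed.

Definition cell (i j : nat) : set (R * R) := `[node i, node i + h[ `*` `[node j, node j + h[.
Definition cell_ind (i j : nat) (z : R * R) : R :=
  itv_ind (node i) (node i.+1) z.1 * itv_ind (node j) (node j.+1) z.2.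

Let sum_ind1 x : - L < x < L -> \sum_(i < n) itv_ind (node i) (node i.+1) x = 1.
Proof.
move=> /andP[x1 x2]; rewrite /itv_ind -(big_mkord xpredT (fun i => ((x < node i.+1)%R)%:R - ((x < node i)%R)%:R)).
rewrite telescope_sumr// /node mul0r addr0.
have -> : - L + n%:R * h = L.
  by rewrite /h mulrC divfK ?pnatr_eq0 -?lt0n//; ring.
by rewrite x2 ltNge (ltW x1) subr0.
Qed.

Let sum_ind z : Om z -> \sum_(i < n) \sum_(j < n) cell_ind i j z = 1.
Proof.
move=> /OmL/andP[h1 h2]; rewrite /cell_ind.
under eq_bigr do rewrite -mulr_sumr sum_ind1// mulr1.
exact: sum_ind1.
Qed.

Let cell_indE i j z : cell_ind i j z = \1_(cell i j) z.
Proof.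
rewrite /cell_ind !itv_indE// indicE in_setX !mem_setE !in_itv /= !nodeS.
by case: (_ <= _ < _); case: (_ <= _ < _); rewrite ?mulr1 ?mulr0.
Qed.

Let mcell i j : measurable (cell i j).
Proof. by apply: measurableX; exact: measurable_itv. Qed.

Let mind i j : measurable_fun setT (cell_ind i j).
Proof.
have -> : cell_ind i j = \1_(cell i j) by apply/funext => z; exact: cell_indE.
by apply: measurable_indic.
Qed.

Let Lind i j : L2 Om (cell_ind i j).
Proof.
apply: (L2_bounded mOm (finite_domain oOm bOm) (C := 1)); first exact: measurable_funTS.
by move=> z _; rewrite cell_indE indicE; case: (_ \in _); rewrite ?normr1 ?normr0.
Qed.

Let cell_dot i j f g : test_function Om f ->
  L2dot (cell i j) f g = L2dot Om (fun z => cell_ind i j z * f z) g.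
Proof.
move=> tf; rewrite /L2dot Rintegral_mkcond [RHS]Rintegral_mkcond.
congr Rintegral; apply/funext => z; rewrite !patchE cell_indE indicE.
case: (pselect (Om z)) => Oz; last first.
  by rewrite (test_out tf Oz) !mulr0 !mul0r; do 2 case: ifP.
by rewrite (mem_set Oz); case: (_ \in _); rewrite ?mul1r ?mul0r.
Qed.

Let Lindf i j f : test_function Om f -> L2 Om (fun z => cell_ind i j z * f z).
Proof.
move=> tf; apply: (L2_dominated mOm _ (LT tf)).
  by apply: measurable_funM; apply: measurable_funTS => //; exact: test_measurable tf.
move=> z _; rewrite cell_indE indicE; case: (_ \in _); rewrite ?mul1r ?mul0r ?normr0//.
Qed.

Let sum_dot (F : nat -> R * R -> R) (f : R * R -> R) : (forall i, L2 Om (F i)) -> L2 Om f ->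
  \sum_(i < n) L2dot Om (F i) f = L2dot Om (fun z => \sum_(i < n) F i z) f.
Proof. by move=> LF Lf; rewrite L2dot_suml. Qed.

Let sum_cells f : test_function Om f ->
  \sum_(i < n) \sum_(j < n) L2dot (cell i j) f f = L2dot Om f f.
Proof.
move=> tf; under eq_bigr do under eq_bigr do rewrite cell_dot//.
have Lc i j : L2 Om (fun z => cell_ind i j z * f z) by exact: Lindf.
have Lf := LT tf.
have Lci i : L2 Om (fun z => \sum_(j < n) cell_ind i j z * f z) by exact: L2_sum.
under eq_bigr => i _ do rewrite (sum_dot (Lc i) Lf).
rewrite (sum_dot Lci Lf).
apply: eq_L2dot => // z Oz.
under eq_bigr do rewrite -mulr_suml.
by rewrite -mulr_suml sum_ind// mul1r.
Qed.

Lemma poincare_grid psi : test_function Om psi ->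
  L2dot Om psi psi <= h ^- 2 * (\sum_(i < n) \sum_(j < n) L2dot Om psi (cell_ind i j) ^+ 2) +
    2 * h ^+ 2 * (L2dot Om ('D_e1 psi) ('D_e1 psi) + L2dot Om ('D_e2 psi) ('D_e2 psi)).
Proof.
move=> tpsi; rewrite -(sum_cells tpsi) -(sum_cells (test_derive1 tpsi)) -(sum_cells (test_derive2 tpsi)).
rewrite -!big_split /= !mulr_sumr -big_split /=; apply: ler_sum => i _.
rewrite -!big_split /= !mulr_sumr -big_split /=; apply: ler_sum => j _.
have -> : L2dot Om psi (cell_ind i j) = L2dot (cell i j) psi (fun=> 1).
  by rewrite cell_dot//; apply: eq_Rintegral => z _; rewrite mulr1 mulrC.
exact: (poincare_cell tpsi (node i) (node j) h0).
Qed.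

Variables (lambda : nat -> R) (phi : nat -> R * R -> R).
Hypothesis eig : dirichlet_eigenbasis Om lambda phi.
Let onb : orthonormal_basis Om phi. Proof. by case: eig. Qed.
Let Lphi k : L2 Om (phi k). Proof. by case: onb. Qed.

(** The gradient of phi k has squared norm lambda k; the inequality passes to the
limit from test functions. *)
Lemma poincare_grid_eigen k :
  1 <= h ^- 2 * (\sum_(i < n) \sum_(j < n) L2dot Om (phi k) (cell_ind i j) ^+ 2) +
    2 * h ^+ 2 * lambda k.
Proof.
have [_ o _] := onb.
have [g1 [g2 [psi H]]] := eigenfunctions_test_approx eig.
have [Lg1 Lg2 tpsi [c0 c1 c2 [_ gE]]] := H k.
have Lpsi m : L2 Om (psi k m) by exact: LT.
have dd (F : nat -> R * R -> R) f : (forall m, L2 Om (F m)) -> L2 Om f -> L2cvg Om F f ->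
   (fun m => L2dot Om (F m) (F m)) @ \oo --> L2dot Om f f.
  move=> LF Lf Ff; under [X in X @ _ --> _]eq_fun do rewrite -sqr_L2norm.
  by rewrite -sqr_L2norm; apply: cvgM; exact: L2cvg_norm.
have l0 := dd _ _ Lpsi (Lphi k) c0; rewrite o eqxx in l0.
have l1 := dd _ _ (fun m => LT (test_derive1 (tpsi m))) Lg1 c1.
have l2 := dd _ _ (fun m => LT (test_derive2 (tpsi m))) Lg2 c2.
rewrite -gE.
have lr : (fun m => h ^- 2 * (\sum_(i < n) \sum_(j < n) L2dot Om (psi k m) (cell_ind i j) ^+ 2) +
    2 * h ^+ 2 * (L2dot Om ('D_e1 (psi k m)) ('D_e1 (psi k m)) + L2dot Om ('D_e2 (psi k m)) ('D_e2 (psi k m)))) @ \oo -->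
   h ^- 2 * (\sum_(i < n) \sum_(j < n) L2dot Om (phi k) (cell_ind i j) ^+ 2) +
    2 * h ^+ 2 * (L2dot Om (g1 k) (g1 k) + L2dot Om (g2 k) (g2 k)).
  apply: cvgD; last by apply: cvgMr; apply: cvgD.
  apply: cvgMr.
  apply: (@cvg_sum_lt R n (fun m i => \sum_(j < n) L2dot Om (psi k m) (cell_ind i j) ^+ 2)
    (fun i => \sum_(j < n) L2dot Om (phi k) (cell_ind i j) ^+ 2)) => i _.
  apply: (@cvg_sum_lt R n (fun m j => L2dot Om (psi k m) (cell_ind i j) ^+ 2)
    (fun j => L2dot Om (phi k) (cell_ind i j) ^+ 2)) => j _.
  by apply: cvgM; apply: L2cvg_dot.
rewrite -subr_ge0; apply: (cvgn_ge (cvgB lr l0) (N := 0)) => m _ /=.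
by rewrite subr_ge0; exact: poincare_grid.
Qed.

(** When the mesh is small compared with La^(-1/2), at least half of the squared norm
of an eigenfunction with eigenvalue at most La is seen by its means over the
cells. Bessel's inequality, applied to the indicators of the cells, bounds the
sum of these squared means over all eigenfunctions. *)
Lemma few_eigenvalues (La : R) (s : seq nat) : 2 * h ^+ 2 * La <= 2^-1 -> uniq s ->
  (forall k, k \in s -> lambda k <= La) ->
  (size s)%:R <= 2 * h ^- 2 * L2dot Om (fun=> 1) (fun=> 1).
Proof.
move=> hLa us sLa.
pose K := (\max_(k <- s) k).+1.
have sK k : k \in s -> (k < K)%N by move=> ks; rewrite ltnS; exact: leq_bigmax_seq.
have h2 : 0 < h ^+ 2 by rewrite exprn_gt0.
have one k : k \in s -> 2^-1 <= h ^- 2 * (\sum_(i < n) \sum_(j < n) L2dot Om (phi k) (cell_ind i j) ^+ 2).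
  move=> ks; have := poincare_grid_eigen k.
  have : 2 * h ^+ 2 * lambda k <= 2 * h ^+ 2 * La by rewrite ler_wpM2l ?sLa// mulr_ge0// ltW.
  by move: (_ * \sum_(i < n) _) (2 * h ^+ 2 * lambda k) (2 * h ^+ 2 * La) hLa => A B C *; lra.
have : (size s)%:R * 2^-1 <= \sum_(k <- s) h ^- 2 * (\sum_(i < n) \sum_(j < n) L2dot Om (phi k) (cell_ind i j) ^+ 2).
  rewrite -sum1_size natr_sum mulr_suml big_seq [leRHS]big_seq.
  by apply: ler_sum => k ks; rewrite mul1r; exact: one.
rewrite -mulr_sumr exchange_big /=.
under [in X in _ <= _ * X]eq_bigr do rewrite exchange_big /=.
have : \sum_(i < n) \sum_(j < n) \sum_(k <- s) L2dot Om (phi k) (cell_ind i j) ^+ 2 <=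
   L2dot Om (fun=> 1) (fun=> 1).
  have -> : L2dot Om (fun=> 1) (fun=> 1) = \sum_(i < n) \sum_(j < n) L2dot Om (cell_ind i j) (cell_ind i j).
    have L1 := L2_cst oOm bOm (1 : R).
    have E i j : L2dot Om (cell_ind i j) (cell_ind i j) = L2dot Om (cell_ind i j) (fun=> 1).
      apply: eq_Rintegral => z _; rewrite cell_indE indicE mulr1.
      by case: (_ \in _); rewrite ?mulr1 ?mulr0.
    under eq_bigr do under eq_bigr do rewrite E.
    under eq_bigr => i _ do rewrite (sum_dot (Lind i) L1).
    have Li i : L2 Om (fun z => \sum_(j < n) cell_ind i j z) by exact: L2_sum.
    rewrite (sum_dot Li L1).
    by apply: eq_L2dot => // z Oz; rewrite sum_ind.
  apply: ler_sum => i _; apply: ler_sum => j _.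
  apply: le_trans (bessel mOm onb K (Lind i j)).
  rewrite -(big_mkord xpredT (fun k => coef Om phi (cell_ind i j) k ^+ 2)) /index_iota subn0.
  rewrite [leRHS](bigID (fun k => k \in s)) /= -[leLHS]addr0 lerD ?sumr_ge0//; last by move=> k _; exact: sqr_ge0.
  rewrite -[X in _ <= X]big_filter.
  have P : perm_eq s [seq k <- iota 0 K | k \in s].
    apply: uniq_perm => //; first by rewrite filter_uniq// iota_uniq.
    move=> k; rewrite mem_filter mem_iota /= add0n.
    by case: (boolP (k \in s)) => //= ks; rewrite sK.
  rewrite (perm_big _ P) /= le_eqVlt; apply/orP; left; apply/eqP.
  by apply: eq_bigr => k _; rewrite /coef L2dotC.
move=> A B; have h3 : 0 <= h ^- 2 by rewrite invr_ge0 ltW.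
have C := le_trans B (ler_wpM2l h3 A).
by rewrite -mulrA mulrC -ler_pdivrMr// ; exact: C.
Qed.

End Grid.

Variables (lambda : nat -> R) (phi : nat -> R * R -> R).
Hypothesis eig : dirichlet_eigenbasis Om lambda phi.

Lemma eigenvalue_unbounded (La : R) : exists N, forall k, (N <= k)%N -> La < lambda k.
Proof.
apply: contrapT => /forallNP H.
have many m : exists s : seq nat, [/\ uniq s, size s = m & forall k, k \in s -> lambda k <= La].
  elim: m => [|m [s [us ss sL]]]; first by exists [::].
  have /existsNP[k /not_implyP[Nk /negP kL]] := H (\max_(k <- s) k).+1.
  exists (k :: s); split => /=; last 1 first.
  - by move=> j; rewrite inE => /predU1P[->|/sL//]; rewrite leNgt.
  - rewrite us andbT; apply/negP => ks.
    by move: Nk; rewrite leqNgt ltnS leq_bigmax_seq.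
  - by rewrite ss.
have [L [L0 HL]] := bounded_box bOm.
pose La' := Num.max La 0.
have La0 : 0 <= La' by rewrite le_max lexx orbT.
(* With mesh h = 2 L / n this makes 2 h^2 La' at most 1/2. *)
pose n := (Num.truncn (16 * L ^+ 2 * La')).+1.
have nb : 16 * L ^+ 2 * La' <= n%:R by apply/ltW; exact: truncnS_gt.
have n0 : (0 < n)%N by [].
have n1 : (1 : R) <= n%:R by rewrite ler1n.
pose h : R := 2 * L / n%:R.
have hLa : 2 * h ^+ 2 * La' <= 2^-1.
  rewrite /h expr_div_n; have nn : (0 : R) < n%:R ^+ 2 by rewrite exprn_gt0// ltr0n.
  have -> : 2 * ((2 * L) ^+ 2 / n%:R ^+ 2) * La' = (8 * L ^+ 2 * La') / n%:R ^+ 2.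
    by field; rewrite gt_eqF// ltr0n.
  rewrite ler_pdivrMr//.
  have : n%:R <= n%:R ^+ 2 :> R by rewrite expr2 ler_peMl// ler0n.
  by move: nb; move: (L ^+ 2) (n%:R : R) (n%:R ^+ 2 : R) => A B C; lra.
pose X := 2 * h ^- 2 * L2dot Om (fun=> 1) (fun=> 1).
have [s [us ss sL]] := many (Num.truncn X).+1.
have := few_eigenvalues L0 n0 HL eig hLa us (fun k ks => le_trans (sL k ks) _).
have LaLa : La <= La' by rewrite le_max lexx.
move/(_ LaLa); rewrite ss leNgt.
by rewrite truncnS_gt.
Qed.

End Rellich.

(** * Duhamel's formula in spectral coordinates *)

Section Curves.
Context {R : realType} (Om : set (R * R)).
Hypothesis oOm : open Om.
Hypothesis bOm : bounded_set Om.
Implicit Types (f g : R * R -> R) (w : R -> R * R -> R).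

Let mOm : measurable Om. Proof. exact: open_measurable2. Qed.
Let finOm : (leb2 Om < +oo)%E. Proof. exact: finite_domain. Qed.
Let L2c r : L2 Om (fun=> r : R). Proof. exact: L2_cst. Qed.

Lemma compact_closure : compact (closure Om).
Proof.
have [L [L0 HL]] := bounded_box bOm.
have cK : compact (`[- L, L]%classic `*` `[- L, L]%classic : set (R * R)).
  by apply: compact_setX; exact: segment_compact.
apply: (subclosed_compact _ cK); first exact: closed_closure.
have clK := compact_closed (@norm_hausdorff R (R * R)%type) cK.
rewrite [X in _ `<=` X](closure_id _).1//.
apply: closure_subset => z /HL/andP[/andP[z1 z2] /andP[z3 z4]].
by split => /=; rewrite in_itv /= !ltW.
Qed.

Lemma C0_bounded f : C0 Om f -> exists B : R, forall x, closure Om x -> `|f x| <= B.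
Proof.
move=> [cf _].
have := continuous_compact cf compact_closure.
move=> /compact_bounded[M [_ HM]]; exists (`|M| + 1) => x cx.
by apply: HM; [rewrite (le_lt_trans (ler_norm M))// ltrDl|exists x].
Qed.

Lemma C0B f g : C0 Om f -> C0 Om g -> C0 Om (f \- g).
Proof.
move=> [cf f0] [cg g0]; split; last by move=> x bx /=; rewrite f0// g0// subr0.
by move=> x; apply: continuousB; [exact: cf|exact: cg].
Qed.

Lemma le_sup_norm f x : C0 Om f -> closure Om x -> `|f x| <= sup_norm Om f.
Proof.
move=> /C0_bounded[B HB] cx; apply: ub_le_sup; last by exists x.
by exists B => _ [z cz <-]; exact: HB.
Qed.

Lemma C0_continuous f : C0 Om f -> {in Om, continuous f}.
Proof.
move=> [cf _] x; rewrite inE => Ox.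
have := (subspace_continuousP (closure Om) f).1 cf x (subset_closure Ox).
rewrite within_interior//; have := oOm; rewrite openE => /(_ _ Ox).
by apply: interiorS; exact: subset_closure.
Qed.

Lemma C0_measurable f : C0 Om f -> measurable_fun Om f.
Proof. by move=> /C0_continuous; exact: open_continuous_measurable2. Qed.

(** Curves are continuous in time for the supremum over Om, at all real times: a
curve defined for nonnegative times is extended by its initial value. *)
Definition uniform_curve w : Prop := forall t, [/\ measurable_fun Om (w t),
  exists B : R, forall x, Om x -> `|w t x| <= B &
  forall e : R, 0 < e -> exists2 d : R, 0 < d & forall s, `|s - t| < d ->
    forall x, Om x -> `|w s x - w t x| <= e].

Lemma C0_uniform_curve u : (forall t, 0 <= t -> C0 Om (u t)) ->
  continuous_curve (sup_norm Om) `[0, +oo[ u -> uniform_curve (fun s => u (Num.max s 0)).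
Proof.
move=> uC cu t; have t0 : 0 <= Num.max t 0 :> R by rewrite le_max lexx orbT.
split; first by apply: C0_measurable; exact: uC.
  have [B HB] := C0_bounded (uC _ t0); exists B => x Ox; apply: HB; exact: subset_closure.
move=> e e0; have tI : `[0, +oo[%classic (Num.max t 0) by rewrite /= in_itv /= andbT.
have /cvgrPdist_le /(_ e e0) := cu _ tI.
rewrite /within /= => /nbhs_ballP[d /= d0 H]; exists d => // s st x Ox.
have s0 : 0 <= Num.max s 0 :> R by rewrite le_max lexx orbT.
have : ball (Num.max t 0) d (Num.max s 0).
  rewrite /ball /= distrC; apply: le_lt_trans st.
  by rewrite /Num.max; case: ltP => ?; case: ltP => ?; rewrite ?subrr// ler_norml; apply/andP; split; move: (ler_norm (s - t)) (ler_norm (- (s - t))); rewrite normrN; lra.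
move/H; rewrite /= in_itv /= andbT => /(_ s0); rewrite sub0r normrN => h.
apply: le_trans (le_sup_norm (C0B (uC _ s0) (uC _ t0)) (subset_closure Ox)) _.
exact: le_trans (ler_norm _) h.
Qed.

(** Near a given time the curve takes its values in a bounded interval, where N is
Lipschitz. *)
Lemma uniform_curve_comp w (N : R -> R) : continuous N ->
  (forall B : R, exists2 L : R, 0 <= L & forall a b, `|a| <= B -> `|b| <= B -> `|N a - N b| <= L * `|a - b|) ->
  uniform_curve w -> uniform_curve (fun s x => N (w s x)).
Proof.
move=> cN NL uw t; have [mw [B HB] cw] := uw t.
have [L L0 HL] := NL (B + 1).
have B1 x : Om x -> `|w t x| <= B + 1 by move=> /HB h; rewrite (le_trans h)// lerDl.
split.
- by apply: measurableT_comp => //; exact: continuous_measurable_fun.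
- exists (`|N (w t 0)| + L * (2 * B + 2) + `|N 0| + L * (B + 1)) => x Ox.
  have B0 : 0 <= B by apply: le_trans (HB x Ox).
  have := HL (w t x) 0 (B1 _ Ox); rewrite normr0 subr0 => /(_ (addr_ge0 B0 ler01)) h.
  have h2 : L * `|w t x| <= L * (B + 1) by rewrite ler_wpM2l// B1.
  have h3 := ler_normD (N (w t x) - N 0) (N 0); rewrite subrK in h3.
  have h4 : 0 <= L * (2 * B + 2) by rewrite mulr_ge0//; lra.
  have h5 := normr_ge0 (N (w t 0)).
  lra.
move=> e e0.
have e'0 : 0 < Num.min (e / (L + 1)) 1 by rewrite lt_min ltr01 andbT divr_gt0// ltr_wpDl.
have [d d0 H] := cw _ e'0; exists d => // s st x Ox.
have /H/(_ _ Ox) := st; rewrite le_min => /andP[h1 h2].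
have ws : `|w s x| <= B + 1.
  have := ler_normD (w s x - w t x) (w t x); rewrite subrK => h3.
  by have := HB _ Ox; lra.
apply: le_trans (HL _ _ ws (B1 _ Ox)) _.
apply: le_trans (ler_wpM2l L0 h1) _.
rewrite mulrCA ger_pMr// ler_pdivrMr ?mul1r ?lerDl//.
by rewrite ltr_wpDl.
Qed.

Lemma uniform_curve_L2 w t : uniform_curve w -> L2 Om (w t).
Proof. by move=> /(_ t)[mw [B HB] _]; exact: (L2_bounded mOm finOm (C := B)). Qed.

Lemma uniform_curve_L2norm w t e : uniform_curve w -> 0 < e -> exists2 d : R, 0 < d &
  forall s, `|s - t| < d -> L2norm Om (fun x => w s x - w t x) <= e.
Proof.
move=> uw e0; have [_ _ cw] := uw t.
pose V := L2norm Om (fun=> 1 : R).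
have V0 : 0 <= V by exact: L2norm_ge0.
have e'0 : 0 < e / (V + 1) by rewrite divr_gt0// ltr_wpDl.
have [d d0 H] := cw _ e'0; exists d => // s st.
apply: (@le_trans _ _ (e / (V + 1) * V)).
  rewrite -[X in X * _](gtr0_norm e'0) -(L2normZ mOm)//.
  apply: L2norm_le => //.
    by apply: L2B => //; exact: uniform_curve_L2.
  by move=> x Ox; rewrite mulr1 (gtr0_norm e'0); exact: H.
rewrite -mulrA ger_pMr// mulrC ler_pdivrMr ?mul1r ?lerDl//.
by rewrite ltr_wpDl.
Qed.

Lemma uniform_curve_dot w f : uniform_curve w -> L2 Om f ->
  continuous (fun s => L2dot Om (w s) f).
Proof.
move=> uw Lf t; apply/cvgrPdist_le => e e0.
have e'0 : 0 < e / (L2norm Om f + 1) by rewrite divr_gt0// ltr_wpDl// L2norm_ge0.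
have [d d0 H] := uniform_curve_L2norm t uw e'0.
apply/nbhs_ballP; exists d => //= s; rewrite /ball /= distrC => /H h.
rewrite distrC -L2dotBl//; try exact: uniform_curve_L2.
apply: le_trans (L2_CS mOm _ Lf) _.
  by apply: L2B => //; exact: uniform_curve_L2.
apply: le_trans (ler_wpM2r (L2norm_ge0 _ _) h) _.
rewrite -mulrA ger_pMr// mulrC ler_pdivrMr ?mul1r ?lerDl//.
by rewrite ltr_wpDl// L2norm_ge0.
Qed.

End Curves.

Section Bochner.
Context {R : realType} (Om : set (R * R)).
Hypothesis mOm : measurable Om.
Implicit Types (f g psi : R * R -> R).
Local Notation mu := (@lebesgue_measure R).

Lemma Rintegral_sum (D : set R) n (h : nat -> R -> R) :
  measurable (D : set (measurableTypeR R)) ->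
  (forall i, mu.-integrable D (EFin \o h i)) ->
  mu.-integrable D (EFin \o (fun s => \sum_(i < n) h i s)) /\
  (\int[mu]_(s in D) (\sum_(i < n) h i s) = \sum_(i < n) \int[mu]_(s in D) h i s)%R.
Proof.
move=> mD ih; elim: n => [|n [IH1 IH2]].
  have -> : (fun s => \sum_(i < 0) h i s) = fun=> 0 by apply/funext => s; rewrite big_ord0.
  by rewrite big_ord0 Rintegral_cst// mul0r; split => //; exact: integrable0.
have -> : (fun s => \sum_(i < n.+1) h i s) = (fun s => \sum_(i < n) h i s + h n s).
  by apply/funext => s; rewrite big_ord_recr.
split; first exact: (integrableD mD IH1 (ih n)).
by rewrite (RintegralD mD IH1 (ih n)) IH2 big_ord_recr.
Qed.

(** For simple functions this is linearity. By Cauchy-Schwarz the error is at most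
the integral of the L2 distance to the simple functions. *)
Lemma bochner_integral_dot (a b : R) F J psi : L2 Om psi ->
  bochner_integral Om a b F J ->
  mu.-integrable `[a, b] (EFin \o (fun s => L2dot Om (F s) psi)) ->
  L2dot Om J psi = (\int[mu]_(s in `[a, b]) L2dot Om (F s) psi)%R.
Proof.
move=> Lpsi [LJ LF [m [A [v [mAv ierr err0 SJ]]]]] iF.
set err := (fun n s => L2norm Om (fun x => F s x - \sum_(i < m n) \1_(A n i) s * v n i x)) in ierr err0.
set S := fun n x => _ in SJ.
have mab : measurable (`[a, b]%classic : set (measurableTypeR R)) by exact: measurable_itv.
have LS n : L2 Om (S n).
  by apply: L2_sum => // i _; apply: L2Z => //; have [] := mAv n i.
have iind n i : mu.-integrable `[a, b] (EFin \o (\1_(A n i) : R -> R)).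
  have [mA _] := mAv n i.
  apply: (@measurable_bounded_integrable _ _ _ mu (\1_(A n i)) _ mab) => //.
  - by apply: compact_finite_measure; exact: segment_compact.
  - exists 1; split => // M M1 x _ /=.
    by rewrite indicE; case: (_ \in _); rewrite ?normr1 ?normr0 ?ltW// (lt_trans ltr01).
have ih n i : mu.-integrable `[a, b] (EFin \o (fun s => L2dot Om (v n i) psi * \1_(A n i) s)).
  exact: (integrableZl mab (L2dot Om (v n i) psi) (iind n i)).
pose p n s := \sum_(i < m n) L2dot Om (v n i) psi * \1_(A n i) s.
have [ip pE] : (forall n, mu.-integrable `[a, b] (EFin \o p n)) /\
    forall n, (\int[mu]_(s in `[a, b]) p n s)%R = L2dot Om (S n) psi.
  split=> n; have [h1 h2] := Rintegral_sum (m n) mab (ih n) => //.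
  rewrite h2 /S L2dot_suml//; last first.
    by move=> i _; apply: L2Z => //; have [] := mAv n i.
  apply: eq_bigr => i _; have [mA Lv] := mAv n i.
  rewrite L2dotZl// RintegralZl// mulrC; congr (_ * _).
  by rewrite /Rintegral integral_indic.
have lim1 := L2cvg_dot mOm LS LJ Lpsi SJ.
have lim2 : (fun n => L2dot Om (S n) psi) @ \oo --> (\int[mu]_(s in `[a, b]) L2dot Om (F s) psi)%R.
  apply: (@cvgn_squeeze0 _ _ (fun n => L2norm Om psi * (\int[mu]_(s in `[a, b]) err n s)%R)).
    by rewrite -(mulr0 (L2norm Om psi)); apply: cvgMr.
  move=> n; rewrite -pE -(RintegralB mab (ip n) iF).
  have iB : mu.-integrable `[a, b] (EFin \o (fun s => p n s - L2dot Om (F s) psi)) by exact: (integrableB mab (ip n) iF).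
  apply: le_trans (le_normr_Rintegral mab iB) _.
  rewrite -(RintegralZl _ mab (ierr n)); apply: le_Rintegral => //.
  - exact: (integrable_norm iB).
  - exact: (integrableZl mab _ (ierr n)).
  move=> s sab; have Ls := LF s sab.
  have Lq : L2 Om (fun x => \sum_(i < m n) \1_(A n i) s * v n i x).
    by apply: L2_sum => // i _; apply: L2Z => //; have [] := mAv n i.
  have -> : p n s = L2dot Om (fun x => \sum_(i < m n) \1_(A n i) s * v n i x) psi.
    rewrite L2dot_suml//; last by move=> i _; apply: L2Z => //; have [] := mAv n i.
    apply: eq_bigr => i _; have [_ Lvi] := mAv n i.
    by rewrite L2dotZl// mulrC.
  rewrite distrC -L2dotBl// mulrC /err; apply: L2_CS => //; exact: L2B.
exact: cvg_unique lim1 lim2.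
Qed.

End Bochner.

Section Evolution.
Context {R : realType} (Om : set (R * R)).
Hypothesis oOm : open Om.
Hypothesis bOm : bounded_set Om.
Variables (lambda : nat -> R) (phi : nat -> R * R -> R).
Hypothesis onb : orthonormal_basis Om phi.
Variables (alpha eps : R) (N : R -> R) (u0 : R * R -> R) (u : R -> R * R -> R).
Hypothesis cN : continuous N.
Hypothesis NL : forall B : R, exists2 L : R, 0 <= L &
  forall a b, `|a| <= B -> `|b| <= B -> `|N a - N b| <= L * `|a - b|.
Hypothesis hu : global_solution Om lambda phi alpha eps N u0 u.
Local Notation mu := (@lebesgue_measure R).

Let mOm : measurable Om. Proof. exact: open_measurable2. Qed.
Let finOm : (leb2 Om < +oo)%E. Proof. exact: finite_domain. Qed.
Let Lphi k : L2 Om (phi k). Proof. by case: onb. Qed.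

Let v (s : R) := u (Num.max s 0).
Let nu k := eps ^+ 2 * lambda k `^ alpha.
Let c k (s : R) := coef Om phi (v s) k.
Let g k (s : R) := coef Om phi (fun x => N (v s x)) k.

Lemma solution_uniform_curve : uniform_curve Om v.
Proof. by have [h1 h2 _ _] := hu; exact: C0_uniform_curve. Qed.

Lemma reaction_uniform_curve : uniform_curve Om (fun s x => N (v s x)).
Proof. by apply: uniform_curve_comp => //; exact: solution_uniform_curve. Qed.

Let Lv s : L2 Om (v s).
Proof. by apply: uniform_curve_L2 => //; exact: solution_uniform_curve. Qed.
Let LN s : L2 Om (fun x => N (v s x)).
Proof. by apply: (@uniform_curve_L2 _ _ oOm bOm (fun s x => N (v s x))); exact: reaction_uniform_curve. Qed.

Lemma continuous_reaction_coef k : continuous (g k).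
Proof.
apply: (@uniform_curve_dot _ _ oOm bOm (fun s x => N (v s x))) => //.
exact: reaction_uniform_curve.
Qed.

Let coef_Q (t : R) f k : 0 <= t -> L2 Om f ->
  L2 Om (Q Om lambda phi alpha eps t f) /\
  coef Om phi (Q Om lambda phi alpha eps t f) k = expR (- (nu k * t)) * coef Om phi f k.
Proof.
move=> t0 Lf.
have B n : \sum_(i < n) (expR (- (eps ^+ 2 * lambda i `^ alpha * t)) * coef Om phi f i) ^+ 2 <= L2dot Om f f.
  apply: le_trans (bessel mOm onb n Lf); apply: ler_sum => i _.
  rewrite exprMn ler_piMl ?sqr_ge0// exprn_ile1 ?expR_ge0// -expR0 ler_expR.
  by rewrite oppr_le0 mulr_ge0// mulr_ge0 ?sqr_ge0 ?powR_ge0.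
have [h1 h2] := spectralP (m := fun l => expR (- (eps ^+ 2 * l `^ alpha * t))) mOm finOm onb B.
by split => //; rewrite h2.
Qed.

Let weight k s := expR (nu k * s) * g k s.

Let continuous_weight k : continuous (weight k).
Proof.
move=> s; apply: (@continuousM _ _ (fun s => expR (nu k * s)) (g k)); last exact: continuous_reaction_coef.
apply: (@continuous_comp _ _ _ (fun s => nu k * s) expR); last exact: continuous_expR.
by apply: continuousM; [exact: cvg_cst|exact: cvg_id].
Qed.

Let weight_integrable k (a b : R) : mu.-integrable `[a, b] (EFin \o weight k).
Proof.
apply: continuous_compact_integrable; first exact: segment_compact.
by apply: continuous_subspaceT; exact: continuous_weight.
Qed.

(** After pairing with phi k, Duhamel's formula only involves the integral of a
continuous real function. *)
Lemma duhamel_coef k (t : R) : 0 <= t ->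
  c k t = expR (- (nu k * t)) * (c k 0 - \int[mu]_(s in `[0, t]) weight k s)%R.
Proof.
move=> t0; have [_ _ u00 /(_ t t0)[J [BJ ae]]] := hu.
have LJ : L2 Om J by case: BJ.
have Lu0 : L2 Om u0.
  apply: (L2_ext mOm _ (Lv 0)) => x Ox; rewrite /v maxxx; apply: u00; exact: subset_closure.
have [LQ cQ] := coef_Q k t0 Lu0.
have mab : measurable (`[0, t]%classic : set (measurableTypeR R)) by exact: measurable_itv.
have vt s : 0 <= s -> v s = u s by move=> s0; rewrite /v max_l.
have cF s : s \in `[0, t] -> coef Om phi (Q Om lambda phi alpha eps (t - s) (fun x => N (u s x))) k =
    expR (- (nu k * t)) * weight k s.
  rewrite in_itv /= => /andP[s0 st].
  have Ls := LN s; rewrite vt// in Ls.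
  have ts : 0 <= t - s by rewrite subr_ge0.
  have [_ ->] := coef_Q k ts Ls.
  rewrite /weight /g vt// mulrA -expRD; congr (expR _ * _); ring.
have iw : mu.-integrable `[0, t] (EFin \o (fun s => expR (- (nu k * t)) * weight k s)).
  exact: (integrableZl mab _ (weight_integrable k 0 t)).
have cJ : coef Om phi J k = expR (- (nu k * t)) * (\int[mu]_(s in `[0, t]) weight k s)%R.
  rewrite /coef (bochner_integral_dot mOm (Lphi k) BJ); last first.
    apply: (eq_integrable mab _ _ _ iw) => s; rewrite inE /= => sI; congr EFin.
    by rewrite -cF.
  rewrite -(RintegralZl _ mab (weight_integrable k 0 t)); apply: eq_Rintegral => s.
  by rewrite inE /= => sI; rewrite -cF.
rewrite /c vt//.
have -> : coef Om phi (u t) k = coef Om phi (fun x => Q Om lambda phi alpha eps t u0 x - J x) k.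
  rewrite /coef; apply: L2dot_ae_l => //.
  - by rewrite -vt.
  - exact: L2B.
rewrite {1}/coef L2dotBl// -/(coef _ _ _ k) cQ -/(coef _ _ J k) cJ mulrBr; congr (_ * _ - _).
apply: eq_L2dot => // x Ox; rewrite /v maxxx u00//; exact: subset_closure.
Qed.

Lemma coef_ode k (t : R) : 0 < t -> is_derive t (1 : R) (c k) (- (nu k * c k t) - g k t).
Proof.
move=> t0.
have [S [dS IS]] := @primitive_from R (weight k) (-1) (@continuous_weight k).
pose h s := expR (- (nu k * s)) * (c k 0 - (S s - S 0)).
have hc s : 0 <= s -> h s = c k s.
  by move=> s0; rewrite duhamel_coef// /h IS//; lra.
apply: (@near_eq_is_derive _ _ _ h).
  by near=> s; apply: hc; apply: ltW; near: s; exact: lt_nbhsr.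
have e1 : is_derive t (1 : R) (fun s => - (nu k * s)) (- nu k).
  have := is_deriveN (is_deriveZ (nu k) (is_derive_id t (1 : R))).
  by move=> H; apply: (is_derive_eq H); rewrite scaler1.
have e2 : is_derive t (1 : R) (expR \o (fun s => - (nu k * s))) (expR (- (nu k * t)) * - nu k).
  exact: (@is_derive1_comp _ expR (fun s => - (nu k * s))).
have e3 : is_derive t (1 : R) (fun s => c k 0 - (S s - S 0)) (- weight k t).
  have H := is_deriveB (is_derive_cst (c k 0) t (1 : R)) (is_deriveB (dS t (lt_trans (ltrN10 R) t0)) (is_derive_cst (S 0) t (1 : R))).
  by apply: (is_derive_eq H); rewrite subr0 sub0r.
have H := is_deriveM e2 e3; apply: (is_derive_eq H).
rewrite -(hc t (ltW t0)) /h /weight /= /GRing.scale /=.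
have E : expR (- (nu k * t)) * expR (nu k * t) = 1 by rewrite expRN mulVf// gt_eqF// expR_gt0.
rewrite [X in X + _](_ : _ = - (expR (- (nu k * t)) * expR (nu k * t) * g k t)); last by ring.
by rewrite E mul1r; ring.
Unshelve. all: by end_near. Qed.

End Evolution.

(** * The flow remains in an interval *)

Section OneVariable.
Context {R : realType}.

(** For each positive slope, the supremum of the times at which Phi lies below the
line with this slope through (a, Phi a) can only be b. *)
Lemma nonincreasing_of_upper_derivate (Phi : R -> R) (a b : R) : a <= b -> continuous Phi ->
  (forall t eta : R, a <= t < b -> 0 < eta ->
     exists2 d : R, 0 < d & forall s, 0 < s < d -> Phi (t + s) <= Phi t + eta * s) ->
  Phi b <= Phi a.
Proof.
move=> ab cPhi H; apply/ler_addgt0Pr => e e0.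
pose eta := e / (b - a + 1).
have eta0 : 0 < eta by rewrite divr_gt0// ltr_wpDl// subr_ge0.
pose A := [set t : R | a <= t <= b /\ Phi t <= Phi a + eta * (t - a)].
have Aa : A a by rewrite /A /= lexx ab subrr mulr0 addr0.
have ubA : ubound A b by move=> t [/andP[_ tb] _].
have hA : has_sup A by split; [exists a|exists b].
set s := sup A.
have as_ : a <= s by apply: ub_le_sup => //; exists b.
have sb : s <= b by apply: ge_sup => //; exists a.
have As : Phi s <= Phi a + eta * (s - a).
  rewrite leNgt; apply/negP => lt.
  have := cPhi s; move=> /cvgrPdist_lt/(_ (Phi s - (Phi a + eta * (s - a)))).
  rewrite subr_gt0 => /(_ lt)/nbhs_ballP[d /= d0 Hd].
  have [t At ts] := sup_adherent d0 hA; rewrite -/s in ts.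
  have tls : t <= s by apply: ub_le_sup => //; exists b.
  have := Hd t; rewrite /ball /= ger0_norm ?subr_ge0// => /(_ _).
  have dt : s - t < d by rewrite ltrBlDl -ltrBlDr.
  move=> /(_ dt) h; case: At => _ h2.
  have h3 := ler_norm (Phi s - Phi t).
  have : eta * (t - a) <= eta * (s - a) by rewrite ler_wpM2l ?(ltW eta0)// lerD2r.
  by move: (eta * _) (eta * _) h h2 h3 => X Y; lra.
have sbE : s = b.
  apply/eqP; rewrite eq_le sb /= leNgt; apply/negP => slb.
  have [|d d0 Hd] := H s eta _ eta0; first by rewrite as_ slb.
  pose r := Num.min (d / 2) (b - s).
  have r0 : 0 < r by rewrite /r lt_min divr_gt0// subr_gt0 slb.
  have rd : r < d by rewrite /r gt_min ltr_pdivrMr// ltr_pMr// ltr1n.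
  have rb : s + r <= b by rewrite -lerBrDl /r ge_min lexx orbT.
  have : A (s + r).
    split; first by rewrite rb andbT (le_trans as_)// lerDl ltW.
    have := Hd r; rewrite r0 rd => /(_ isT) h.
    have -> : eta * (s + r - a) = eta * (s - a) + eta * r by ring.
    by move: As h; move: (eta * (s - a)) (eta * r) => X Y; lra.
  move=> /(ub_le_sup (ex_intro _ b ubA)); rewrite -/s leNgt => /negP; apply.
  by rewrite ltrDl.
rewrite sbE in As; apply: (le_trans As); rewrite lerD2l /eta.
rewrite -mulrA ger_pMr// mulrC ler_pdivrMr ?mul1r ?lerDl//.
by rewrite ltr_wpDl// subr_ge0.
Qed.

(** The difference F - V is trapped between - W and W, up to constants, and W is
flat at s. *)
Lemma is_derive_sandwich (F V W : R -> R) (s d : R) :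
  is_derive s (1 : R) V d -> is_derive s (1 : R) W 0 ->
  (forall x, `|F x - F s - (V x - V s)| <= W x - W s) -> is_derive s (1 : R) F d.
Proof.
move=> dV dW H.
pose D x := F x - V x.
have lW : (fun h => h^-1 *: (W (h *: (1 : R) + s) - W s)) @ (0 : R)^' --> (0 : R).
  have [dW1 dW2] := dW.
  by rewrite -[X in _ --> X]dW2; exact: dW1.
have lD : (fun h => h^-1 *: (D (h *: (1 : R) + s) - D s)) @ (0 : R)^' --> (0 : R).
  apply/cvgrPdist_le => e e0.
  move/cvgrPdist_le: lW => /(_ e e0); apply: filterS => h.
  rewrite !sub0r !normrN => h1; apply: le_trans h1.
  rewrite !normrZ ler_wpM2l// /D.
  have -> : F (h *: 1 + s) - V (h *: 1 + s) - (F s - V s) =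
     F (h *: 1 + s) - F s - (V (h *: 1 + s) - V s) by ring.
  exact: le_trans (H _) (ler_norm _).
have dD : is_derive s (1 : R) D 0.
  by apply: DeriveDef; [apply: (cvgP _ lD)|apply: cvg_lim lD].
have -> : F = (fun x => D x + V x) by apply/funext => x; rewrite /D subrK.
by have HH := is_deriveD dD dV; apply: (is_derive_eq HH); rewrite add0r.
Qed.

Lemma is_derive_sum_lt n (h dh : nat -> R -> R) (s : R) :
  (forall k, is_derive s (1 : R) (h k) (dh k s)) ->
  is_derive s (1 : R) (fun x => \sum_(k < n) h k x) (\sum_(k < n) dh k s).
Proof.
move=> H; elim: n => [|n IH].
  have -> : (fun x => \sum_(k < 0) h k x) = fun=> 0 by apply/funext => x; rewrite big_ord0.
  by rewrite big_ord0; exact: is_derive_cst.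
have -> : (fun x => \sum_(k < n.+1) h k x) = (fun x => \sum_(k < n) h k x + h n x).
  by apply/funext => x; rewrite big_ord_recr.
by rewrite big_ord_recr; exact: is_deriveD.
Qed.

Lemma sandwich_bounds (Fx Ft q q' S : R) : 0 <= S -> 2 * q <= Fx - Ft ->
  2 * - q' <= Ft - Fx -> q' - q <= S -> - (2 * S) <= Fx - Ft - 2 * q <= 2 * S.
Proof. by move=> *; apply/andP; split; lra. Qed.

Lemma chain_lower_bound (X Y eta q0 q1 q2 : R) : 0 <= q0 -> X + Y <= eta ->
  q0 - q1 <= X -> q1 - q2 <= Y -> - eta <= q2.
Proof. by move=> *; lra. Qed.

End OneVariable.

Section MaximumPrinciple.
Context {R : realType} (Om : set (R * R)).
Hypothesis oOm : open Om.
Hypothesis bOm : bounded_set Om.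
Variables (lambda : nat -> R) (phi : nat -> R * R -> R).
Hypothesis eig : dirichlet_eigenbasis Om lambda phi.
Variables (M alpha eps : R).
Hypothesis M0 : 0 <= M.
Hypothesis al01 : 0 < alpha < 1.
Variables (v w : R -> R * R -> R).
Hypothesis uv : uniform_curve Om v.
Hypothesis uw : uniform_curve Om w.

Let mOm : measurable Om. Proof. exact: open_measurable2. Qed.
Let onb : orthonormal_basis Om phi. Proof. by case: eig. Qed.
Let Lphi k : L2 Om (phi k). Proof. by case: onb. Qed.
Let Lv s : L2 Om (v s). Proof. exact: uniform_curve_L2. Qed.
Let Lw s : L2 Om (w s). Proof. exact: uniform_curve_L2. Qed.

Let c s k := coef Om phi (v s) k.
Let g s k := coef Om phi (w s) k.
Let nu k := eps ^+ 2 * lambda k `^ alpha.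

Hypothesis ode : forall k (t : R), 0 < t ->
  is_derive t (1 : R) (fun s => c s k) (- (nu k * c t k) - g t k).
Hypothesis sign : forall t x, Om x -> 0 <= gap M (v t x) * w t x.
Hypothesis init : forall x, Om x -> `|v 0 x| <= M.

Let P f n := fsum phi (coef Om phi f) n.
Let LP f n : L2 Om (P f n). Proof. exact: L2_fsum. Qed.
Let Lgap f : L2 Om f -> L2 Om (gap M \o f). Proof. exact: L2_gap. Qed.
Let E := gap_energy Om M.
Let p n t := E (P (v t) n).
Let ga n t k := L2dot Om (phi k) (gap M \o P (v t) n).

Let gapL2 f h : L2 Om f -> L2 Om h ->
  L2norm Om (fun x => gap M (f x) - gap M (h x)) <= L2norm Om (fun x => f x - h x).
Proof.
move=> Lf Lh; rewrite -[leRHS]mul1r.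
apply: (L2norm_comp_lipschitz oOm) => //; [|exact: gap0|exact: gap_continuous].
by move=> a b; rewrite mul1r gap_lipschitz.
Qed.

(** The two tangent inequalities between times t and x pinch the increment of the
convex energy; they differ by at most twice the squared
increment of the curve. *)
Let is_derive_truncated_energy n (t : R) : 0 < t ->
  is_derive t (1 : R) (p n) (2 * \sum_(k < n) (- (nu k * c t k) - g t k) * ga n t k).
Proof.
move=> t0.
(* V linearizes the energy at time t, and W bounds the error. *)
pose V x := 2 * \sum_(k < n) c x k * ga n t k.
pose W x := 2 * \sum_(k < n) (c x k - c t k) ^+ 2.
have dV : is_derive t (1 : R) V (2 * \sum_(k < n) (- (nu k * c t k) - g t k) * ga n t k).
  have HS := @is_derive_sum_lt R n (fun k x => c x k * ga n t k) (fun k t => (- (nu k * c t k) - g t k) * ga n t k) t _.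
  apply: (is_derive_eq (is_deriveZ 2 (HS _))) => // k.
  have HM := is_deriveM (ode k t0) (is_derive_cst (ga n t k) t (1 : R)).
  by apply: (is_derive_eq HM); rewrite scaler0 add0r /GRing.scale /= mulrC.
have dW : is_derive t (1 : R) W 0.
  have HS := @is_derive_sum_lt R n (fun k x => (c x k - c t k) ^+ 2) (fun k t => 0) t _.
  apply: (is_derive_eq (is_deriveZ 2 (HS _))); last by rewrite big1// scaler0.
  move=> k.
  have HB : is_derive t (1 : R) (fun x => c x k - c t k) (- (nu k * c t k) - g t k - 0).
    exact: (is_deriveB (ode k t0) (is_derive_cst (c t k) t (1 : R))).
  have HM := is_deriveM HB HB.
  by apply: (is_derive_eq HM); rewrite /= subrr !scale0r addr0.
apply: (is_derive_sandwich dV dW) => x.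
have La := LP (v x) n; have Lb := LP (v t) n.
have Lga := Lgap La; have Lgb := Lgap Lb.
pose D z := P (v x) n z - P (v t) n z.
have LD : L2 Om D by exact: L2B.
have DE : D = fsum phi (fun k => c x k - c t k) n by apply/funext => z; rewrite fsumB.
have h1 := gap_energy_tangent oOm M0 La Lb.
have h2 := gap_energy_tangent oOm M0 Lb La.
have VE : V x - V t = 2 * L2dot Om D (gap M \o P (v t) n).
  rewrite DE (L2dot_fsum mOm onb)//.
  rewrite /V -mulrBr -sumrB; congr (_ * _).
  by apply: eq_bigr => k _; rewrite mulrBl.
have WE : W x - W t = 2 * L2dot Om D D.
  rewrite DE (L2norm2_fsum mOm onb) /W [X in _ - 2 * X]big1 ?mulr0 ?subr0//.
  by move=> k _; rewrite subrr expr0n.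
rewrite -/D -VE in h1.
have h3 : L2dot Om (fun z => P (v t) n z - P (v x) n z) (gap M \o P (v x) n) =
   - L2dot Om D (gap M \o P (v x) n).
  transitivity (L2dot Om (fun z => - D z) (gap M \o P (v x) n)); last first.
    by rewrite L2dotNl//; exact: Lgap.
  by apply: eq_L2dot => // z _; rewrite opprB.
have h4 : L2dot Om D (gap M \o P (v x) n) - L2dot Om D (gap M \o P (v t) n) <= L2dot Om D D.
  rewrite -L2dotBr//; try exact: Lgap.
  apply: le_trans (ler_norm _) _.
  apply: le_trans (L2_CS mOm LD _) _; first exact: L2B.
  rewrite -sqr_L2norm expr2 ler_wpM2l ?L2norm_ge0//.
  exact: gapL2.
rewrite VE in h1 *; rewrite WE -/(p n x) -/(p n t) ler_norml.
rewrite -/(E _) -/(E _) -/(p n x) -/(p n t) in h1 h2; rewrite h3 in h2.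
have h5 : 0 <= L2dot Om D D by exact: L2dot_ge0.
exact: sandwich_bounds h5 h1 h2 h4.
Qed.

(** Taking the remainder after n terms does not increase the norm of f - h. *)
Let tail_contraction f h n : L2 Om f -> L2 Om h ->
  L2norm Om (fun x => f x - P f n x) <=
  L2norm Om (fun x => h x - P h n x) + L2norm Om (fun x => f x - h x).
Proof.
move=> Lf Lh; pose k x := f x - h x.
have Lk : L2 Om k by exact: L2B.
have Lkk : L2 Om (fun x => k x - P k n x) by exact: L2B.
have Lhh : L2 Om (fun x => h x - P h n x) by exact: L2B.
have -> : L2norm Om (fun x => f x - P f n x) =
    L2norm Om (fun x => (h x - P h n x) + (k x - P k n x)).
  apply: eq_L2norm => x _; rewrite /P /k.
  have -> : fsum phi (coef Om phi (fun x => f x - h x)) n x =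
     fsum phi (coef Om phi f) n x - fsum phi (coef Om phi h) n x.
    rewrite -fsumB; apply: eq_bigr => i _; congr (_ * _).
    by rewrite /coef L2dotBl.
  ring.
apply: le_trans (L2normD mOm Lhh Lkk) _; rewrite lerD2l.
rewrite ler_wsqrtr// /P sub_fsum_coef_fsum//.
rewrite [X in _ + X]big1 ?addr0; last by move=> i _; rewrite subrr expr0n.
by rewrite gerBl sumr_ge0// => i _; exact: sqr_ge0.
Qed.

(** The sum tends to <w, gap o v>, which is nonnegative. At time s the error of the
truncation is controlled by that at time t and by the displacement of the curves,
so that n0 does not depend on s. *)
Let local_lower_bound (t eta : R) : 0 < eta ->
  exists2 d : R, 0 < d & exists n0, forall n s, (n0 <= n)%N -> `|s - t| < d ->
    - eta <= \sum_(k < n) g s k * ga n s k.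
Proof.
move=> eta0.
pose A := L2norm Om (v t) + 1; pose B := L2norm Om (w t) + 1.
have A1 : 1 <= A by rewrite lerDr L2norm_ge0.
have B1 : 1 <= B by rewrite lerDr L2norm_ge0.
pose e := Num.min 1 (eta / (2 * (A + B))).
have AB : 0 < 2 * (A + B) by lra.
have e0 : 0 < e by rewrite lt_min ltr01 divr_gt0.
have e1 : e <= 1 by rewrite ge_min lexx.
have eAB : e * (2 * (A + B)) <= eta by rewrite -ler_pdivlMr// ge_min lexx orbT.
have [d1 d10 H1] := uniform_curve_L2norm oOm bOm t uv e0.
have [d2 d20 H2] := uniform_curve_L2norm oOm bOm t uw e0.
have tail f : L2 Om f -> exists n0, forall n, (n0 <= n)%N -> L2norm Om (fun x => f x - P f n x) <= e.
  move=> Lf; have /cvgn_epsP/(_ e e0)[n0 Hn] := L2cvg_coef onb Lf.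
  exists n0 => n /Hn; rewrite subr0 ger0_norm ?L2norm_ge0// => h.
  by rewrite (L2norm_sub mOm).
have [n1 Hn1] := tail _ (Lv t); have [n2 Hn2] := tail _ (Lw t).
exists (Num.min d1 d2); first by rewrite lt_min d10.
exists (maxn n1 n2) => n s; rewrite geq_max => /andP[/Hn1 t1 /Hn2 t2].
rewrite lt_min => /andP[/H1 s1 /H2 s2].
have T1 := le_trans (tail_contraction n (Lv s) (Lv t)) (lerD t1 s1).
have T2 := le_trans (tail_contraction n (Lw s) (Lw t)) (lerD t2 s2).
have nv : L2norm Om (v s) <= A.
  rewrite -lerBlDl; apply: le_trans (ler_norm _) _.
  apply: le_trans (L2norm_dist mOm (Lv s) (Lv t)) _; exact: le_trans s1 e1.
have nw : L2norm Om (P (w s) n) <= B.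
  have : L2norm Om (P (w s) n) <= L2norm Om (w s).
    rewrite ler_wsqrtr// /P (L2norm2_fsum mOm onb); exact: bessel.
  move=> h; apply: (le_trans h); rewrite -lerBlDl; apply: le_trans (ler_norm _) _.
  apply: le_trans (L2norm_dist mOm (Lw s) (Lw t)) _; exact: le_trans s2 e1.
have -> : \sum_(k < n) g s k * ga n s k = L2dot Om (P (w s) n) (gap M \o P (v s) n).
  by rewrite (L2dot_fsum mOm onb)//; exact: Lgap.
have Lg := Lgap (Lv s); have LPg := Lgap (LP (v s) n).
have q0 : 0 <= L2dot Om (w s) (gap M \o v s).
  by apply: Rintegral_ge0 => x Ox; rewrite mulrC; exact: sign.
have D1 : L2dot Om (fun x => w s x - P (w s) n x) (gap M \o v s) <= (e + e) * A.
  apply: le_trans (ler_norm _) _; apply: le_trans (L2_CS mOm _ Lg) _; first exact: L2B.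
  apply: ler_pM => //; rewrite ?L2norm_ge0//; apply: le_trans nv.
  by apply: L2norm_le => // x _; exact: gap_le.
have D2 : L2dot Om (P (w s) n) (fun x => gap M (v s x) - gap M (P (v s) n x)) <= B * (e + e).
  apply: le_trans (ler_norm _) _; apply: le_trans (L2_CS mOm _ _) _ => //; first exact: L2B.
  apply: ler_pM => //; rewrite ?L2norm_ge0//; apply: le_trans T1.
  exact: gapL2.
rewrite L2dotBl// in D1; rewrite L2dotBr// in D2.
have EE : e * (2 * (A + B)) = (e + e) * A + B * (e + e) by ring.
rewrite EE in eAB; exact: chain_lower_bound q0 eAB D1 D2.
Qed.

Let truncated_energy_cvg t : (fun n => p n t) @ \oo --> E (v t).
Proof.
have H : L2cvg Om (fun n => gap M \o P (v t) n) (gap M \o v t).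
  apply: (cvgn_squeeze0 (L2cvg_coef onb (Lv t))) => n.
  rewrite subr0 ger0_norm ?L2norm_ge0//; exact: gapL2.
have H2 := L2cvg_norm mOm (fun n => Lgap (LP (v t) n)) (Lgap (Lv t)) H.
rewrite /E /gap_energy -sqr_L2norm.
under [X in X @ _ --> _]eq_fun do rewrite /p /E /gap_energy -sqr_L2norm.
exact: cvgM.
Qed.

(** The derivative of the truncated energy is
- 2 eps^2 <A^alpha Pv, gap o Pv> - 2 <Pw, gap o Pv>. The first term is nonpositive by
fractional_gap_ge0, the second one almost so for large n. Since this holds on a
time interval that does not depend on n, the limit n -> oo can be taken. *)
Let energy_step (t eta : R) : 0 < t -> 0 < eta ->
  exists2 d : R, 0 < d & forall s, 0 < s < d -> E (v (t + s)) <= E (v t) + eta * s.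
Proof.
move=> t0 eta0.
have e20 : 0 < eta / 2 by rewrite divr_gt0.
have [d d0 [n0 H]] := local_lower_bound t e20.
exists d => // s /andP[s0 sd].
have lim1 := @truncated_energy_cvg (t + s); have lim2 := @truncated_energy_cvg t.
rewrite -lerBlDl.
apply: (cvgn_le (cvgB lim1 lim2) (N := n0)) => n nn.
have ts : t <= t + s by rewrite lerDl ltW.
have der x : t <= x <= t + s -> is_derive x (1 : R) (fun x => eta * x - p n x)
   (eta - 2 * \sum_(k < n) (- (nu k * c x k) - g x k) * ga n x k).
  move=> /andP[tx xs]; have x0 : 0 < x := lt_le_trans t0 tx.
  have H1 := is_deriveB (is_deriveZ eta (is_derive_id x (1 : R))) (is_derive_truncated_energy n x0).
  by apply: (is_derive_eq H1); rewrite /GRing.scale /= mulr1.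
have := nondecreasing_of_derive ts der.
have pos x : t <= x <= t + s -> 0 <= eta - 2 * \sum_(k < n) (- (nu k * c x k) - g x k) * ga n x k.
  move=> /andP[tx xs].
  have -> : \sum_(k < n) (- (nu k * c x k) - g x k) * ga n x k =
     - (eps ^+ 2 * \sum_(k < n) lambda k `^ alpha * c x k * ga n x k) - \sum_(k < n) g x k * ga n x k.
    rewrite mulr_sumr -sumrN -sumrB; apply: eq_bigr => k _; rewrite /nu; ring.
  have f0 : 0 <= eps ^+ 2 * \sum_(k < n) lambda k `^ alpha * c x k * ga n x k.
    by rewrite mulr_ge0 ?sqr_ge0//; apply: (fractional_gap_ge0 oOm bOm eig M0 n (c x) al01).
  have := H n x nn; rewrite ger0_norm ?subr_ge0// ltrBlDl => /(_ (le_lt_trans xs _)).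
  rewrite ltrD2l => /(_ sd).
  by move: (\sum_(k < n) g x k * _) (eps ^+ 2 * _) f0 => X Y; lra.
move=> /(_ pos); rewrite !fctE mulrDr; move: (p n t) (p n (t + s)) => X Y; lra.
Qed.

Let continuous_energy : continuous (fun t => E (v t)).
Proof.
move=> t; rewrite /E /gap_energy.
have cn : (fun s => L2norm Om (gap M \o v s)) @ t --> L2norm Om (gap M \o v t).
  apply/cvgrPdist_le => e e0.
  have [d d0 H] := uniform_curve_L2norm oOm bOm t uv e0.
  apply/nbhs_ballP; exists d => //= s; rewrite /ball /= distrC => /H h.
  rewrite distrC; apply: le_trans (L2norm_dist mOm (Lgap (Lv s)) (Lgap (Lv t))) _.
  apply: le_trans h; exact: gapL2.
have -> : (fun s => L2dot Om (gap M \o v s) (gap M \o v s)) = (fun s => L2norm Om (gap M \o v s) ^+ 2).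
  by apply/funext => s; rewrite sqr_L2norm.
exact: (cvgM cn cn).
Qed.

(** The energy does not increase at positive times, and it is continuous at time 0,
where it vanishes. *)
Lemma gap_energy_curve t : 0 <= t -> gap_energy Om M (v t) = 0.
Proof.
move=> t0; apply/eqP; rewrite eq_le L2dot_ge0 andbT.
have E0 : E (v 0) = 0.
  rewrite /E /gap_energy; transitivity (L2dot Om (fun=> 0) (gap M \o v 0)); last exact: L2dot0l.
  by apply: eq_L2dot => // x Ox /=; rewrite gap_small// init.
rewrite -[leRHS]E0 -/E.
have mono a b : 0 < a -> a <= b -> E (v b) <= E (v a).
  move=> a0 ab; apply: (@nonincreasing_of_upper_derivate _ (fun t => E (v t))) => // s eta /andP[sa _] eta0.
  by apply: energy_step => //; exact: lt_le_trans sa.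
have [->//|tn0] := eqVneq t 0; have {}t0 : 0 < t by rewrite lt_neqAle eq_sym tn0.
apply/ler_addgt0Pr => e e0.
have := @continuous_energy 0; move=> /cvgrPdist_le/(_ e e0)/nbhs_ballP[d /= d0 H].
pose a := Num.min (d / 2) t.
have a0 : 0 < a by rewrite lt_min t0 divr_gt0.
have ad : a < d by rewrite gt_min ltr_pdivrMr// ltr_pMr// ltr1n.
have at_ : a <= t by rewrite ge_min lexx orbT.
apply: le_trans (mono _ _ a0 at_) _.
have := H a; rewrite /ball /= sub0r normrN gtr0_norm// => /(_ ad).
by rewrite distrC => h; have := le_trans (ler_norm _) h; rewrite lerBlDl.
Qed.

End MaximumPrinciple.

(** * Dissipation of energy *)

Lemma energy_arith (R : realFieldType) (q1 q2 p1 p2 W X Y Z D : R) :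
  q2 - q1 + W <= - D / 2 + X / 2 -> p2 - p1 <= W + Y -> Y <= Z ->
  X <= 4^-1 * D -> Z <= 8^-1 * D -> q2 + p2 <= q1 + p1 - D / 4.
Proof. by move=> *; lra. Qed.

Section Dissipation.
Context {R : realType} (Om : set (R * R)).
Hypothesis oOm : open Om.
Hypothesis bOm : bounded_set Om.
Variables (lambda : nat -> R) (phi : nat -> R * R -> R).
Hypothesis onb : orthonormal_basis Om phi.
Variables (alpha eps : R) (v : R -> R * R -> R) (N F : R -> R) (M L K CF : R).
Let w (s : R) (x : R * R) := N (v s x).
Hypothesis uv : uniform_curve Om v.
Hypothesis uw : uniform_curve Om w.

Let mOm : measurable Om. Proof. exact: open_measurable2. Qed.
Let finOm : (leb2 Om < +oo)%E. Proof. exact: finite_domain. Qed.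
Let Lphi k : L2 Om (phi k). Proof. by case: onb. Qed.
Let Lv s : L2 Om (v s). Proof. exact: uniform_curve_L2. Qed.
Let Lw s : L2 Om (w s). Proof. exact: uniform_curve_L2. Qed.
Let Lc r : L2 Om (fun=> r : R). Proof. exact: L2_cst. Qed.

Let c s k := coef Om phi (v s) k.
Let g s k := coef Om phi (w s) k.
Let nu k := eps ^+ 2 * lambda k `^ alpha.
Let nu0 k : 0 <= nu k. Proof. by rewrite mulr_ge0 ?sqr_ge0 ?powR_ge0. Qed.

Hypothesis ode : forall k (t : R), 0 < t ->
  is_derive t (1 : R) (fun s => c s k) (- (nu k * c t k) - g t k).
Hypothesis M0 : 0 <= M.
Hypothesis vM : forall t x, Om x -> `|v t x| <= M.
Hypothesis L0 : 0 <= L.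
Hypothesis NL : forall a b, `|a| <= M -> `|b| <= M -> `|N a - N b| <= L * `|a - b|.
Hypothesis K0 : 0 <= K.
Hypothesis cF : continuous F.
Hypothesis FN : forall a b, `|a| <= M -> `|b| <= M -> F b - F a <= N a * (b - a) + K * (b - a) ^+ 2.
Hypothesis FC : forall a, `|a| <= M -> `|F a| <= CF.
Hypothesis vH : forall t, 0 < t -> Halpha Om lambda phi alpha (v t).

Let en n t := \sum_(k < n) nu k * c t k ^+ 2 / 2.
Definition quadratic_energy t := limn (fun n => en n t).
Definition potential_energy t : R := (\int[leb2]_(x in Om) F (v t x))%R.
Definition total_energy t := quadratic_energy t + potential_energy t.

Lemma quadratic_energy_cvg t : 0 < t -> (fun n => en n t) @ \oo --> quadratic_energy t.
Proof.
move=> /vH[_ H].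
suff : cvgn (fun n => en n t) by [].
have -> : (fun n => en n t) = (fun n => eps ^+ 2 / 2 * series (fun k => lambda k `^ alpha * `|coef Om phi (v t) k| ^+ 2) n).
  apply/funext => n; rewrite /en /series /= big_mkord mulr_sumr; apply: eq_bigr => k _.
  rewrite real_normK ?num_real// /nu /c.
  by move: (lambda k `^ alpha) (coef Om phi (v t) k) => X Y; field.
by apply: is_cvgM; [exact: is_cvg_cst|exact: H].
Qed.

Lemma truncated_energy_le t n : 0 < t -> en n t <= quadratic_energy t.
Proof.
move=> t0; apply: (cvgn_ge (quadratic_energy_cvg t0) (N := n)) => m nm.
rewrite /en -(subnKC nm) big_split_ord /= lerDl sumr_ge0// => i _.
by rewrite divr_ge0// mulr_ge0// sqr_ge0.
Qed.

Lemma quadratic_energy_ge0 t : 0 < t -> 0 <= quadratic_energy t.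
Proof. by move=> t0; have := truncated_energy_le 0 t0; rewrite /en big_ord0. Qed.

Let IF t : leb2.-integrable Om (EFin \o (fun x => F (v t x))).
Proof.
have LF : L2 Om (fun x => F (v t x)).
  apply: (L2_bounded mOm finOm (C := CF)); last by move=> x Ox; apply: FC; exact: vM.
  have [mv _ _] := uv t.
  by apply: measurableT_comp mv; exact: continuous_measurable_fun.
have I := L2M_integrable mOm LF (Lc 1).
by apply: eq_integrable I => // x _; rewrite /= mulr1.
Qed.

Let vol : R := L2dot Om (fun=> 1) (fun=> 1).

Lemma potential_energy_ge t : - (CF * vol) <= potential_energy t.
Proof.
have -> : - (CF * vol) = (\int[leb2]_(x in Om) (- CF * 1 * 1))%R.
  rewrite /vol -mulNr; have -> : - CF * L2dot Om (fun=> 1) (fun=> 1) = L2dot Om (fun=> - CF * 1) (fun=> 1) by rewrite L2dotZl.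
  by [].
apply: le_Rintegral => //; first exact: (L2M_integrable mOm (Lc (- CF * 1)) (Lc 1)).
move=> x Ox; rewrite !mulr1; have := FC (vM t Ox); rewrite ler_norml => /andP[]//.
Qed.

Lemma potential_energy_sub_le s t :
  potential_energy s - potential_energy t <=
  L2dot Om (w t) (fun x => v s x - v t x) +
  K * L2dot Om (fun x => v s x - v t x) (fun x => v s x - v t x).
Proof.
have LD : L2 Om (fun x => v s x - v t x) by exact: L2B.
have -> : K * L2dot Om (fun x => v s x - v t x) (fun x => v s x - v t x) =
   L2dot Om (fun x => K * (v s x - v t x)) (fun x => v s x - v t x) by rewrite L2dotZl.
have LKD : L2 Om (fun x => K * (v s x - v t x)) by exact: L2Z.
have I1 := L2M_integrable mOm (Lw t) LD; have I2 := L2M_integrable mOm LKD LD.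
rewrite /potential_energy /L2dot -RintegralB// -RintegralD//.
have J1 : leb2.-integrable Om (EFin \o (fun x => F (v s x) - F (v t x))) by exact: (@integrableB _ _ _ leb2 Om mOm (EFin \o (fun x => F (v s x))) (EFin \o (fun x => F (v t x)))).
have J2 : leb2.-integrable Om (EFin \o (fun x => w t x * (v s x - v t x) + K * (v s x - v t x) * (v s x - v t x))).
  by exact: (@integrableD _ _ _ leb2 Om mOm (EFin \o (fun x => w t x * (v s x - v t x))) (EFin \o (fun x => K * (v s x - v t x) * (v s x - v t x)))).
apply: le_Rintegral => //.
move=> x Ox; apply: le_trans (FN (vM t Ox) (vM s Ox)) _.
by rewrite expr2 mulrA.
Qed.

Let dc k s := - (nu k * c s k) - g s k.

Let continuous_c k : continuous (fun s => c s k).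
Proof. exact: (uniform_curve_dot oOm bOm uv (Lphi k)). Qed.
Let continuous_g k : continuous (fun s => g s k).
Proof. exact: (uniform_curve_dot oOm bOm uw (Lphi k)). Qed.

(** The dissipation of one mode is kept as a primitive, which avoids exchanging sums
over modes with integrals in time. *)
Let speed_primitive : exists S : nat -> R -> R, forall k (x : R), 0 < x ->
  is_derive x (1 : R) (S k) (dc k x ^+ 2).
Proof.
suff /choice[S HS] : forall k, exists Sk : R -> R, forall x : R, 0 < x -> is_derive x (1 : R) Sk (dc k x ^+ 2).
  by exists S.
move=> k.
have cf : continuous (fun x => dc k x ^+ 2).
  move=> x; have cd : {for x, continuous (dc k)}.
    apply: (@continuousB _ _ _ (fun s => - (nu k * c s k)) (fun s => g s k)); last exact: continuous_g.
    apply: (@continuousN _ _ _ (fun s => nu k * c s k)).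
    by apply: (@continuousM _ _ (fun=> nu k) (fun s => c s k)); [exact: cvg_cst|exact: continuous_c].
  exact: (continuousM cd cd).
by have [S [dS _]] := primitive_from 0 cf; exists S.
Qed.

Section Window.
Variables (S : nat -> R -> R) (t delta : R).
Hypothesis dS : forall k (x : R), 0 < x -> is_derive x (1 : R) (S k) (dc k x ^+ 2).
Hypothesis t0 : 0 < t.
Hypothesis delta0 : 0 < delta.

Let d k := S k (t + delta) - S k t.
Let S_mono k x y : t <= x -> x <= y -> S k x <= S k y.
Proof.
move=> tx xy; apply: (nondecreasing_of_derive xy (s := fun z => dc k z ^+ 2)) => z /andP[xz _].
  by apply: dS; apply: lt_le_trans t0 _; exact: le_trans xz.
exact: sqr_ge0.
Qed.
Let d0 k : 0 <= d k. Proof. by rewrite subr_ge0 S_mono// lerDl ltW. Qed.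

(** The derivative of e_n + <h, c> + (dissipation) / 2 is
- |c'|^2 / 2 - <g - h, c'>, at most |g - h|^2 / 2. The choice h = 0 shows that
the dissipation is finite. The choice h = g t leaves an error controlled by the
displacement during the window. *)
Let truncated_balance n (h : nat -> R) (B : R) :
  (forall s, t <= s <= t + delta -> \sum_(k < n) (g s k - h k) ^+ 2 <= B) ->
  en n (t + delta) - en n t + \sum_(k < n) h k * (c (t + delta) k - c t k) <=
  - (\sum_(k < n) d k) / 2 + B * delta / 2.
Proof.
move=> HB.
pose Z s := \sum_(k < n) (- (nu k * c s k ^+ 2 / 2) - h k * c s k - S k s / 2).
have dZ s : t <= s <= t + delta -> is_derive s (1 : R) (fun s => Z s + B / 2 * s)
   (\sum_(k < n) (dc k s ^+ 2 / 2 + (g s k - h k) * dc k s) + B / 2).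
  move=> /andP[ts _]; have s0 := lt_le_trans t0 ts.
  have HS := @is_derive_sum_lt R n (fun k s => - (nu k * c s k ^+ 2 / 2) - h k * c s k - S k s / 2)
     (fun k s => dc k s ^+ 2 / 2 + (g s k - h k) * dc k s) s _.
  have HZ := is_deriveD (HS _) (is_deriveZ (B / 2) (is_derive_id s (1 : R))).
  apply: (is_derive_eq (HZ _)); last by rewrite /GRing.scale /= mulr1.
  move=> k; have D1 := ode k s0.
  have D2 : is_derive s (1 : R) (fun s => c s k * c s k) (c s k * dc k s + c s k * dc k s).
    exact: (is_deriveM D1 D1).
  have D3 := is_deriveB (is_deriveB (is_deriveZ (- (nu k / 2)) D2) (is_deriveZ (h k) D1)) (is_deriveZ (2^-1) (dS k s0)).
  have -> : (fun s => - (nu k * c s k ^+ 2 / 2) - h k * c s k - S k s / 2) =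
     (- (nu k / 2) *: (fun s => c s k * c s k) - h k *: (fun s => c s k)) - 2^-1 *: S k.
    by apply/funext => x; rewrite !fctE /GRing.scale /= expr2; field.
  apply: (is_derive_eq D3); rewrite /GRing.scale /= /dc.
  by move: (c s k) (g s k) (nu k) (h k) => *; field.
have tt : t <= t + delta by rewrite lerDl ltW.
have pos s : t <= s <= t + delta -> 0 <= \sum_(k < n) (dc k s ^+ 2 / 2 + (g s k - h k) * dc k s) + B / 2.
  move=> /HB h1.
  have : - \sum_(k < n) (g s k - h k) ^+ 2 / 2 <= \sum_(k < n) (dc k s ^+ 2 / 2 + (g s k - h k) * dc k s).
    rewrite -sumrN; apply: ler_sum => k _.
    by have := sqr_ge0 (dc k s + (g s k - h k)); move: (dc k s) (g s k - h k) => X Y; nra.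
  by move: h1; rewrite -mulr_suml; move: (\sum_(k < n) (g s k - h k) ^+ 2) (\sum_(k < n) _) => X Y; lra.
have := nondecreasing_of_derive tt dZ pos.
have ZE : Z (t + delta) - Z t = - (en n (t + delta) - en n t) -
    \sum_(k < n) h k * (c (t + delta) k - c t k) - (\sum_(k < n) d k) / 2.
  rewrite /Z /en mulr_suml -!sumrB -sumrN -!sumrB; apply: eq_bigr => k _; rewrite /d.
  by move: (c (t + delta) k) (c t k) => *; field.
rewrite mulrDr; move: ZE.
move: (Z t) (Z (t + delta)) (en n t) (en n (t + delta)) (\sum_(k < n) _) (\sum_(k < n) d k) => *.
by nra.
Qed.

Let reaction_bound : exists G : R, forall s n, \sum_(k < n) (g s k - 0) ^+ 2 <= G.
Proof.
exists (L2dot Om (fun=> `|N 0| + L * M) (fun=> `|N 0| + L * M)) => s n.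
under eq_bigr do rewrite subr0.
apply: le_trans (bessel mOm onb n (Lw s)) _; apply: L2dot_le => // x Ox.
rewrite [leRHS]ger0_norm ?addr_ge0 ?mulr_ge0//.
have := ler_normD (N (v s x) - N 0) (N 0); rewrite subrK => h1.
have h2 := NL (vM s Ox) (_ : `|0| <= M); rewrite normr0 subr0 in h2.
have h3 : L * `|v s x| <= L * M by rewrite ler_wpM2l// vM.
apply: (le_trans h1); rewrite addrC lerD2l; apply: le_trans h3; exact: h2.
Qed.

Let increments_cvg : cvgn (fun n => \sum_(k < n) d k).
Proof.
have [G HG] := reaction_bound.
apply: nondecreasing_is_cvgn.
  apply/nondecreasing_seqP => n; rewrite big_ord_recr lerDl; exact: d0.
exists (2 * quadratic_energy t + G * delta) => _ [n _ <-].
have := @truncated_balance n (fun=> 0) G (fun s _ => HG s n).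
have h1 := truncated_energy_le n t0.
have h2 : 0 <= en n (t + delta).
  by apply: sumr_ge0 => k _; rewrite divr_ge0// mulr_ge0// sqr_ge0.
under eq_bigr do rewrite mul0r; rewrite big1//.
by move: h1 h2; move: (en n t) (en n _) (\sum_(k < n) _) (quadratic_energy t) (G * delta) => *; lra.
Qed.

Let D := limn (fun n => \sum_(k < n) d k).
Let D_ge n : \sum_(k < n) d k <= D.
Proof.
apply: (cvgn_ge increments_cvg (N := n)) => m nm.
by rewrite -(subnKC nm) big_split_ord /= lerDl sumr_ge0.
Qed.

Let displacement s : t <= s <= t + delta ->
  L2dot Om (fun x => v s x - v t x) (fun x => v s x - v t x) <= delta * D.
Proof.
move=> /andP[ts st].
have LD : L2 Om (fun x => v s x - v t x) by exact: L2B.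
apply: (cvgn_le (parseval_norm mOm onb LD) (N := 0)) => n _.
apply: (@le_trans _ _ (\sum_(k < n) delta * d k)); last by rewrite -mulr_sumr ler_wpM2l ?(ltW delta0).
apply: ler_sum => k _.
have -> : coef Om phi (fun x => v s x - v t x) k = c s k - c t k by rewrite /coef L2dotBl.
apply: (@le_trans _ _ ((s - t) * (S k s - S k t))).
  apply: (@sqr_increment_le _ (fun s => c s k) (S k) (dc k)) => // x /andP[tx _]; have x0 := lt_le_trans t0 tx.
    exact: ode.
  exact: dS.
apply: ler_pM; rewrite ?subr_ge0//; first exact: S_mono.
  by rewrite lerBlDl.
by rewrite /d lerD2r S_mono.
Qed.

(** D is the total dissipation, the sum over all modes of the integrals of c_k'^2.
By Cauchy-Schwarz it controls the displacement during the window. Both the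
variation of the reaction term and the second order term of the potential energy
are then small multiples of D when the window is short, and do not offset the
decrease of the energy. *)
Lemma window_dissipation : L ^+ 2 * delta ^+ 2 <= 4^-1 -> K * delta <= 8^-1 ->
  exists D : R, [/\ 0 <= D, total_energy (t + delta) <= total_energy t - D / 4 &
    forall s, t <= s <= t + delta ->
      L2dot Om (fun x => v s x - v t x) (fun x => v s x - v t x) <= delta * D].
Proof.
move=> hL hK; exists D.
have D0 : 0 <= D by have := D_ge 0; rewrite big_ord0.
split => //.
have HB n s : t <= s <= t + delta -> \sum_(k < n) (g s k - g t k) ^+ 2 <= L ^+ 2 * (delta * D).
  move=> sI; have LD : L2 Om (fun x => v s x - v t x) by exact: L2B.
  have LwD : L2 Om (fun x => w s x - w t x) by exact: L2B.
  apply: (@le_trans _ _ (L2dot Om (fun x => w s x - w t x) (fun x => w s x - w t x))).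
    apply: le_trans (bessel mOm onb n LwD); apply: ler_sum => k _.
    by rewrite /coef L2dotBl.
  apply: (@le_trans _ _ (L2dot Om (fun x => L * (v s x - v t x)) (fun x => L * (v s x - v t x)))).
    apply: L2dot_le => //; first exact: L2Z.
    by move=> x Ox; rewrite normrM (ger0_norm L0); apply: NL; exact: vM.
  rewrite L2dotZl//; last exact: L2Z.
  by rewrite L2dotZr// mulrA -expr2 ler_wpM2l ?sqr_ge0// displacement.
have td0 : 0 < t + delta by rewrite addr_gt0.
have LD : L2 Om (fun x => v (t + delta) x - v t x) by exact: L2B.
have lim1 := cvgB (quadratic_energy_cvg td0) (quadratic_energy_cvg t0).
have lim2 := parseval mOm onb (Lw t) LD.
have lim3 : (fun n => - (\sum_(k < n) d k) / 2 + L ^+ 2 * (delta * D) * delta / 2) @ \oo -->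
   - D / 2 + L ^+ 2 * (delta * D) * delta / 2.
  by apply: cvgD; [apply: cvgMl; apply: cvgN; exact: increments_cvg|exact: cvg_cst].
have key : quadratic_energy (t + delta) - quadratic_energy t +
   L2dot Om (w t) (fun x => v (t + delta) x - v t x) <= - D / 2 + L ^+ 2 * (delta * D) * delta / 2.
  have lim4 : (fun n => (- (\sum_(k < n) d k) / 2 + L ^+ 2 * (delta * D) * delta / 2) -
      (en n (t + delta) - en n t + \sum_(k < n) coef Om phi (w t) k * coef Om phi (fun x => v (t + delta) x - v t x) k)) @ \oo -->
      (- D / 2 + L ^+ 2 * (delta * D) * delta / 2) - (quadratic_energy (t + delta) - quadratic_energy t +
      L2dot Om (w t) (fun x => v (t + delta) x - v t x)).
    apply: cvgB; [exact: lim3|apply: cvgD; [|exact: lim2]].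
    exact: lim1.
  rewrite -subr_ge0; apply: (cvgn_ge lim4 (N := 0)) => n _; rewrite subr_ge0.
  apply: le_trans (truncated_balance (HB n)).
  rewrite lerD2l le_eqVlt; apply/orP; left; apply/eqP; apply: eq_bigr => k _.
  by rewrite /coef L2dotBl.
have pot := potential_energy_sub_le (t + delta) t.
have disp := @displacement (t + delta) _; rewrite lexx lerDl (ltW delta0) in disp.
have disp' := ler_wpM2l K0 (disp isT).
have h1 : L ^+ 2 * (delta * D) * delta <= 4^-1 * D.
  have -> : L ^+ 2 * (delta * D) * delta = L ^+ 2 * delta ^+ 2 * D by ring.
  by rewrite ler_wpM2r.
have h2 : K * (delta * D) <= 8^-1 * D by rewrite mulrA ler_wpM2r.
rewrite /total_energy.
exact: energy_arith key pot disp' h1 h2.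
Qed.

End Window.

Section Decay.
Variable delta : R.
Hypothesis delta0 : 0 < delta.
Hypothesis hL : L ^+ 2 * delta ^+ 2 <= 4^-1.
Hypothesis hK : K * delta <= 8^-1.

Lemma dissipation t d : 0 < t -> 0 < d <= delta -> exists2 D : R, 0 <= D &
  total_energy (t + d) <= total_energy t - D / 4 /\
  forall s, t <= s <= t + d ->
    L2dot Om (fun x => v s x - v t x) (fun x => v s x - v t x) <= delta * D.
Proof.
move=> t0 /andP[d0 dd]; have [S dS] := speed_primitive.
have hL' : L ^+ 2 * d ^+ 2 <= 4^-1.
  by apply: le_trans hL; rewrite ler_wpM2l ?sqr_ge0// lerXn2r ?nnegrE ?(ltW d0)// ltW.
have hK' : K * d <= 8^-1 by apply: le_trans hK; rewrite ler_wpM2l.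
have [D [D0 DE disp]] := window_dissipation dS t0 d0 hL' hK'.
exists D => //; split => // s sI; apply: le_trans (disp s sI) _.
by rewrite ler_wpM2r.
Qed.

Lemma total_energy_nonincreasing s t : 0 < s -> s <= t -> total_energy t <= total_energy s.
Proof.
move=> s0 st.
(* The interval is cut into m windows that are short enough. *)
pose m := (Num.truncn ((t - s) / delta)).+1.
have mm : (t - s) / delta < m%:R by exact: truncnS_gt.
pose d := (t - s) / m%:R.
have m0 : (0 : R) < m%:R by rewrite ltr0n.
have [->//|ts] := eqVneq t s.
have st' : 0 < t - s by rewrite subr_gt0 lt_neqAle eq_sym ts.
have d0 : 0 < d by rewrite divr_gt0.
have dd : d <= delta by rewrite ler_pdivrMr// mulrC -ler_pdivrMr// ltW.
have step j : total_energy (s + j%:R * d) <= total_energy s.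
  elim: j => [|j IH]; first by rewrite mul0r addr0.
  have sj : 0 < s + j%:R * d by rewrite ltr_wpDr// mulr_ge0// ltW.
  have [|D D0 [h _]] := @dissipation (s + j%:R * d) d sj; first by rewrite d0.
  rewrite -natr1 mulrDl mul1r addrA; apply: le_trans IH; apply: le_trans h _.
  by rewrite gerBl divr_ge0.
have := step m; rewrite /d mulrC divfK ?gt_eqF//.
by rewrite addrC subrK.
Qed.

Lemma quadratic_energy_bounded : exists B : R, forall t, 1 <= t -> quadratic_energy t <= B.
Proof.
exists (total_energy 1 + CF * vol) => t t1.
have := total_energy_nonincreasing ltr01 t1; have := potential_energy_ge t.
rewrite /total_energy; move: (quadratic_energy t) (potential_energy t) (CF * vol) => *; lra.
Qed.

(** The energy is nonincreasing and bounded below: what it loses during a window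
tends to 0, and this loss controls the displacement. *)
Lemma displacement_decay (e : R) : 0 < e -> exists2 T : R, 0 < T & forall t s, T <= t ->
  t <= s <= t + delta -> L2norm Om (fun x => v s x - v t x) <= e.
Proof.
move=> e0.
pose A := [set total_energy t | t in [set t : R | 0 < t]].
have hA : has_inf A.
  split; first by exists (total_energy 1); exists 1 => //=; exact: ltr01.
  exists (- (CF * vol)) => _ [t t0 <-]; rewrite /total_energy.
  have := quadratic_energy_ge0 t0; have := potential_energy_ge t.
  move: (quadratic_energy t) (potential_energy t) (CF * vol) => *; lra.
pose r := e ^+ 2 / (4 * delta).
have r0 : 0 < r by rewrite divr_gt0 ?exprn_gt0// mulr_gt0.
have [_ [T T0 <-] HT] := inf_adherent r0 hA.
exists T => // t s Tt sI; have t0 : 0 < t := lt_le_trans T0 Tt.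
have dI : 0 < delta <= delta by rewrite delta0 lexx.
have [D D0 [h /(_ s sI) disp]] := dissipation t0 dI.
have h1 := total_energy_nonincreasing T0 Tt.
have h2 : inf A <= total_energy (t + delta).
  by apply: ge_inf; [case: hA|exists (t + delta) => //=; rewrite addr_gt0].
have h3 : D <= 4 * r.
  move: h h1 h2 HT; move: (total_energy _) (total_energy _) (total_energy _) (inf A) => *; lra.
rewrite -(@ler_pXn2r _ 2)// ?nnegrE ?L2norm_ge0 ?(ltW e0)// sqr_L2norm.
apply: le_trans disp _; apply: le_trans (ler_wpM2l (ltW delta0) h3) _.
rewrite /r le_eqVlt; apply/orP; left; apply/eqP; field.
by rewrite gt_eqF.
Qed.

End Decay.
End Dissipation.

(** * Continuous functions that vanish almost everywhere *)

Section OpenSets.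
Context {R : realType} (Om : set (R * R)).
Hypothesis oOm : open Om.
Hypothesis bOm : bounded_set Om.
Let mOm : measurable Om. Proof. exact: open_measurable2. Qed.

Lemma leb2_box_gt0 (q : (R * R) * (R * R)) : q.1.1 < q.1.2 -> q.2.1 < q.2.2 -> (0 < leb2 (box q))%E.
Proof.
have E (a b : R) : a < b -> (0 < @lebesgue_measure R `]a, b[%classic)%E.
  by move=> ab; rewrite lebesgue_measure_itv /= lte_fin ab -EFinB lte_fin subr_gt0.
move=> h1 h2; rewrite /leb2 /box product_measure1E; try exact: measurable_itv.
by apply: mule_gt0; exact: E.
Qed.

(** A nonempty open set contains a box, which is not negligible. *)
Lemma continuous_ae0 f : {in Om, continuous f} -> L2 Om f -> L2norm Om f = 0 ->
  forall x, Om x -> f x = 0.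
Proof.
move=> cf Lf f0 x Ox; apply/eqP/negPn/negP => fx.
have [A [mA A0 HA]] := L2norm_eq0_ae mOm Lf f0.
have nb : \forall y \near x, Om y /\ f y != 0.
  near=> y; split; near: y; first exact: open_nbhs_nbhs.
  have := cf x; rewrite inE => /(_ Ox) cx.
  by apply: (cx [set r | r != 0]); apply: open_nbhs_nbhs; split => //; exact: open_neq.
move: nb => /nbhs_ballP[e /= e0 He].
pose q := ((x.1 - e, x.1 + e), (x.2 - e, x.2 + e)).
have : (leb2 (box q) <= leb2 A)%E.
  apply: le_measure; rewrite ?inE//; first exact: measurable_box.
  move=> y [/=]; rewrite !in_itv /= => /andP[? ?] /andP[? ?]; apply: HA => /=.
  have [Oy fy] : Om y /\ f y != 0.
    by apply: He; split; rewrite /ball /= ltr_norml; apply/andP; split; lra.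
  by move=> /(_ Oy) fy0; move: fy; rewrite fy0 eqxx.
rewrite A0 leNgt leb2_box_gt0//= ltrD2l; lra.
Unshelve. all: by end_near. Qed.

End OpenSets.

(** * Relative compactness *)

Section SequenceCompactness.
Context {R : realType}.

(** The sequence has a cluster point in the compact product of the intervals
[-B, B]. A term close to it in the first j coordinates is then picked beyond each
rank j. *)
Lemma cluster_coordinates (B : R) (a : nat -> nat -> R) : (forall j k, `|a j k| <= B) ->
  exists (c : nat -> R) (m : nat -> nat), (forall j, (j <= m j)%N) /\
    forall k, (fun j => a (m j) k) @ \oo --> c k.
Proof.
move=> aB.
pose X := prod_topology (fun _ : nat => R).
pose K : set X := [set f | forall k, `[- B, B]%classic (f k)].
have cK : compact K by exact: (@tychonoff nat (fun=> R) (fun=> `[- B, B]%classic) (fun=> @segment_compact R (- B) B)).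
pose G : set_system X := (fun j => a j : X) @ \oo.
have GK : G K by exists 0%N => // j _ k /=; rewrite in_itv /= -ler_norml.
have [c [_ cl]] := cK G _ GK.
have near_c (j : nat) : nbhs (c : X) [set f : X | forall k, (k < j)%N -> `|f k - c k| <= j.+1%:R^-1].
  have e0 : 0 < (j.+1%:R^-1 : R) by rewrite invr_gt0.
  move: (j.+1%:R^-1 : R) e0 => e e0.
  elim: j => [|j IH]; first by apply: filterE.
  have H : nbhs (c : X) [set f : X | `|f j - c j| <= e].
    have H := @proj_continuous nat (fun=> R) j c.
    apply: (H [set r : R | `|r - c j| <= e]); apply/nbhs_ballP; exists e => // r.
    by rewrite /ball /= distrC => /ltW.
  apply: filterS2 IH H => f /= h1 h2 k; rewrite ltnS leq_eqVlt => /predU1P[->//|]; exact: h1.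
have pick (j : nat) : exists m : nat, (j <= m)%N /\ forall k, (k < j)%N -> `|a m k - c k| <= j.+1%:R^-1.
  have tailj : G [set a m | m in [set m | (j <= m)%N]].
    by exists j => // m /= jm; exists m.
  have [_ [[m jm <-] Hm]] := cl _ _ tailj (near_c j).
  by exists m.
have /choice[m Hm] := pick.
exists c, m; split => [j|k]; first by case: (Hm j).
apply/cvgn_epsP => e e0.
have /cvgn_epsP/(_ e e0)[n0 Hn0] := @cvg_harmonic R.
exists (maxn n0 k.+1) => n; rewrite geq_max => /andP[nn kn].
have [_ /(_ k kn) h] := Hm n; apply: le_trans h _.
have := Hn0 n nn; rewrite subr0 ger0_norm// /harmonic /= invr_ge0//.
Qed.

Lemma weighted_tail (W d : nat -> R) (La C : R) (J n : nat) : 0 < La -> (forall k, 0 <= W k) ->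
  (forall k, (J <= k)%N -> La <= W k) -> \sum_(k < n) W k * d k ^+ 2 <= C ->
  \sum_(k < n) d k ^+ 2 <= \sum_(k < J) d k ^+ 2 + C / La.
Proof.
move=> La0 W0 WJ HC.
have h1 : \sum_(k < n) d k ^+ 2 <= \sum_(k < n) ((k < J)%N%:R * d k ^+ 2) + (\sum_(k < n) W k * d k ^+ 2) / La.
  rewrite mulr_suml -big_split /=; apply: ler_sum => k _.
  have s0 := sqr_ge0 (d k).
  case: ltnP => kJ /=.
    by rewrite mul1r lerDl divr_ge0 ?(ltW La0)// mulr_ge0.
  rewrite mul0r add0r ler_pdivlMr// mulrC ler_wpM2r// WJ//.
apply: le_trans h1 _; apply: lerD; last by rewrite ler_pM2r ?invr_gt0.
elim: n {HC} => [|n IH]; first by rewrite big_ord0 sumr_ge0// => k _; exact: sqr_ge0.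
have [nJ|Jn] := ltnP n J; last by rewrite big_ord_recr /= ltnNge Jn mul0r addr0.
rewrite -(subnKC nJ) big_split_ord /= -[leLHS]addr0 lerD//; last by rewrite sumr_ge0// => k _; exact: sqr_ge0.
apply: ler_sum => k _; rewrite (leq_trans (ltn_ord k))// ?mul1r//.
by rewrite subnKC// ltnW.
Qed.

End SequenceCompactness.

Section Compactness.
Context {R : realType} (Om : set (R * R)).
Hypothesis oOm : open Om.
Hypothesis bOm : bounded_set Om.
Variables (lambda : nat -> R) (phi : nat -> R * R -> R).
Hypothesis eig : dirichlet_eigenbasis Om lambda phi.
Variable alpha : R.
Hypothesis al0 : 0 < alpha.

Let mOm : measurable Om. Proof. exact: open_measurable2. Qed.
Let finOm : (leb2 Om < +oo)%E. Proof. exact: finite_domain. Qed.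
Let onb : orthonormal_basis Om phi. Proof. by case: eig. Qed.

Let weight_unbounded (La : R) : 0 <= La -> exists J, forall k, (J <= k)%N -> La <= lambda k `^ alpha.
Proof.
move=> La0; have [J HJ] := eigenvalue_unbounded oOm bOm eig (La `^ alpha^-1).
exists J => k /HJ h.
have -> : La = (La `^ alpha^-1) `^ alpha by rewrite -powRrM mulVf ?gt_eqF// powRr1.
by apply: ge0_ler_powR; rewrite ?nnegrE ?powR_ge0 ?(ltW al0)// ?(ltW h)// (eigenvalue_ge0 eig).
Qed.

(** Coordinatewise convergence holds along a subsequence. It is convergence in L2,
because the weighted sums are bounded and the weights tend to infinity, which
makes the tails uniformly small. *)
Lemma relative_compactness (f : nat -> R * R -> R) (B B' : R) : (forall j, L2 Om (f j)) ->
  (forall j, L2dot Om (f j) (f j) <= B) ->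
  (forall j n, \sum_(k < n) lambda k `^ alpha * coef Om phi (f j) k ^+ 2 <= B') ->
  exists (m : nat -> nat) y, [/\ forall j, (j <= m j)%N, L2 Om y & L2cvg Om (fun j => f (m j)) y].
Proof.
move=> Lf fB fB'.
have coefB j k : `|coef Om phi (f j) k| <= B + 1.
  have : coef Om phi (f j) k ^+ 2 <= B.
    apply: le_trans (fB j); apply: le_trans (bessel mOm onb k.+1 (Lf j)).
    by rewrite big_ord_recr /= lerDr sumr_ge0// => i _; exact: sqr_ge0.
  by rewrite -real_normK ?num_real//; move: (`|_|) => x; nra.
have [c [m [mj cc]]] := cluster_coordinates coefB.
have cB n : \sum_(k < n) c k ^+ 2 <= B.
  apply: (@cvgn_le _ (fun j => \sum_(k < n) coef Om phi (f (m j)) k ^+ 2) _ _ 0).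
    by apply: (@cvg_sum_lt R n (fun j k => coef Om phi (f (m j)) k ^+ 2) (fun k => c k ^+ 2)) => k _; exact: cvgM.
  by move=> j _; apply: le_trans (fB (m j)); exact: bessel.
have cB' n : \sum_(k < n) lambda k `^ alpha * c k ^+ 2 <= B'.
  apply: (@cvgn_le _ (fun j => \sum_(k < n) lambda k `^ alpha * coef Om phi (f (m j)) k ^+ 2) _ _ 0).
    apply: (@cvg_sum_lt R n (fun j k => lambda k `^ alpha * coef Om phi (f (m j)) k ^+ 2) (fun k => lambda k `^ alpha * c k ^+ 2)) => k _.
    by apply: cvgMr; exact: cvgM.
  by move=> j _; exact: fB'.
have [y [Ly cy]] := riesz_fischer mOm finOm onb cB.
have yc k : coef Om phi y k = c k by exact: (coef_L2cvg mOm onb k Ly cy).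
exists m, y; split => //.
have B'0 : 0 <= B' by have := cB' 0%N; rewrite big_ord0.
apply/cvgn_epsP => e e0.
(* The weighted sum of the differences is at most 4 B', so that the tail is at most e^2 / 2. *)
pose La := 8 * (B' + 1) / e ^+ 2.
have e20 : 0 < e ^+ 2 by rewrite exprn_gt0.
have B'1 : 0 < B' + 1 by rewrite ltr_wpDl.
have La0 : 0 < La by rewrite divr_gt0// mulr_gt0.
have [J HJ] := weight_unbounded (ltW La0).
have low : (fun j => \sum_(k < J) (coef Om phi (f (m j)) k - c k) ^+ 2) @ \oo --> (0 : R).
  rewrite [X in _ --> X](_ : 0 = \sum_(k < J) 0); last by rewrite big1.
  apply: (@cvg_sum_lt R J (fun j k => (coef Om phi (f (m j)) k - c k) ^+ 2) (fun k => 0)) => k _.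
  rewrite -(mulr0 (0 : R)); apply: cvgM; rewrite -(subrr (c k)); apply: cvgB => //; exact: cvg_cst.
have e22 : 0 < e ^+ 2 / 2 by rewrite divr_gt0.
have /cvgn_epsP/(_ _ e22)[n0 Hn0] := low.
exists n0 => j jn; rewrite subr0 ger0_norm ?L2norm_ge0//.
rewrite -(@ler_pXn2r _ 2)// ?nnegrE ?L2norm_ge0 ?(ltW e0)// sqr_L2norm.
have LD : L2 Om (fun x => f (m j) x - y x) by exact: L2B.
apply: (cvgn_le (parseval_norm mOm onb LD) (N := 0)) => n _.
have -> : \sum_(k < n) coef Om phi (fun x => f (m j) x - y x) k ^+ 2 =
    \sum_(k < n) (coef Om phi (f (m j)) k - c k) ^+ 2.
  by apply: eq_bigr => k _; rewrite -yc /coef L2dotBl//; case: onb.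
have W0 k : 0 <= lambda k `^ alpha by exact: powR_ge0.
have H4 : \sum_(k < n) lambda k `^ alpha * (coef Om phi (f (m j)) k - c k) ^+ 2 <= 4 * B'.
  apply: (@le_trans _ _ (\sum_(k < n) (2 * (lambda k `^ alpha * coef Om phi (f (m j)) k ^+ 2) + 2 * (lambda k `^ alpha * c k ^+ 2)))).
    apply: ler_sum => k _; have := W0 k; move: (lambda k `^ alpha) (coef _ _ _ _) (c k) => w a b w0.
    have : 0 <= w * (a + b) ^+ 2 by rewrite mulr_ge0// sqr_ge0.
    by nra.
  rewrite big_split /= -!mulr_sumr; have := fB' (m j) n; have := cB' n.
  by move: (\sum_(k < n) _) (\sum_(k < n) _) => *; lra.
apply: le_trans (weighted_tail (d := fun k => coef Om phi (f (m j)) k - c k) La0 W0 HJ H4) _.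
have := Hn0 j jn; rewrite subr0 => /(le_trans (ler_norm _)) h.
have h2 : 4 * B' / La <= e ^+ 2 / 2.
  rewrite ler_pdivrMr// /La.
  have -> : e ^+ 2 / 2 * (8 * (B' + 1) / e ^+ 2) = 4 * (B' + 1) by field; rewrite gt_eqF.
  by lra.
by move: h h2; move: (\sum_(k < J) _) (4 * B' / La) (e ^+ 2) => *; lra.
Qed.

End Compactness.

(** * Stationarity of the limit points *)

Lemma half_power (R : realType) (l a : R) : 0 <= l -> l `^ (a / 2) * l `^ (a / 2) = l `^ a.
Proof.
rewrite le_eqVlt => /predU1P[<-|l0].
  have [->|a0] := eqVneq a 0; first by rewrite mul0r powRr0 mul1r.
  by rewrite !powR0 ?mul0r// mulf_neq0// invr_neq0.
by rewrite -powRD ?(gt_eqF l0) ?implybT// -splitr.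
Qed.

Lemma stationary_mode (R : comRingType) (e p P a a' b d A B : R) : p * p = P -> e * P * a + d = 0 ->
  A = p * a' -> a' = a -> B = p * b -> e * (A * B) + d * b = 0.
Proof. by move=> <- h -> -> ->; rewrite -[RHS](mul0r b) -h; ring. Qed.

Lemma L2_ae (R : realType) (Om : set (R * R)) (f h : R * R -> R) : measurable Om ->
  measurable_fun Om f -> L2 Om h -> {ae leb2, forall x, Om x -> f x = h x} -> L2 Om f.
Proof.
move=> mOm mf [mh ih] fh; split => //.
have mf2 : measurable_fun Om (EFin \o (fun x => f x ^+ 2)) by apply/measurable_EFinP; exact: measurable_funX.
have /integrableP[mh2 hoo] := ih.
apply/integrableP; split => //.
have mf3 : measurable_fun Om (fun x => `|(f x ^+ 2)%:E|%E) by exact: measurableT_comp mf2.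
have mh3 : measurable_fun Om (fun x => `|(h x ^+ 2)%:E|%E) by exact: measurableT_comp mh2.
apply: le_lt_trans hoo; rewrite le_eqVlt; apply/orP; left; apply/eqP.
apply: ae_eq_integral => //.
by apply: filterS fh => x H Ox /=; rewrite H.
Qed.

Section Stationarity.
Context {R : realType} (Om : set (R * R)).
Hypothesis oOm : open Om.
Hypothesis bOm : bounded_set Om.
Variables (lambda : nat -> R) (phi : nat -> R * R -> R).
Hypothesis eig : dirichlet_eigenbasis Om lambda phi.
Variables (alpha eps : R) (v : R -> R * R -> R) (N : R -> R) (M L delta B : R).
Let w (s : R) (x : R * R) := N (v s x).
Hypothesis uv : uniform_curve Om v.
Hypothesis uw : uniform_curve Om w.
Hypothesis M0 : 0 <= M.
Hypothesis L0 : 0 <= L.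
Hypothesis cN : continuous N.
Hypothesis NL : forall a b, `|a| <= M -> `|b| <= M -> `|N a - N b| <= L * `|a - b|.
Hypothesis vM : forall t x, Om x -> `|v t x| <= M.

Let mOm : measurable Om. Proof. exact: open_measurable2. Qed.
Let finOm : (leb2 Om < +oo)%E. Proof. exact: finite_domain. Qed.
Let onb : orthonormal_basis Om phi. Proof. by case: eig. Qed.
Let Lphi k : L2 Om (phi k). Proof. by case: onb. Qed.
Let Lv s : L2 Om (v s). Proof. exact: uniform_curve_L2. Qed.
Let Lw s : L2 Om (w s). Proof. exact: uniform_curve_L2. Qed.
Let phi1 k : L2norm Om (phi k) = 1.
Proof. by case: onb => _ o _; rewrite /L2norm o eqxx sqrtr1. Qed.

Let c s k := coef Om phi (v s) k.
Let g s k := coef Om phi (w s) k.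
Let nu k := eps ^+ 2 * lambda k `^ alpha.

Hypothesis ode : forall k (t : R), 0 < t ->
  is_derive t (1 : R) (fun s => c s k) (- (nu k * c t k) - g t k).
Hypothesis delta0 : 0 < delta.
Hypothesis decay : forall e : R, 0 < e -> exists2 T : R, 0 < T & forall t s, T <= t ->
  t <= s <= t + delta -> L2norm Om (fun x => v s x - v t x) <= e.
Hypothesis quad : forall t n, 1 <= t -> \sum_(k < n) lambda k `^ alpha * c t k ^+ 2 <= B.

Let coef_le f k : L2 Om f -> `|coef Om phi f k| <= L2norm Om f.
Proof. by move=> Lf; have := L2_CS mOm Lf (Lphi k); rewrite phi1 mulr1. Qed.

Let coefB f h k : L2 Om f -> L2 Om h ->
  coef Om phi f k - coef Om phi h k = coef Om phi (fun x => f x - h x) k.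
Proof. by move=> Lf Lh; rewrite /coef L2dotBl. Qed.

Section OmegaLimit.
Variables (y : R * R -> R) (s : nat -> R).
Hypothesis Ly : L2 Om y.
Hypothesis s1 : forall n, 1 <= s n.
Hypothesis soo : forall T, exists n0, forall n, (n0 <= n)%N -> T <= s n.
Hypothesis sy : L2cvg Om (fun n => v (s n)) y.

(** The values of y lie in [-M, M] only almost everywhere; the Lipschitz bound on N
applies to its truncation z at all points. *)
Let z x := y x - gap M (y x).

Let zM x : `|z x| <= M.
Proof.
rewrite /z ler_norml; move: (y x) => r; have m0 := M0.
case: (gap_cases r M0) => [[h ->]|[h h' ->]|[h ->]]; apply/andP; split; lra.
Qed.

Let Lz : L2 Om z.
Proof. by apply: L2B => //; exact: (L2_gap oOm M0 Ly). Qed.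

(** The gap of y is controlled by the distance from y to a function bounded by M. *)
Let yz : {ae leb2, forall x, Om x -> y x = z x}.
Proof.
have Lg := L2_gap oOm M0 Ly.
have : L2norm Om (gap M \o y) = 0.
  apply/eqP; rewrite eq_le L2norm_ge0 andbT; apply/ler_addgt0Pr => e e0; rewrite add0r.
  have /cvgn_epsP/(_ e e0)[n0 /(_ n0 (leqnn _))] := sy.
  rewrite subr0 ger0_norm ?L2norm_ge0//; apply: le_trans.
  apply: L2norm_le => //; first exact: L2B.
  move=> x Ox /=; have := gap_lipschitz (v (s n0) x) (y x) M0.
  by rewrite (gap_small M0 (vM (s n0) Ox)) sub0r normrN.
move=> /(L2norm_eq0_ae mOm Lg); apply: filterS => x /= H Ox.
by rewrite /z H// subr0.
Qed.

Let LNz : L2 Om (fun x => N (z x)).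
Proof.
apply: (L2_bounded mOm finOm (C := `|N 0| + L * M)) => [|x Ox].
  apply: measurableT_comp (L2_measurable Lz); exact: continuous_measurable_fun.
have M0' : `|0 : R| <= M by rewrite normr0.
have h1 := NL (zM x) M0'; rewrite subr0 in h1.
have h2 := ler_wpM2l L0 (zM x).
have h3 := ler_normD (N (z x) - N 0) (N 0); rewrite subrK in h3.
by apply: (le_trans h3); rewrite addrC lerD2l; exact: le_trans h1 h2.
Qed.

Let near_z e : 0 < e -> exists n, forall r, s n <= r <= s n + delta ->
  L2norm Om (fun x => v r x - z x) <= e.
Proof.
move=> e0; have e20 : 0 < e / 2 by rewrite divr_gt0.
have [T _ HT] := decay e20; have [n1 Hn1] := soo T.
have /cvgn_epsP/(_ _ e20)[n2 Hn2] := sy.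
exists (maxn n1 n2) => r rI; set n := maxn n1 n2.
have h1 := HT (s n) r (Hn1 _ (leq_maxl _ _)) rI.
have := Hn2 n (leq_maxr _ _); rewrite subr0 ger0_norm ?L2norm_ge0// => h2.
have h3 := L2normB mOm (Lv r) (Lv (s n)) Lz.
have h4 : L2norm Om (fun x => v (s n) x - z x) = L2norm Om (v (s n) \- y).
  have LA : L2 Om (fun x => v (s n) x - z x) by exact: L2B.
  have LB : L2 Om (v (s n) \- y) by exact: L2B.
  have E : {ae leb2, forall x, Om x -> v (s n) x - z x = (v (s n) \- y) x}.
    by move: yz; apply: filterS => x H Ox /=; rewrite H.
  rewrite /L2norm (L2dot_ae_l mOm LA LB LA E) L2dotC (L2dot_ae_l mOm LA LB LB E)//.
by apply: (le_trans h3); rewrite h4 [leRHS]splitr lerD.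
Qed.

(** The coefficient c k hardly varies between s n and s n + delta, so that its
derivative is small at some time r in between. By the differential equation this
derivative is close to the opposite of the left-hand side, since v r is close
to z. *)
Let coef_stationary k : nu k * coef Om phi z k + coef Om phi (fun x => N (z x)) k = 0.
Proof.
set X := _ + _; apply/eqP; rewrite -normr_le0.
pose A := nu k + L + 2 / delta.
have nu0 : 0 <= nu k by rewrite mulr_ge0 ?sqr_ge0 ?powR_ge0.
have A0 : 0 <= A by rewrite !addr_ge0// divr_ge0// ltW.
have XA e : 0 < e -> `|X| <= A * e.
  move=> e0; have [n Hn] := near_z e0.
  have sn0 x : s n <= x -> 0 < x by move=> h; apply: lt_le_trans h; apply: lt_le_trans (s1 n).
  have sd : s n < s n + delta by rewrite ltrDl.
  have dC x : x \in `](s n), (s n + delta)[%R -> is_derive x (1 : R) (fun s => c s k) (- (nu k * c x k) - g x k).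
    by rewrite in_itv /= => /andP[h _]; apply: ode; apply: sn0; exact: ltW.
  have cC : {within `[s n, s n + delta], continuous (fun s => c s k)}.
    by apply: derivable_within_continuous => x; rewrite in_itv /= => /andP[h _]; have [] := ode k (sn0 x h).
  have [r] := MVT sd dC cC.
  rewrite in_itv /= => /andP[sr rs].
  have -> : s n + delta - s n = delta by rewrite addrC addKr.
  move=> E.
  have rI : s n <= r <= s n + delta by rewrite !ltW.
  have cI : s n <= s n <= s n + delta by rewrite lexx ltW.
  have dI : s n <= s n + delta <= s n + delta by rewrite lexx ltW.
  have Lr : L2 Om (fun x => v r x - z x) by exact: L2B.
  have c1 : `|c r k - coef Om phi z k| <= e.
    by rewrite /c coefB//; apply: le_trans (Hn r rI); exact: coef_le.
  have g1 : `|g r k - coef Om phi (fun x => N (z x)) k| <= L * e.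
    rewrite /g coefB//; apply: le_trans (coef_le _ (L2B mOm (Lw r) LNz)) _.
    apply: (@le_trans _ _ (L2norm Om (fun x => L * (v r x - z x)))).
      apply: (L2norm_le mOm (L2B mOm (Lw r) LNz) (L2Z mOm L Lr)) => x Ox.
      by rewrite normrM (ger0_norm L0); apply: NL => //; exact: vM.
    by rewrite (L2normZ mOm)// (ger0_norm L0) ler_wpM2l// Hn.
  have d1 : `|c (s n + delta) k - c (s n) k| <= 2 * e.
    rewrite /c coefB//; apply: le_trans (coef_le _ _) _; first exact: L2B.
    apply: le_trans (L2normB mOm (Lv _) Lz (Lv _)) _.
    rewrite mulr_natl mulr2n lerD ?Hn// (L2norm_sub mOm)// Hn//.
  have XE : X = - (c (s n + delta) k - c (s n) k) / delta - nu k * (c r k - coef Om phi z k)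
      - (g r k - coef Om phi (fun x => N (z x)) k).
    by rewrite E /X; field; rewrite gt_eqF.
  have d2 : `|- (c (s n + delta) k - c (s n) k) / delta| <= 2 / delta * e.
    rewrite normrM normrN (gtr0_norm (_ : 0 < delta^-1)) ?invr_gt0//.
    by rewrite mulrAC ler_pM2r ?invr_gt0.
  have c2 : `|nu k * (c r k - coef Om phi z k)| <= nu k * e.
    by rewrite normrM (ger0_norm nu0) ler_wpM2l.
  rewrite XE; apply: le_trans (ler_normB _ _) _.
  apply: le_trans (lerD (ler_normB _ _) g1) _.
  apply: le_trans (lerD (lerD d2 c2) (lexx _)) _.
  by rewrite /A !mulrDl -[leLHS]addrA [leLHS]addrC.
apply/ler_addgt0Pr => e e0; rewrite add0r.
have A1 : 0 < A + 1 by rewrite ltr_wpDl.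
apply: le_trans (XA (e / (A + 1)) _) _; first by rewrite divr_gt0.
by rewrite mulrCA ger_pMr// ler_pdivrMr// mul1r lerDl.
Qed.

Let coef_yz k : coef Om phi y k = coef Om phi z k.
Proof. exact: (L2dot_ae_l mOm Ly Lz (Lphi k) yz). Qed.

Let y_quad n : \sum_(k < n) lambda k `^ alpha * coef Om phi y k ^+ 2 <= B.
Proof.
apply: (@cvgn_le _ (fun j => \sum_(k < n) lambda k `^ alpha * c (s j) k ^+ 2) _ _ 0).
  apply: (@cvg_sum_lt R n (fun j k => lambda k `^ alpha * c (s j) k ^+ 2) (fun k => lambda k `^ alpha * coef Om phi y k ^+ 2)) => k _.
  have h := L2cvg_dot mOm (fun n => Lv (s n)) Ly (Lphi k) sy.
  by apply: cvgMr; exact: (cvgM h h).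
by move=> j _; exact: quad.
Qed.

Lemma Halpha_of_bounded f C : L2 Om f ->
  (forall n, \sum_(k < n) lambda k `^ alpha * coef Om phi f k ^+ 2 <= C) ->
  Halpha Om lambda phi alpha f.
Proof.
move=> Lf H; split => //.
apply: nondecreasing_is_cvgn.
  apply/nondecreasing_seqP => n; rewrite /series /= big_nat_recr//= lerDl mulr_ge0 ?powR_ge0//.
exists C => _ [n _ <-]; rewrite /series /= big_mkord.
by under eq_bigr do rewrite real_normK ?num_real//.
Qed.

Lemma Halpha_bounded f : Halpha Om lambda phi alpha f ->
  exists C : R, forall n, \sum_(k < n) lambda k `^ alpha * coef Om phi f k ^+ 2 <= C.
Proof.
move=> [Lf H]; exists (limn (series (fun k => lambda k `^ alpha * `|coef Om phi f k| ^+ 2))) => n.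
apply: (cvgn_ge H (N := n)) => m nm.
rewrite /series /= big_mkord -(subnKC nm) big_split_ord /=.
under [X in _ <= X + _]eq_bigr do rewrite real_normK ?num_real//.
by rewrite lerDl sumr_ge0// => i _; rewrite mulr_ge0 ?powR_ge0// exprn_ge0.
Qed.

Hypothesis al0 : 0 < alpha.

Lemma fracLap_half f C : L2 Om f ->
  (forall n, \sum_(k < n) lambda k `^ alpha * coef Om phi f k ^+ 2 <= C) ->
  L2 Om (fracLap Om lambda phi (alpha / 2) f) /\
  forall k, coef Om phi (fracLap Om lambda phi (alpha / 2) f) k = lambda k `^ (alpha / 2) * coef Om phi f k.
Proof.
move=> Lf H; apply: (spectralP (m := fun l => l `^ (alpha / 2)) mOm finOm onb (B := C)) => n.
apply: le_trans (H n); apply: ler_sum => k _.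
by rewrite exprMn [X in X * _ <= _]expr2 half_power// (eigenvalue_ge0 eig).
Qed.

(** By Parseval's formula the weak equation is the sum over k of the equations of
coef_stationary. *)
Lemma omega_limit_stationary : stationary_solution Om lambda phi alpha eps N y.
Proof.
split; first exact: Halpha_of_bounded y_quad.
move=> f Hf; have [Lf _] := Hf; have [C HC] := Halpha_bounded Hf.
have mNy : measurable_fun Om (fun x => N (y x)).
  by apply: measurableT_comp (L2_measurable Ly); exact: continuous_measurable_fun.
have Nyz : {ae leb2, forall x, Om x -> N (y x) = N (z x)}.
  by move: yz; apply: filterS => x H Ox; rewrite H.
have LNy : L2 Om (fun x => N (y x)) := L2_ae mOm mNy LNz Nyz.
have [Lfy cfy] := fracLap_half Ly y_quad; have [Lff cff] := fracLap_half Lf HC.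
split; first exact: L2M_integrable.
have -> : (\int[leb2]_(x in Om) (N (y x) * f x))%R = L2dot Om (fun x => N (z x)) f.
  exact: (L2dot_ae_l mOm LNy LNz Lf Nyz).
have l1 := parseval mOm onb Lfy Lff; have l2 := parseval mOm onb LNz Lf.
have l3 : (fun n => eps ^+ 2 * (\sum_(k < n) coef Om phi (fracLap Om lambda phi (alpha / 2) y) k *
    coef Om phi (fracLap Om lambda phi (alpha / 2) f) k) +
    \sum_(k < n) coef Om phi (fun x => N (z x)) k * coef Om phi f k) @ \oo -->
    eps ^+ 2 * L2dot Om (fracLap Om lambda phi (alpha / 2) y) (fracLap Om lambda phi (alpha / 2) f) +
    L2dot Om (fun x => N (z x)) f.
  by apply: cvgD => //; apply: cvgMr.
have l4 n : eps ^+ 2 * (\sum_(k < n) coef Om phi (fracLap Om lambda phi (alpha / 2) y) k *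
    coef Om phi (fracLap Om lambda phi (alpha / 2) f) k) +
    \sum_(k < n) coef Om phi (fun x => N (z x)) k * coef Om phi f k = 0.
  rewrite mulr_sumr -big_split /= big1// => k _.
  exact: (stationary_mode (half_power alpha (eigenvalue_ge0 eig k)) (coef_stationary k)
    (cfy k) (coef_yz k) (cff k)).
apply/eqP; rewrite eq_le; apply/andP; split.
  by apply: (cvgn_le l3 (N := 0)) => n _; rewrite l4.
by apply: (cvgn_ge l3 (N := 0)) => n _; rewrite l4.
Qed.

End OmegaLimit.
End Stationarity.

(** * The cubic reaction term *)

Section Reaction.
Context {R : realType} (p q : R).
Let N (r : R) := r * (r + p) * (r + q).
Let F (r : R) := r ^+ 4 / 4 + (p + q) * r ^+ 3 / 3 + p * q * r ^+ 2 / 2.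

Lemma cubic_lipschitz (B a b : R) : `|a| <= B -> `|b| <= B ->
  `|N a - N b| <= (3 * B ^+ 2 + 2 * `|p + q| * B + `|p * q|) * `|a - b|.
Proof.
move=> aB bB.
have -> : N a - N b = (a * a + a * b + b * b + (p + q) * (a + b) + p * q) * (a - b) by rewrite /N; ring.
rewrite normrM ler_wpM2r//.
have B0 : 0 <= B := le_trans (normr_ge0 a) aB.
have sq x y : `|x| <= B -> `|y| <= B -> `|x * y| <= B ^+ 2.
  by move=> xB yB; rewrite normrM expr2 ler_pM.
have h1 := sq _ _ aB aB; have h2 := sq _ _ aB bB; have h3 := sq _ _ bB bB.
have h4 : `|(p + q) * (a + b)| <= 2 * `|p + q| * B.
  rewrite normrM [2 * _]mulrC -mulrA ler_wpM2l// mulr_natl mulr2n.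
  by apply: le_trans (ler_normD _ _) _; rewrite lerD.
apply: le_trans (ler_normD _ _) _; rewrite lerD2r.
apply: le_trans (ler_normD _ _) _; apply: lerD h4.
apply: le_trans (ler_normD _ _) _; apply: le_trans (lerD (ler_normD _ _) (lexx _)) _.
by move: h1 h2 h3; move: `|a * a| `|a * b| `|b * b| (B ^+ 2) => *; lra.
Qed.

(** F is a primitive of N, and the constant bounds half of F''. *)
Lemma quartic_tangent (B a b : R) : `|a| <= B -> `|b| <= B ->
  F b - F a <= N a * (b - a) + (3 * B ^+ 2 / 2 + `|p + q| * B + `|p * q|) * (b - a) ^+ 2.
Proof.
move=> aB bB.
have B0 : 0 <= B := le_trans (normr_ge0 a) aB.
pose Z := (b * b + 2 * (a * b) + 3 * (a * a)) / 4 + (p + q) * ((b + 2 * a) / 3) + p * q / 2.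
have -> : F b - F a = N a * (b - a) + Z * (b - a) ^+ 2 by rewrite /N /F /Z; field.
rewrite lerD2l ler_wpM2r ?sqr_ge0// /Z.
have sq x y : `|x| <= B -> `|y| <= B -> x * y <= B ^+ 2.
  by move=> xB yB; apply: le_trans (ler_norm _) _; rewrite normrM expr2 ler_pM.
have h1 := sq _ _ aB aB; have h2 := sq _ _ aB bB; have h3 := sq _ _ bB bB.
have h4 : (p + q) * ((b + 2 * a) / 3) <= `|p + q| * B.
  apply: le_trans (ler_norm _) _; rewrite normrM ler_wpM2l//.
  move: aB bB; rewrite !ler_norml => /andP[? ?] /andP[? ?]; apply/andP; split; lra.
have h5 := ler_norm (p * q); have h6 := normr_ge0 (p * q).
by move: h1 h2 h3 h4 h5 h6; move: (a * a) (a * b) (b * b) (B ^+ 2) (`|p + q| * B) (p * q) `|p * q| ((p + q) * _) => *; lra.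
Qed.

Lemma quartic_bounded (B : R) : exists C : R, forall a, `|a| <= B -> `|F a| <= C.
Proof.
exists (B ^+ 4 / 4 + `|p + q| * B ^+ 3 / 3 + `|p * q| * B ^+ 2 / 2) => a aB.
have e n : `|a ^+ n| <= B ^+ n.
  by rewrite normrX lerXn2r ?nnegrE// (le_trans _ aB).
rewrite /F; apply: le_trans (ler_normD _ _) _; apply: lerD.
  apply: le_trans (ler_normD _ _) _; apply: lerD.
    by rewrite normrM [`|4^-1|]ger0_norm ?invr_ge0// ler_pM2r ?invr_gt0.
  by rewrite 2!normrM [`|3^-1|]ger0_norm ?invr_ge0// ler_pM2r ?invr_gt0// ler_wpM2l.
by rewrite normrM [`|p * q * _|]normrM [`|2^-1|]ger0_norm ?invr_ge0// ler_pM2r ?invr_gt0// ler_wpM2l.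
Qed.

Lemma continuous_cubic : continuous N.
Proof.
have cl (r x : R) : {for x, continuous (fun y : R => y + r)}.
  by apply: continuousD; [exact: cvg_id|exact: cvg_cst].
have ci (x : R) : {for x, continuous (fun y : R => y)} by exact: cvg_id.
by move=> x; exact: (continuousM (continuousM (ci x) (cl p x)) (cl q x)).
Qed.

Lemma continuous_quartic : continuous F.
Proof.
have cX n (x : R) : {for x, continuous (fun y : R => y ^+ n)} by exact: exprn_continuous.
have cc (r x : R) : {for x, continuous (fun=> r)} by exact: cvg_cst.
move=> x; exact: (continuousD (continuousD (continuousM (cX 4%N x) (cc 4^-1 x))
  (continuousM (continuousM (cc (p + q) x) (cX 3%N x)) (cc 3^-1 x)))
  (continuousM (continuousM (cc (p * q) x) (cX 2%N x)) (cc 2^-1 x))).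
Qed.

(** Outside [-M, M] the three factors of N r have the sign of r. *)
Lemma cubic_sign (M r : R) : 0 <= M -> `|p| <= M -> `|q| <= M -> 0 <= gap M r * N r.
Proof.
move=> M0; rewrite !ler_norml => /andP[p1 p2] /andP[q1 q2]; rewrite /N.
have [[h ->]|[h h' ->]|[h ->]] := gap_cases r M0.
- apply: mulr_le0; first by lra.
  by apply: mulr_ge0_le0; [apply: mulr_le0; lra|lra].
- by rewrite mul0r.
- by do ![apply: mulr_ge0]; lra.
Qed.

End Reaction.

(** * Long time behaviour *)

Section CubicFlow.
Context {R : realType} (Om : set (R * R)).
Hypothesis oOm : open Om.
Hypothesis bOm : bounded_set Om.
Variables (lambda : nat -> R) (phi : nat -> R * R -> R).
Hypothesis eig : dirichlet_eigenbasis Om lambda phi.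
Variables (alpha eps p q : R) (u0 : R * R -> R) (u : R -> R * R -> R).
Hypothesis al01 : 0 < alpha < 1.
Hypothesis eps0 : 0 < eps.
Let N (r : R) := r * (r + p) * (r + q).
Let F (r : R) := r ^+ 4 / 4 + (p + q) * r ^+ 3 / 3 + p * q * r ^+ 2 / 2.
Hypothesis hu : global_solution Om lambda phi alpha eps N u0 u.
Hypothesis hmem : forall t, 0 < t -> Halpha Om lambda phi alpha (u t).

Let mOm : measurable Om. Proof. exact: open_measurable2. Qed.
Let onb : orthonormal_basis Om phi. Proof. by case: eig. Qed.
Let v (s : R) := u (Num.max s 0).
Let w (s : R) (x : R * R) := N (v s x).

Let NL (B : R) : exists2 L : R, 0 <= L & forall a b, `|a| <= B -> `|b| <= B -> `|N a - N b| <= L * `|a - b|.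
Proof.
exists (3 * `|B| ^+ 2 + 2 * `|p + q| * `|B| + `|p * q|).
  by rewrite !addr_ge0 ?mulr_ge0// exprn_ge0.
by move=> a b aB bB; apply: cubic_lipschitz; exact: le_trans (ler_norm B).
Qed.

Let cN : continuous N. Proof. exact: continuous_cubic. Qed.
Let uv : uniform_curve Om v. Proof. exact: (solution_uniform_curve oOm bOm hu). Qed.
Let uw : uniform_curve Om w. Proof. exact: (reaction_uniform_curve oOm bOm cN NL hu). Qed.
Let ode k (t : R) : 0 < t ->
  is_derive t (1 : R) (fun s => coef Om phi (v s) k)
    (- (eps ^+ 2 * lambda k `^ alpha * coef Om phi (v t) k) - coef Om phi (w t) k).
Proof. exact: (coef_ode oOm bOm onb cN NL hu). Qed.

(** M is chosen such that [-M, M] contains the initial values and N points out of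
it. The gap energy then remains 0, and continuity in space gives the bound at
every point. *)
Lemma cubic_flow_bounded : exists2 M : R, 0 <= M & forall t x, Om x -> `|v t x| <= M.
Proof.
have [uC _ _ _] := hu.
have [B HB] := C0_bounded bOm (uC 0 (lexx 0)).
pose M := `|B| + `|p| + `|q|.
have M0 : 0 <= M by rewrite !addr_ge0.
exists M => // t x Ox.
have v0 y : Om y -> `|v 0 y| <= M.
  move=> Oy; rewrite /v maxxx; apply: le_trans (HB y (subset_closure Oy)) _.
  by apply: le_trans (ler_norm B) _; rewrite /M -addrA lerDl addr_ge0.
have pM : `|p| <= M by rewrite /M addrAC lerDr addr_ge0.
have qM : `|q| <= M by rewrite /M lerDr addr_ge0.
have sign s y : Om y -> 0 <= gap M (v s y) * w s y by move=> _; exact: cubic_sign.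
have mt : 0 <= Num.max t 0 :> R by rewrite le_max lexx orbT.
have := gap_energy_curve oOm bOm eig M0 al01 uv uw ode sign v0 mt.
have -> : v (Num.max t 0) = v t by rewrite /v [Num.max (Num.max t 0) 0]max_l.
move=> E.
apply: (gap_eq0 M0).
apply: (continuous_ae0 oOm (f := gap M \o v t)) => //.
- move=> y Oy; apply: continuous_comp; last exact: gap_continuous.
  exact: (C0_continuous oOm (uC _ mt)).
- apply: (L2_gap oOm M0); exact: uniform_curve_L2.
- by rewrite /L2norm; move: E; rewrite /gap_energy => ->; rewrite sqrtr0.
Qed.

Lemma cubic_flow_omega_limit : omega_limit Om u !=set0 /\
  forall y, omega_limit Om u y -> stationary_solution Om lambda phi alpha eps N y.
Proof.
have /andP[al0 _] := al01.
have [M M0 vM] := cubic_flow_bounded.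
have [L L0 HL] := NL M.
have [CF HF] := @quartic_bounded _ p q M.
pose K := 3 * M ^+ 2 / 2 + `|p + q| * M + `|p * q|.
have K0 : 0 <= K by rewrite !addr_ge0 ?divr_ge0 ?mulr_ge0// exprn_ge0.
have FN a b : `|a| <= M -> `|b| <= M -> F b - F a <= N a * (b - a) + K * (b - a) ^+ 2.
  exact: quartic_tangent.
have vH t : 0 < t -> Halpha Om lambda phi alpha (v t).
  by move=> t0; rewrite /v max_l ?(ltW t0)//; exact: hmem.
(* Both L delta and K delta are at most 1/8. *)
pose delta := (8 * (L + K + 1))^-1.
have LK : 0 < L + K + 1 by rewrite ltr_wpDl// addr_ge0.
have delta0 : 0 < delta by rewrite invr_gt0 mulr_gt0.
have small X : 0 <= X -> X <= L + K + 1 -> X * delta <= 8^-1.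
  move=> X0 XLK; rewrite /delta invfM mulrCA ger_pMr ?invr_gt0//.
  by rewrite ler_pdivrMr// mul1r.
have Kd : K * delta <= 8^-1 by apply: small => //; lra.
have Ld : L ^+ 2 * delta ^+ 2 <= 4^-1.
  have h : L * delta <= 8^-1 by apply: small => //; lra.
  have h0 : 0 <= L * delta by rewrite mulr_ge0// ltW.
  by rewrite -exprMn; move: h h0; move: (L * delta) => r; nra.
have cF : continuous F by exact: continuous_quartic.
have decay := displacement_decay oOm bOm onb uv uw ode M0 vM L0 HL K0 cF FN HF vH delta0 Ld Kd.
have [B HB] := quadratic_energy_bounded oOm bOm onb uv uw ode M0 vM L0 HL K0 cF FN HF vH delta0 Ld Kd.
have quad t n : 1 <= t -> \sum_(k < n) lambda k `^ alpha * coef Om phi (v t) k ^+ 2 <= 2 * B / eps ^+ 2.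
  move=> t1; have t0 : 0 < t := lt_le_trans ltr01 t1.
  have h := le_trans (truncated_energy_le eps vH n t0) (HB t t1).
  rewrite ler_pdivlMr ?exprn_gt0// mulrC mulr_sumr -(@ler_pM2r _ 2^-1) ?invr_gt0// mulr_suml.
  rewrite mulrAC divff// mul1r; apply: le_trans h.
  by apply: ler_sum => k _; rewrite !mulrA.
have stat := @omega_limit_stationary _ _ oOm bOm _ _ eig alpha eps v N M L delta _ uv uw M0 L0 cN HL vM ode delta0 decay quad.
split; last first.
  move=> y [Ly [tn [tnoo tny]]].
  have tnoo' T : exists n0, forall n, (n0 <= n)%N -> T <= tn n.
    by have /cvgryPge/(_ T)[n0 _ Hn] := tnoo; exists n0.
  have [n1 Hn1] := tnoo' 1.
  (* Times are at least 1 from rank n1 on. *)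
  apply: (stat y (fun n => tn (n + n1)%N)) => //.
  - by move=> n; apply: Hn1; rewrite leq_addl.
  - move=> T; have [n0 Hn0] := tnoo' T; exists n0 => n nn; apply: Hn0.
    by rewrite (leq_trans nn)// leq_addr.
  - have -> : (fun n => v (tn (n + n1)%N)) = (fun n => u (tn (n + n1)%N)).
      apply/funext => n; rewrite /v max_l// (le_trans ler01)// Hn1// leq_addl//.
    by move: tny; rewrite /L2cvg -(cvg_shiftn n1).
have Lv s : L2 Om (v s) by exact: uniform_curve_L2.
have vb s : L2dot Om (v s) (v s) <= L2dot Om (fun=> M) (fun=> M).
  apply: L2dot_le => //; first exact: L2_cst.
  by move=> x Ox; rewrite (ger0_norm M0) vM.
have quadS j n : \sum_(k < n) lambda k `^ alpha * coef Om phi (v j.+1%:R) k ^+ 2 <= 2 * B / eps ^+ 2.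
  by apply: quad; rewrite ler1n.
have [m [y [mj Ly ym]]] := relative_compactness oOm bOm eig al0 (f := fun j => v j.+1%:R)
  (fun j => Lv _) (fun j => vb _) quadS.
exists y; split => //; exists (fun j => (m j).+1%:R); split.
  apply/cvgryPge => T; have := @cvgr_idn R; move=> /cvgryPge/(_ T)[n0 _ Hn].
  exists n0 => // n /= nn; apply: le_trans (Hn n nn) _; rewrite ler_nat.
  by rewrite (leq_trans (mj n)).
have -> : (fun n => u (m n).+1%:R) = (fun n => v (m n).+1%:R).
  by apply/funext => n; rewrite /v max_l.
exact: ym.
Qed.

End CubicFlow.

Theorem proposition4p1 (R : realType) (Omega : set (R * R))
    (lambda : nat -> R) (phi : nat -> R * R -> R)
    (alpha eps u_minus u_mid u_plus : R)
    (u0 : R * R -> R) (u : R -> R * R -> R)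
    (hOmega : lipschitz_domain Omega)
    (heig : dirichlet_eigenbasis Omega lambda phi)
    (halpha : 0 < alpha < 1) (heps : 0 < eps)
    (hlow : u_minus < u_mid) (hhigh : u_mid < u_plus)
    (hu0 : C0 Omega u0)
    (hu : global_solution Omega lambda phi alpha eps
            (reaction u_minus u_mid u_plus) u0 u)
    (hmem : forall t, 0 < t -> Halpha Omega lambda phi alpha (u t))
    (hcont : continuous_curve (Halpha_norm Omega lambda phi alpha)
               `]0, +oo[ u) :
  omega_limit Omega u !=set0 /\
  forall y, omega_limit Omega u y ->
    stationary_solution Omega lambda phi alpha eps
      (reaction u_minus u_mid u_plus) y.
Proof.
have [_ oOm bOm _] := hOmega.
have E : reaction u_minus u_mid u_plus =
    (fun r => r * (r + (u_minus - u_mid)) * (r + (u_minus - u_plus))).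
  by apply/funext => r; rewrite /reaction !addrA.
rewrite E in hu *; exact: (cubic_flow_omega_limit oOm bOm heig halpha heps hu hmem).
Qed.
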